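(* Let $A\in SL(2,\mathbb{Z})$ be a hyperbolic matrix with eigenvalues $0<\frac1\lambda<1<\lambda$, let $f_A\colon S\to S$ be the diffeomorphism obtained from the induced linear Anosov diffeomorphism of $\mathbb{T}^2$ by blowing up the fixed point $p=(0,0)$, and let $p_1,p_2$ be the two fixed points of $f_A$ on the exceptional fiber. Let $\mathcal{M}_{f_A}$ be the set of $f_A$-invariant Borel probability measures on $S$. Then a measure $\mu\in\mathcal{M}_{f_A}$ is accumulated in the weak$*$ topology by ergodic measures $\nu_n$ (that is, $\mu=\lim_n\nu_n$ for a sequence of ergodic $\nu_n\in\mathcal{M}_{f_A}$) if, and only if, \begin{itemize} \item either $\mu\in\{\delta_{p_1},\delta_{p_2}\}$, and hence $\nu_n=\mu$ for $n$ large enough, \item or $\mu(\{p_1\})=\mu(\{p_2\})$, in which case $\mu$ is the weak$*$ limit of a sequence of invariant probability measures supported on periodic orbits whose Lyapunov exponents are $\pm\log\lambda$. \end{itemize}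
   Context: The matrix $A$ induces a linear Anosov diffeomorphism $A\colon\mathbb{T}^2\to\mathbb{T}^2$, $\mathbb{T}^2=\mathbb{R}^2/\mathbb{Z}^2$, with fixed point $p=(0,0)$. $S$ denotes the closed (non-orientable) real-analytic surface obtained from $\mathbb{T}^2$ by (real) blowing up the point $p$, with canonical analytic projection $\pi\colon S\to\mathbb{T}^2$; $\pi$ is a diffeomorphism over $\mathbb{T}^2\setminus\{p\}$, and the exceptional fiber $C=\pi^{-1}(p)$ is canonically identified with $\mathbb{RP}^1$ (the lines in $T_p\mathbb{T}^2$). $A$ has a unique continuous lift $f_A\colon S\to S$ (with $\pi\circ f_A=A\circ\pi$), which is an analytic diffeomorphism. The restriction of $f_A$ to $C$ has exactly two fixed points $p_1,p_2$ (corresponding to the two eigendirections of $A$); they are hyperbolic saddles of $f_A$ with eigenvalues $0<\frac1{\lambda^2}<1<\lambda$ at $p_1$ and $0<\frac1\lambda<1<\lambda^2$ at $p_2$. *)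

(* Defs.v *)
From HB Require Import structures.
From mathcomp Require Import all_boot all_order all_algebra.
From mathcomp Require Import generic_quotient.
From mathcomp Require Import all_classical all_reals all_analysis.
Import Order.TTheory GRing.Theory Num.Theory.
Import numFieldNormedType.Exports.

Set Implicit Arguments.
Unset Strict Implicit.
Unset Printing Implicit Defensive.

Local Open Scope classical_set_scope.
Local Open Scope ring_scope.
Local Open Scope quotient_scope.

Section Torus.
Context {R : realType}.

Definition lattice (v : 'rV[R]_2) : Prop :=
  exists n : 'rV[int]_2, v = map_mx intr n.

Lemma lattice0 : lattice 0.
Proof. by exists 0; rewrite map_mx0. Qed.

Lemma latticeN v : lattice v -> lattice (- v).
Proof. by case=> n ->; exists (- n); rewrite map_mxN. Qed.

Lemma latticeD v w : lattice v -> lattice w -> lattice (v + w).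
Proof. by case=> m -> [n ->]; exists (m + n); rewrite map_mxD. Qed.

Lemma latticeB v w : lattice v -> lattice w -> lattice (v - w).
Proof. by move=> hv hw; apply: latticeD => //; exact: latticeN. Qed.

Definition torus_eq (v w : 'rV[R]_2) : bool := `[< lattice (v - w) >].

Lemma torus_eq_refl : reflexive torus_eq.
Proof. by move=> v; apply/asboolP; rewrite subrr; exact: lattice0. Qed.

Lemma torus_eq_sym : symmetric torus_eq.
Proof.
by move=> v w; apply/asboolP/asboolP => /latticeN; rewrite opprB.
Qed.

Lemma torus_eq_trans : transitive torus_eq.
Proof.
move=> w v z /asboolP h /asboolP k; apply/asboolP.
by have := latticeD h k; rewrite addrA subrK.
Qed.

Canonical torus_eqr := EquivRel torus_eq torus_eq_refl torus_eq_sym torus_eq_trans.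

Definition torus : Type := quotient_topology {eq_quot torus_eqr}.
HB.instance Definition _ := Topological.on torus.
HB.instance Definition _ := Quotient.on torus.

Definition torus_pt (v : 'rV[R]_2) : torus := \pi_torus v.

Definition origin : torus := torus_pt 0.

(* Points of the plane are row vectors, so v |-> A v reads v *m A^T. *)
Definition mxact (A : 'M[int]_2) (v : 'rV[R]_2) : 'rV[R]_2 :=
  v *m (map_mx intr A)^T.

Definition torus_map (A : 'M[int]_2) (x : torus) : torus :=
  torus_pt (mxact A (repr x)).

End Torus.
Arguments torus R : clear implicits.

Section Surface.
Context {R : realType}.

(* The blow-up of the plane at 0 is {(v, L) | v \in L}, L a line through 0.  A
   pair (t, u) with u != 0 stands for (t u, R u): these are homogeneous
   coordinates on the blow-up seen as the tautological line bundle over RP^1.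
   The points lying over non-zero lattice vectors are discarded, since the
   quotient below glues the rest of this open set over the punctured torus. *)
Definition blow_dom : set (R * 'rV[R]_2) :=
  [set x | x.2 != 0 /\ (lattice (x.1 *: x.2) -> x.1 = 0)].

Lemma blow_base_dom : blow_dom (0, const_mx 1).
Proof.
split => //=; apply/eqP => /matrixP /(_ ord0 ord0).
by rewrite !mxE => /eqP; rewrite oner_eq0.
Qed.

Definition blow_base : set_type blow_dom := SigSub (mem_set blow_base_dom).

(* Off the exceptional fibre points are identified when they agree modulo Z^2;
   on it, when they define the same line. *)
Definition surf_eq (x y : set_type blow_dom) : bool :=
  let: (t, u) := val x in let: (s, w) := val y in
  `[< [/\ t != 0, s != 0 & lattice (t *: u - s *: w)] \/
      [/\ t = 0, s = 0 & exists c : R, u = c *: w] >].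

Lemma blow_domP (x : set_type blow_dom) : blow_dom (val x).
Proof. exact: set_mem (valP x). Qed.

Lemma surf_eq_refl : reflexive surf_eq.
Proof.
move=> x; rewrite /surf_eq; case: (val x) => t u; apply/asboolP.
have [->|t0] := eqVneq t 0.
  by right; split => //; exists 1; rewrite scale1r.
by left; split => //; rewrite subrr; exact: lattice0.
Qed.

Lemma surf_eq_sym : symmetric surf_eq.
Proof.
suff H x y : surf_eq x y -> surf_eq y x by move=> x y; apply/idP/idP; exact: H.
rewrite /surf_eq; have [+ _] := blow_domP x.
case: (val x) => t u; case: (val y) => s w /= u0 /asboolP H; apply/asboolP.
case: H => [[t0 s0 /latticeN]|[t0 s0 [c uE]]].
  by rewrite opprB => h; left.
right; split => //; exists c^-1; rewrite uE scalerA mulVf ?scale1r//.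
by apply: contraNneq u0 => c0; rewrite uE c0 scale0r.
Qed.

Lemma surf_eq_trans : transitive surf_eq.
Proof.
move=> y x z; rewrite /surf_eq.
case: (val x) => t u; case: (val y) => s w; case: (val z) => r q.
move=> /asboolP H /asboolP K; apply/asboolP; move: H K.
case=> [[t0 s0 h]|[t0 s0 [c uE]]]; case=> [[s0' r0 k]|[s0' r0 [d wE]]].
- by left; split => //; have := latticeD h k; rewrite addrA subrK.
- by rewrite s0' eqxx in s0.
- by rewrite s0 eqxx in s0'.
- by right; split => //; exists (c * d); rewrite uE wE scalerA.
Qed.

Canonical surf_eqr := EquivRel surf_eq surf_eq_refl surf_eq_sym surf_eq_trans.

Definition surface : Type := quotient_topology {eq_quot surf_eqr}.
HB.instance Definition _ := Topological.on surface.
HB.instance Definition _ := Quotient.on surface.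
HB.instance Definition _ := isPointed.Build surface (\pi_surface blow_base).

(* Only meaningful when (t, u) is in blow_dom. *)
Definition surf_pt (t : R) (u : 'rV[R]_2) : surface :=
  \pi_surface (insubd blow_base (t, u)).

Definition blowdown (s : surface) : torus R :=
  let: (t, u) := val (repr s) in torus_pt (t *: u).

Definition exceptional : set surface := blowdown @^-1` [set origin].

(* f_A : (v, L) |-> (A v, A L). *)
Definition blowup_map (A : 'M[int]_2) (s : surface) : surface :=
  let: (t, u) := val (repr s) in surf_pt t (mxact A u).

End Surface.
Arguments surface R : clear implicits.
Arguments blow_dom R : clear implicits.
Arguments exceptional R : clear implicits.

Section SurfaceTheory.
Context {R : realType}.
Implicit Types (t : R) (u v : 'rV[R]_2) (A : 'M[int]_2).

Lemma val_insub_blow t u :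
  blow_dom R (t, u) -> val (insubd (@blow_base R) (t, u)) = (t, u).
Proof. by move=> h; rewrite insubdK//; exact: mem_set. Qed.

Lemma torus_ptP v w : torus_pt v = torus_pt w <-> lattice (v - w).
Proof.
split; first by move/eqmodP/asboolP.
by move=> h; apply/eqmodP/asboolP.
Qed.

Lemma surf_ptP t u s w : blow_dom R (t, u) -> blow_dom R (s, w) ->
  surf_pt t u = surf_pt s w <->
  [/\ t != 0, s != 0 & lattice (t *: u - s *: w)] \/
  [/\ t = 0, s = 0 & exists c : R, u = c *: w].
Proof.
move=> h k; split.
  by move/eqmodP; rewrite /= /surf_eq !val_insub_blow// => /asboolP.
by move=> H; apply/eqmodP; rewrite /= /surf_eq !val_insub_blow//; apply/asboolP.
Qed.

Lemma surf_pt_surj (s : surface R) :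
  exists t u, blow_dom R (t, u) /\ s = surf_pt t u.
Proof.
case E : (val (repr s)) => [t u]; exists t, u.
have h : blow_dom R (t, u) by rewrite -E; exact: blow_domP.
by split => //; rewrite /surf_pt -E valKd reprK.
Qed.

Lemma repr_surf_pt t u : blow_dom R (t, u) ->
  exists s w, [/\ val (repr (surf_pt t u)) = (s, w), blow_dom R (s, w) &
    surf_pt t u = surf_pt s w].
Proof.
move=> h; case E : (val (repr (surf_pt t u))) => [s w]; exists s, w; split => //.
  by rewrite -E; exact: blow_domP.
by rewrite [RHS]/surf_pt -E valKd reprK.
Qed.

Lemma blowdown_pt t u : blow_dom R (t, u) ->
  blowdown (surf_pt t u) = torus_pt (t *: u).
Proof.
move=> h; have [s [w [E k e]]] := repr_surf_pt h.
rewrite /blowdown E; apply/esym/torus_ptP.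
case/(surf_ptP h k) : e => [[]//|[-> -> _]].
by rewrite !scale0r subrr; exact: lattice0.
Qed.

Lemma exceptionalP t u : blow_dom R (t, u) ->
  exceptional R (surf_pt t u) <-> t = 0.
Proof.
move=> h; rewrite /exceptional /= blowdown_pt//; split.
  by move/torus_ptP; rewrite subr0; exact: h.2.
by move=> ->; rewrite scale0r.
Qed.

Lemma blowdown_inj (x y : surface R) : ~ exceptional R x -> ~ exceptional R y ->
  blowdown x = blowdown y -> x = y.
Proof.
have [t [u [h ->]]] := surf_pt_surj x; have [s [w [k ->]]] := surf_pt_surj y.
move=> /(exceptionalP h)/eqP t0 /(exceptionalP k)/eqP s0.
by rewrite !blowdown_pt// => /torus_ptP l; apply/(surf_ptP h k); left.
Qed.

Lemma blowdown_surj (x : torus R) : exists s, blowdown s = x.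
Proof.
have -> : x = torus_pt (repr x) by rewrite /torus_pt reprK.
have [l|nl] := pselect (lattice (repr x)).
  exists (surf_pt 0 (const_mx 1)); rewrite blowdown_pt; last exact: blow_base_dom.
  by apply/torus_ptP; rewrite scale0r sub0r; exact: latticeN.
exists (surf_pt 1 (repr x)); rewrite blowdown_pt ?scale1r//.
split => /=; last by rewrite scale1r.
by apply/eqP => e; apply: nl; rewrite e; exact: lattice0.
Qed.

Let fst_val_continuous :
  continuous (fun x : set_type (blow_dom R) => (val x).1).
Proof.
move=> x.
have vc : continuous (set_val : set_type (blow_dom R) -> R * 'rV[R]_2).
  exact: initial_continuous.
have fc : continuous (fst : R * 'rV[R]_2 -> R) by move=> z; exact: cvg_fst.
exact: (continuous_comp (vc x) (fc _)).
Qed.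

Let snd_val_continuous :
  continuous (fun x : set_type (blow_dom R) => (val x).2).
Proof.
move=> x.
have vc : continuous (set_val : set_type (blow_dom R) -> R * 'rV[R]_2).
  exact: initial_continuous.
have fc : continuous (snd : R * 'rV[R]_2 -> 'rV[R]_2) by move=> z; exact: cvg_snd.
exact: (continuous_comp (vc x) (fc _)).
Qed.

Lemma blowdown_continuous : continuous (@blowdown R).
Proof.
apply/quotient_continuous.
have -> : @blowdown R \o \pi_(surface R) =
    (fun x : set_type (blow_dom R) => torus_pt ((val x).1 *: (val x).2)).
  apply/funext => x /=; case E : (val x) => [t u] /=.
  have h : blow_dom R (t, u) by rewrite -E; exact: blow_domP.
  by rewrite -blowdown_pt// /surf_pt -E valKd.
have sc : continuous (fun x : set_type (blow_dom R) => (val x).1 *: (val x).2).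
  by move=> x; exact: (cvgZ (@fst_val_continuous x) (@snd_val_continuous x)).
by move=> x; apply: continuous_comp; [exact: sc|exact: pi_continuous].
Qed.

Lemma mxact_continuous A : continuous (@mxact R A).
Proof.
rewrite /mxact.
have -> : (fun w : 'rV[R]_2 => w *m (map_mx intr A)^T) =
    (fun w => w ord0 ord0 *: row ord0 (map_mx intr A)^T +
              w ord0 (lift ord0 ord0) *: row (lift ord0 ord0) (map_mx intr A)^T).
  by apply/funext => w; rewrite mulmx_sum_row !big_ord_recl big_ord0 addr0.
have rc (i : 'I_2) :
    continuous (fun w : 'rV[R]_2 => w ord0 i *: row i (map_mx intr A)^T).
  move=> v; apply: (@continuous_comp _ _ _ (fun w : 'rV[R]_2 => w ord0 i)
    (fun k : R => k *: row i (map_mx intr A)^T)).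
    exact: coord_continuous.
  exact: scalel_continuous.
by move=> v; exact: (cvgD (@rc _ v) (@rc _ v)).
Qed.

Lemma lattice_act A v : lattice v -> lattice (mxact A v).
Proof.
by case=> n ->; exists (n *m A^T); rewrite /mxact map_mxM map_trmx.
Qed.

Lemma mxactK A : \det A = 1 ->
  cancel (@mxact R A) (mxact (\adj A)).
Proof.
move=> dA v; rewrite /mxact -mulmxA -trmx_mul -map_mxM mul_adj_mx dA.
by rewrite map_scalar_mx trmx1 mulmx1.
Qed.

Lemma mxactZ A t u : mxact A (t *: u) = t *: mxact A u.
Proof. by rewrite /mxact scalemxAl. Qed.

Lemma mxactB A u v : mxact A (u - v) = mxact A u - mxact A v.
Proof. by rewrite /mxact mulmxBl. Qed.

Lemma blow_dom_act A t u : \det A = 1 ->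
  blow_dom R (t, u) -> blow_dom R (t, mxact A u).
Proof.
move=> dA [/= u0 l]; split => /=.
  apply: contra_neq u0 => e.
  by rewrite -(mxactK dA u) e /mxact mul0mx.
move=> h; apply: l; rewrite -(mxactK dA (t *: u)) mxactZ.
exact: lattice_act.
Qed.

Lemma blowup_map_pt A t u : \det A = 1 -> blow_dom R (t, u) ->
  blowup_map A (surf_pt t u) = surf_pt t (mxact A u).
Proof.
move=> dA h; have [s [w [E k e]]] := repr_surf_pt h.
rewrite /blowup_map E; apply/esym/surf_ptP; [exact: blow_dom_act..|].
case/(surf_ptP h k) : e => [[t0 s0 l]|[t0 s0 [c ->]]].
  by left; split => //; rewrite -!mxactZ -mxactB; exact: lattice_act.
by right; split => //; exists c; rewrite mxactZ.
Qed.

Lemma torus_map_pt A v : torus_map A (torus_pt v) = torus_pt (mxact A v) :> torus R.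
Proof.
apply/torus_ptP; rewrite -mxactB; apply: lattice_act.
by apply/torus_ptP; rewrite /torus_pt reprK.
Qed.

Lemma blowup_map_lift A (s : surface R) : \det A = 1 ->
  blowdown (blowup_map A s) = torus_map A (blowdown s).
Proof.
move=> dA; have [t [u [h ->]]] := surf_pt_surj s.
rewrite blowup_map_pt// !blowdown_pt//; last exact: blow_dom_act.
by rewrite torus_map_pt mxactZ.
Qed.

Lemma blowup_map_continuous A : \det A = 1 ->
  continuous (blowup_map A : surface R -> surface R).
Proof.
move=> dA; apply/quotient_continuous.
have Fdom (x : set_type (blow_dom R)) :
    ((val x).1, mxact A (val x).2) \in blow_dom R.
  apply/mem_set/blow_dom_act => //.
  by rewrite -surjective_pairing; exact: blow_domP.
pose F x : set_type (blow_dom R) := SigSub (Fdom x).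
have -> : blowup_map A \o \pi_(surface R) = \pi_(surface R) \o F.
  apply/funext => x /=.
  have e : x = insubd (@blow_base R) ((val x).1, (val x).2).
    by rewrite -surjective_pairing valKd.
  rewrite [in LHS]e -/(surf_pt _ _) blowup_map_pt//; last first.
    by rewrite -surjective_pairing; exact: blow_domP.
  by rewrite /surf_pt; congr (\pi _); apply: val_inj; rewrite insubdK.
move=> x; apply: continuous_comp; last exact: pi_continuous.
move: x; apply: continuous_comp_initial => x.
have ac : continuous (fun y : set_type (blow_dom R) => mxact A (val y).2).
  by move=> y; apply: continuous_comp;
    [exact: snd_val_continuous|exact: mxact_continuous].
exact: (cvg_pair (@fst_val_continuous x) (@ac x)).
Qed.

End SurfaceTheory.

Notation borel T := (g_sigma_algebraType (@open T)).

Section Measures.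
Context {R : realType} {T : ptopologicalType}.
Implicit Types (f : T -> T) (mu nu : probability (borel T) R).

Definition invariant_measure f mu : Prop :=
  forall B : set (borel T), measurable B -> mu (f @^-1` B) = mu B.

Definition ergodic_measure f mu : Prop :=
  invariant_measure f mu /\
  forall B : set (borel T), measurable B -> f @^-1` B = B ->
    mu B = 0%E \/ mu B = 1%E.

(* Values on non-measurable sets are irrelevant, so measures are not compared
   with Leibniz equality. *)
Definition same_measure (mu nu : set (borel T) -> \bar R) : Prop :=
  forall B : set (borel T), measurable B -> mu B = nu B.

Definition weak_star_cvg (nu : nat -> probability (borel T) R) mu : Prop :=
  forall g : T -> R, continuous g ->
    (\int[nu n]_x (g x)%:E)%E @[n --> \oo] --> (\int[mu]_x (g x)%:E)%E.

Definition full_orbit f (x : T) : set T := [set iter k f x | k in [set: nat]].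

Definition periodic_point f (x : T) : Prop :=
  exists2 m : nat, (0 < m)%N & iter m f x = x.

End Measures.

Section Lyapunov.
Context {R : realType}.

(* The two affine charts (s, m) |-> ((s, s m), [1 : m]) and
   (s, m) |-> ((s m, s), [m : 1]) of the blow-up.  Where (s, m) lies over
   blow_dom they are local homeomorphisms onto the surface, and they define its
   analytic structure. *)
Definition surf_chart (i : 'I_2) (y : 'rV[R]_2) : surface R :=
  surf_pt (y ord0 ord0) (\row_(j < 2) (if j == i then 1 else y ord0 ord_max)).

(* The images of this compact set by the two charts cover the surface. *)
Definition chart_box : set 'rV[R]_2 :=
  [set y | `|y ord0 ord0| <= 2^-1 /\ `|y ord0 ord_max| <= 1].

(* J is the matrix, in the charts i at y and j at z, of the differential of g
   (acting on row vectors). *)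
Definition chart_differential (g : surface R -> surface R)
    (i : 'I_2) (y : 'rV[R]_2) (j : 'I_2) (z : 'rV[R]_2) (J : 'M[R]_2) : Prop :=
  exists G : 'rV[R]_2 -> 'rV[R]_2,
    [/\ G y = z, differentiable G y,
        \forall y' \near y, surf_chart j (G y') = g (surf_chart i y') &
        J = jacobian G y].

(* chi = lim (1/n) log |D_x f^n v| for some tangent vector v != 0.  Norms are
   read in the charts above the points of the compact set chart_box, where they
   are uniformly comparable with those of any Riemannian metric. *)
Definition lyapunov_exponent (f : surface R -> surface R) (x : surface R)
    (chi : R) : Prop :=
  exists (i : nat -> 'I_2) (y : nat -> 'rV[R]_2) (J : nat -> 'M[R]_2)
         (v : 'rV[R]_2),
    [/\ v != 0, surf_chart (i 0%N) (y 0%N) = x,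
        forall n, chart_box (y n),
        forall n, chart_differential (iter n f) (i 0%N) (y 0%N) (i n) (y n) (J n) &
        ln `|v *m J n| / n%:R @[n --> \oo] --> chi].

End Lyapunov.

(* Main.v *)
Require Import Defs.
From HB Require Import structures.
From mathcomp Require Import all_boot all_order all_algebra.
From mathcomp Require Import all_classical all_reals all_analysis.
From mathcomp Require Import measurable_realfun generic_quotient zify ring lra.
Import Order.TTheory GRing.Theory Num.Theory.
Import numFieldNormedType.Exports.

Local Open Scope classical_set_scope.
Local Open Scope ring_scope.
Local Open Scope quotient_scope.

(** Write f for the lifted map, pu and ps for its fixed points on the
    exceptional fibre (the unstable and the stable eigendirection), and l for
    the expanding eigenvalue.

    Everything rests on one continuous function on the surface, the expansion
    rate phi = [expansion]: the logarithmic growth under f of the distance to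
    the origin of the torus.  That distance degenerates on the fibre, but its
    growth rate does not; there it is the growth rate ln (|A u| / |u|) of the
    line R u.  Off the fibre phi is the coboundary of the logarithm of the
    distance.  On the fibre, for a norm adapted to the eigendirections, phi
    increases along orbits, strictly except at pu and ps, where it equals
    ln l and - ln l.  A truncation argument ([coboundary_integral0]) then shows
    that, for every invariant probability nu,

      mean of phi = ln l * (nu {pu} - nu {ps})          ([expansion_mean]).

    Necessity.  An ergodic measure gives mass 0 or 1 to pu and to ps, so its
    mean of phi is 0, ln l or - ln l.  These values form a discrete closed set
    and the mean of phi is weak-star continuous.  Hence a limit mu of ergodic
    measures has mu {pu} - mu {ps} in {0, 1, -1}; the last two cases are the
    Dirac masses, and then the sequence is eventually constant.

    Sufficiency.  Let mu {pu} = mu {ps}.  On the torus, orbit segments of length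
    N of finitely many points, chosen so that their averages imitate mu
    ([finite_sample]), are concatenated into a closed pseudo-orbit with one jump
    per segment.  Because A is linear and hyperbolic, there is a true periodic
    orbit whose total distance to the pseudo-orbit is bounded by the total size
    of the jumps ([shadowing]), so on average it is O(1/N)-close.  It can be
    kept away from the origin by an argument modulo 2 ([closing_lemma]).  This
    gives periodic orbits that equidistribute towards the image of mu on the
    torus ([periodic_equidistribution]).

    They lift to the surface, and it remains to control continuous functions g
    near the fibre ([off_fibre_criterion]).  Subtracting a constant and a
    multiple of phi, which changes all the means in the same way since
    mu {pu} = mu {ps}, one may assume that g vanishes at pu and ps.  As phi
    increases along fibre orbits, |g| is dominated on the fibre by a small
    constant plus a multiple of the increment of phi, so the Birkhoff averages
    of g are uniformly small on the fibre ([birkhoff_fibre]), hence near it.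
    They have the same mean as g and may be cut off near the fibre, which
    leaves a function that comes from the torus.

    Finally, off the fibre the charts are local lifts of the torus, in which f^n
    is A^n up to a lattice translation.  A periodic orbit off the fibre stays at
    a positive distance from it, so chart norms along it are comparable with the
    planar norm, and its exponents are those of A ([periodic_exponents]). *)

Set Implicit Arguments.
Unset Strict Implicit.
Unset Printing Implicit Defensive.

(** * Eigencoordinates of a hyperbolic matrix *)

(** [cu] and [cs] are coordinates along the unstable and the stable line, with
    dual basis [bu], [bs]. Bounding the basis by 1 makes |cu| + |cs| dominate
    the sup norm, so that it is at least 1 on nonzero lattice vectors. *)
Record eigenframe (R : realType) (A : 'M[int]_2) (lam : R) := Eigenframe {
  cu : {scalar 'rV[R]_2};
  cs : {scalar 'rV[R]_2};
  bu : 'rV[R]_2;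
  bs : 'rV[R]_2;
  frame_dec : forall v, v = cu v *: bu + cs v *: bs;
  cu_bu : cu bu = 1;
  cs_bu : cs bu = 0;
  cu_bs : cu bs = 0;
  cs_bs : cs bs = 1;
  cu_act : forall v, cu (mxact A v) = lam * cu v;
  cs_act : forall v, cs (mxact A v) = lam^-1 * cs v;
  norm_bu : `|bu| <= 1;
  norm_bs : `|bs| <= 1
}.

Section FrameExists.
Context (R : realType) (A : 'M[int]_2) (lam : R).

Lemma row2P (v w : 'rV[R]_2) :
  v ord0 ord0 = w ord0 ord0 -> v ord0 ord_max = w ord0 ord_max -> v = w.
Proof.
move=> h0 h1; apply/rowP => i; case: (unliftP ord0 i) => [j ->|-> //].
by rewrite (_ : lift ord0 j = ord_max) //; apply/val_inj => /=; case: j => [[]].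
Qed.

(** Left eigenvectors of the matrix are linear forms that the action scales.
    Those of distinct eigenvalues are independent, and their dual basis can be
    rescaled against them. *)
Lemma eigenframe_exists : 1 < lam ->
  eigenvalue (map_mx intr A) lam -> eigenvalue (map_mx intr A) lam^-1 ->
  inhabited (eigenframe A lam).
Proof.
move=> lam1 /eigenvalueP[p pA p0] /eigenvalueP[q qA q0].
have lam0 : 0 < lam by lra.
pose dot (p v : 'rV[R]_2) : R := (v *m p^T) ord0 ord0.
have dotE (a v : 'rV[R]_2) :
    dot a v = v ord0 ord0 * a ord0 ord0 + v ord0 ord_max * a ord0 ord_max.
  rewrite /dot mxE !big_ord_recl big_ord0 addr0 !mxE.
  by rewrite (_ : lift ord0 ord0 = ord_max) //; apply/val_inj.
pose M : R := p ord0 ord0 * q ord0 ord_max - p ord0 ord_max * q ord0 ord0.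
have act_dot (a : 'rV[R]_2) (c : R) v : a *m map_mx intr A = c *: a ->
    dot a (mxact A v) = c * dot a v.
  move=> h; rewrite /dot /mxact -mulmxA -trmx_mul h.
  by rewrite linearZ /= -scalemxAr mxE.
have M0 : M != 0.
  apply/eqP => M0.
  have [c pq] : exists c : R, c != 0 /\ p = c *: q.
    have qn : q ord0 ord0 != 0 \/ q ord0 ord_max != 0.
      have [h0|] := eqVneq (q ord0 ord0) 0; last by left.
      have [h1|] := eqVneq (q ord0 ord_max) 0; last by right.
      by case/eqP: q0; apply: row2P; rewrite mxE.
    have [c pq] : exists c : R, p = c *: q.
      case: qn => qn.
        exists (p ord0 ord0 / q ord0 ord0).
        apply: row2P; rewrite mxE; first by field.
        by move: M0; rewrite /M => /eqP; rewrite subr_eq0 => /eqP h; rewrite mulrAC h mulfK.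
      exists (p ord0 ord_max / q ord0 ord_max).
      apply: row2P; rewrite mxE; last by field.
      by move: M0; rewrite /M => /eqP; rewrite subr_eq0 => /eqP h; rewrite mulrAC -h mulfK.
    exists c; split => //; apply: contraNneq p0 => c0.
    by rewrite pq c0 scale0r.
  case: pq => c0 pq.
  have : lam *: p = lam^-1 *: p.
    by rewrite -pA pq -scalemxAl qA !scalerA mulrC.
  move/eqP; rewrite -subr_eq0 -scalerBl scaler_eq0 (negbTE p0) orbF subr_eq0.
  have : lam^-1 < 1 by rewrite invf_lt1.
  by move=> h /eqP e; move: h; rewrite -e; lra.
have dot_lin (a : 'rV[R]_2) : scalar (dot a).
  by move=> c v w; rewrite !dotE !mxE; ring.
pose bu0 : 'rV[R]_2 := \row_(j < 2) (if j == ord0 then q ord0 ord_max else - q ord0 ord0) .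
pose bs0 : 'rV[R]_2 := \row_(j < 2) (if j == ord0 then - p ord0 ord_max else p ord0 ord0).
(* Dividing by C brings both vectors of the dual basis into the unit ball. *)
pose C := `|M^-1 *: bu0| + `|M^-1 *: bs0| + 1.
have C0 : 0 < C by rewrite ltr_wpDl// addr_ge0.
have Cn : C != 0 by rewrite gt_eqF.
have lin1 : scalar (fun v => C * dot p v).
  by move=> c v w; rewrite dot_lin /=; ring.
have lin2 : scalar (fun v => C * dot q v).
  by move=> c v w; rewrite dot_lin /=; ring.
pose X : {scalar 'rV[R]_2} := HB.pack (fun v => C * dot p v)
  (GRing.isLinear.Build _ _ _ _ (fun v => C * dot p v) lin1).
pose Y : {scalar 'rV[R]_2} := HB.pack (fun v => C * dot q v)
  (GRing.isLinear.Build _ _ _ _ (fun v => C * dot q v) lin2).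
constructor.
apply: (@Eigenframe R A lam X Y ((C^-1 * M^-1) *: bu0) ((C^-1 * M^-1) *: bs0)).
- move=> v; apply: row2P; rewrite /= !dotE !mxE /=; rewrite /M in M0 *; field; rewrite ?M0 ?Cn //.
- by rewrite /= !dotE !mxE /=; rewrite /M in M0 *; field; rewrite ?M0 ?Cn.
- by rewrite /= !dotE !mxE /=; ring.
- by rewrite /= !dotE !mxE /=; ring.
- by rewrite /= !dotE !mxE /=; rewrite /M in M0 *; field; rewrite ?M0 ?Cn.
- by move=> v; rewrite /= (act_dot _ _ _ pA); ring.
- by move=> v; rewrite /= (act_dot _ _ _ qA); ring.
- rewrite -scalerA normrZ gtr0_norm ?invr_gt0// mulrC ler_pdivrMr// mul1r.
  by rewrite /C -addrA lerDl addr_ge0.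
- rewrite -scalerA normrZ gtr0_norm ?invr_gt0// mulrC ler_pdivrMr// mul1r.
  by rewrite /C addrAC lerDr addr_ge0.
Qed.

End FrameExists.

(** * An adapted norm and the distance to the lattice *)

Section Norm.
Context (R : realType) (A : 'M[int]_2) (lam : R) (E : eigenframe A lam).
Implicit Types (v w n : 'rV[R]_2).

Definition enorm v : R := locked (`|cu E v| + `|cs E v|).

Lemma enormE v : enorm v = `|cu E v| + `|cs E v|.
Proof. by rewrite /enorm -lock. Qed.

Lemma enorm_ge0 v : 0 <= enorm v. Proof. by rewrite enormE addr_ge0. Qed.

Lemma enormZ (t : R) v : enorm (t *: v) = `|t| * enorm v.
Proof. by rewrite !enormE !linearZ /= !normrM mulrDr. Qed.

Lemma enorm0 : enorm 0 = 0.
Proof. by rewrite !enormE !linear0 normr0 addr0. Qed.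

Lemma enormN v : enorm (- v) = enorm v.
Proof. by rewrite !enormE !linearN !normrN. Qed.

Lemma enormD v w : enorm (v + w) <= enorm v + enorm w.
Proof. by rewrite !enormE !linearD /= addrACA lerD ?ler_normD. Qed.

Lemma norm_le_enorm v : `|v| <= enorm v.
Proof.
rewrite {1}(frame_dec E v); apply: le_trans (ler_normD _ _) _.
by rewrite enormE !normrZ lerD// ler_piMr// ?norm_bu ?norm_bs.
Qed.

Lemma enorm_eq0 v : (enorm v == 0) = (v == 0).
Proof.
apply/eqP/eqP => [h|->]; last exact: enorm0.
by apply/normr0_eq0/le_anti; rewrite normr_ge0 andbT -h norm_le_enorm.
Qed.

Lemma enorm_gt0 v : (0 < enorm v) = (v != 0).
Proof. by rewrite lt_def enorm_ge0 andbT enorm_eq0. Qed.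

Definition enorm_bound : R :=
  enorm (delta_mx ord0 ord0) + enorm (delta_mx ord0 ord_max).

Lemma coord_le_norm v i : `|v ord0 i| <= `|v|.
Proof.
rewrite [leRHS]/Num.norm /= mx_normrE.
exact: (le_bigmax_cond _ (fun ij : 'I_1 * 'I_2 => `|v ij.1 ij.2|) (j := (ord0, i))).
Qed.

Lemma row2_dec v : v = v ord0 ord0 *: delta_mx ord0 ord0 +
  v ord0 ord_max *: delta_mx ord0 ord_max.
Proof. by apply: row2P; rewrite !mxE /= ?mulr1 ?mulr0 ?addr0 ?add0r. Qed.

Lemma enorm_le v : enorm v <= enorm_bound * `|v|.
Proof.
rewrite {1}(row2_dec v); apply: le_trans (enormD _ _) _.
by rewrite !enormZ /enorm_bound mulrDl lerD// mulrC ler_wpM2l// ?enorm_ge0// coord_le_norm.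
Qed.

Lemma enorm_bound_gt0 : 0 < enorm_bound.
Proof.
rewrite /enorm_bound ltr_pwDl ?enorm_ge0// enorm_gt0.
by apply/eqP => /rowP /(_ ord0); rewrite !mxE /= => /eqP; rewrite oner_eq0.
Qed.

(** The norm dominates the sup norm, which is an integer on the lattice. *)
Lemma lattice_ge1 n : lattice n -> n != 0 -> 1 <= enorm n.
Proof.
move=> [m ->] m0; apply: le_trans (norm_le_enorm _).
have [i mi] : exists i, m ord0 i != 0.
  apply: contrapT => /forallNP h; case/eqP: m0; apply/rowP => i; rewrite !mxE.
  by have /negP/negPn/eqP -> := h i.
apply: le_trans (coord_le_norm _ i); rewrite mxE -intr_norm.
by rewrite -[1]/(1%:~R) ler_int -gtz0_ge1 normr_gt0.
Qed.

Lemma enorm_act v : enorm (mxact A v) = `|lam| * `|cu E v| + `|lam|^-1 * `|cs E v|.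
Proof. by rewrite enormE cu_act cs_act !normrM normfV. Qed.

Hypothesis lam1 : 1 < lam.

Lemma lam_gt0 : 0 < lam. Proof. exact: lt_trans ltr01 lam1. Qed.
Local Hint Resolve lam_gt0 : core.

Lemma lamV_lt1 : lam^-1 < 1. Proof. by rewrite invf_lt1. Qed.

Lemma lamV_gt0 : 0 < lam^-1. Proof. by rewrite invr_gt0. Qed.

Lemma enorm_actE v : enorm (mxact A v) = lam * `|cu E v| + lam^-1 * `|cs E v|.
Proof. by rewrite enorm_act gtr0_norm. Qed.

End Norm.

Section Dist.
Context (R : realType) (A : 'M[int]_2) (lam : R) (E : eigenframe A lam).
Implicit Types (v w n : 'rV[R]_2).
Local Notation enorm := (enorm E).

Definition latdist v : R := locked (inf [set enorm (v - n) | n in lattice]).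

Lemma latdistE v : latdist v = inf [set enorm (v - n) | n in lattice].
Proof. by rewrite /latdist -lock. Qed.

Let has_inf_lat v : has_inf [set enorm (v - n) | n in lattice].
Proof.
split; first by exists (enorm (v - 0)), 0 => //; exact: lattice0.
by exists 0 => _ [n _ <-]; exact: enorm_ge0.
Qed.

Lemma latdist_le v n : lattice n -> latdist v <= enorm (v - n).
Proof. by move=> ln; rewrite latdistE; apply: (inf_lbound (has_inf_lat v).2); exists n. Qed.

Lemma latdist_lt v (r : R) : latdist v < r ->
  exists2 n, lattice n & enorm (v - n) < r.
Proof.
rewrite latdistE => h; have /inf_lt := h => /(_ (has_inf_lat v).1) [_ [n ln <-]] nr.
by exists n.
Qed.

Lemma latdist_ge0 v : 0 <= latdist v.
Proof.
rewrite [leRHS]latdistE; apply: lb_le_inf; first exact: (has_inf_lat v).1.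
by move=> _ [n _ <-]; exact: enorm_ge0.
Qed.

Lemma latdist_le_enorm v : latdist v <= enorm v.
Proof. by rewrite -{2}(subr0 v); apply: latdist_le; exact: lattice0. Qed.

Lemma latdist_per v w : lattice (v - w) -> latdist v = latdist w.
Proof.
move=> l; apply: le_anti; apply/andP; split.
  rewrite [leRHS]latdistE; apply: lb_le_inf; first exact: (has_inf_lat w).1.
  move=> _ [n ln <-]; rewrite (_ : w - n = v - (n + (v - w))).
    by apply: latdist_le; exact: latticeD.
  by apply/rowP => i; rewrite !mxE; ring.
rewrite [leRHS]latdistE; apply: lb_le_inf; first exact: (has_inf_lat v).1.
move=> _ [n ln <-]; rewrite (_ : v - n = w - (n - (v - w))).
  by apply: latdist_le; exact: latticeB.
by apply/rowP => i; rewrite !mxE; ring.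
Qed.

(** An infimum of 1-Lipschitz functions is 1-Lipschitz. *)
Lemma latdist_lip v w : `|latdist v - latdist w| <= enorm (v - w).
Proof.
have H (a b : 'rV[R]_2) : latdist a <= enorm (a - b) + latdist b.
  apply/ler_addgt0Pr => e e0.
  have : latdist b < latdist b + e by rewrite ltrDl.
  move=> /latdist_lt[n ln nb].
  apply: le_trans (latdist_le _ ln) _.
  rewrite (_ : a - n = (a - b) + (b - n)); last by apply/rowP => i; rewrite !mxE; ring.
  by apply: le_trans (enormD _ _ _) _; rewrite -addrA lerD2l ltW.
rewrite ler_norml lerBlDr (H v w) andbT lerNl opprB lerBlDr.
by rewrite -enormN opprB H.
Qed.

(** The origin is the nearest lattice point, since every other one is at
    distance at least 1 from it. *)
Lemma latdist_small v : enorm v <= 2^-1 -> latdist v = enorm v.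
Proof.
move=> h; apply: le_anti; rewrite latdist_le_enorm /=.
rewrite [leRHS]latdistE; apply: lb_le_inf; first exact: (has_inf_lat v).1.
move=> _ [n ln <-]; have [->|n0] := eqVneq n 0; first by rewrite subr0.
have := lattice_ge1 E ln n0; have := enormD E (n - v) v.
by rewrite subrK -[enorm (n - v)]enormN opprB; move: h; set a := enorm _; set b := enorm _; set c := enorm _; lra.
Qed.

Lemma latdist_eq0 v : latdist v = 0 <-> lattice v.
Proof.
split=> [h|l]; last first.
  apply: le_anti; rewrite latdist_ge0 andbT.
  by have := latdist_le v l; rewrite subrr enorm0.
have : latdist v < 2^-1 by rewrite h invr_gt0.
case/latdist_lt => n ln hn.
have e : latdist (v - n) = 0.
  by rewrite -h; apply: latdist_per; rewrite addrAC subrr sub0r; exact: latticeN.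
have /eqP := latdist_small (ltW hn).
by rewrite e eq_sym enorm_eq0 subr_eq0 => /eqP ->.
Qed.

Lemma latdist0 : latdist 0 = 0. Proof. by apply/latdist_eq0; exact: lattice0. Qed.

Lemma latdist_gt0 v : ~ lattice v -> 0 < latdist v.
Proof.
by move=> h; rewrite lt_def latdist_ge0 andbT; apply/eqP => /latdist_eq0.
Qed.

Lemma enorm_near v (e : R) : 0 < e -> \forall w \near v, enorm (v - w) <= e.
Proof.
move=> e0; have d0 : 0 < e / enorm_bound E by rewrite divr_gt0 ?enorm_bound_gt0.
apply/nbhs_ballP; exists (e / enorm_bound E) => //= w.
rewrite -ball_normE /= => /ltW h; apply: le_trans (enorm_le _ _) _.
by rewrite mulrC -ler_pdivlMr ?enorm_bound_gt0.
Qed.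

Lemma lip_continuous (f : 'rV[R]_2 -> R) (k : R) :
  (forall v w, `|f v - f w| <= k * enorm (v - w)) -> continuous f.
Proof.
move=> fl v; apply/(@cvgrPdist_le _ _ _ (nbhs v)) => e e0.
have k0 : 0 < `|k| + 1 by rewrite ltr_wpDl.
have := @enorm_near v (e / (`|k| + 1)) (divr_gt0 e0 k0).
apply: filterS => w /=; rewrite ler_pdivlMr// => h.
apply: le_trans (fl _ _) _; apply: le_trans h; rewrite mulrC.
by rewrite ler_wpM2l ?enorm_ge0// ler_wpDr// ler_norm.
Qed.

Lemma enorm_lip v w : `|enorm v - enorm w| <= enorm (v - w).
Proof.
have := enormD E (v - w) w; have := enormD E (w - v) v.
rewrite !subrK -[enorm (w - v)]enormN opprB => h1 h2.
by rewrite ler_norml; apply/andP; split; lra.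
Qed.

Lemma enorm_continuous : continuous enorm.
Proof. by apply: (@lip_continuous _ 1) => v w; rewrite mul1r enorm_lip. Qed.

Lemma latdist_continuous : continuous latdist.
Proof. by apply: (@lip_continuous _ 1) => v w; rewrite mul1r latdist_lip. Qed.

Lemma lattice_round v : exists2 n, lattice n & `|v - n| <= 2^-1.
Proof.
exists (\row_i ((Num.floor (v ord0 i + 2^-1))%:~R)).
  by exists (\row_i Num.floor (v ord0 i + 2^-1)); apply/rowP => i; rewrite !mxE.
rewrite [leLHS]/Num.norm /= mx_normrE; apply/bigmax_leP; split => //= -[i j] _ /=.
rewrite !mxE (ord1 i) ler_norml.
have := floor_le (v ord0 j + 2^-1); have := floorD1_gt (v ord0 j + 2^-1).
by rewrite intrD /= => h1 h2; apply/andP; split; lra.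
Qed.

Lemma lattice_half v : lattice v -> `|v| <= 2^-1 -> v = 0.
Proof.
move=> [m ->] h; apply/rowP => i; rewrite !mxE.
have := le_trans (coord_le_norm _ i) h; rewrite mxE -intr_norm.
have [->//|mi] := eqVneq (m ord0 i) 0.
have : (1 : R) <= `|m ord0 i|%:~R.
  by rewrite -[1]/(1%:~R) ler_int -gtz0_ge1 normr_gt0.
by lra.
Qed.

End Dist.

(** * Homogeneous coordinates on the blown-up torus *)

Section SurfaceTopology.
Context (R : realType) (A : 'M[int]_2) (lam : R) (E : eigenframe A lam).
Local Notation enorm := (enorm E).
Local Notation latdist := (latdist E).
Implicit Types (t : R) (u v : 'rV[R]_2) (p q : R * 'rV[R]_2) (s : surface R).

Lemma scale_pair_continuous :
  continuous (fun p : R * 'rV[R]_2 => p.1 *: p.2).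
Proof. by move=> p; apply: cvgZ; [exact: cvg_fst|exact: cvg_snd]. Qed.

Lemma latdist_pair_continuous :
  continuous (fun p : R * 'rV[R]_2 => latdist (p.1 *: p.2)).
Proof.
move=> p; apply: (@continuous_comp _ _ _ (fun p : R * 'rV[R]_2 => p.1 *: p.2) latdist).
  exact: scale_pair_continuous.
exact: latdist_continuous.
Qed.

Lemma enorm_pair_continuous :
  continuous (fun p : R * 'rV[R]_2 => enorm (p.1 *: p.2)).
Proof.
move=> p; apply: (@continuous_comp _ _ _ (fun p : R * 'rV[R]_2 => p.1 *: p.2) enorm).
  exact: scale_pair_continuous.
exact: enorm_continuous.
Qed.

Lemma enorm_snd_continuous :
  continuous (fun p : R * 'rV[R]_2 => enorm p.2).
Proof.
move=> p; apply: (@continuous_comp _ _ _ (fun p : R * 'rV[R]_2 => p.2) enorm).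
  exact: cvg_snd.
exact: enorm_continuous.
Qed.

Lemma blow_dom_latdist t u : blow_dom R (t, u) -> t != 0 -> 0 < latdist (t *: u).
Proof.
by move=> [/= u0 l] t0; apply: latdist_gt0 => /l/eqP; rewrite (negbTE t0).
Qed.

Lemma blow_dom_small t u : u != 0 -> enorm (t *: u) <= 2^-1 -> blow_dom R (t, u).
Proof.
move=> u0 h; split => //= l; apply/eqP.
have /eqP := latdist_small h.
rewrite (latdist_eq0 E (t *: u)).2// eq_sym enormZ mulf_eq0 normr_eq0 enorm_eq0.
by rewrite (negbTE u0) orbF.
Qed.

(** Off the fibre the condition says that the distance to the lattice is
    positive; near the fibre it is automatic, since short vectors are not
    lattice vectors. *)
Lemma blow_dom_open : open (blow_dom R).
Proof.
have -> : blow_dom R = [set p | 0 < latdist (p.1 *: p.2)] `|`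
  ([set p | 0 < enorm p.2] `&` [set p | enorm (p.1 *: p.2) < 2^-1]).
  apply/seteqP; split=> [[t u] h|[t u]] /=.
    have [t0|t0] := eqVneq t 0; last by left; exact: blow_dom_latdist.
    right; rewrite enorm_gt0 t0 scale0r enorm0 invr_gt0 ltr0n.
    by split => //; exact: h.1.
  move=> [h|[]].
    split => /=.
      by apply: contraTneq h => ->; rewrite scaler0 latdist0 ltxx.
    by move=> l; move: h; rewrite (latdist_eq0 E _).2// ltxx.
  by rewrite enorm_gt0 => u0 /ltW; exact: blow_dom_small.
apply: openU.
  apply: (open_comp (f := fun p : R * 'rV[R]_2 => latdist (p.1 *: p.2))
    (D := [set x | 0 < x])); last exact: open_gt.
  by move=> p _; exact: latdist_pair_continuous.
apply: openI.
  apply: (open_comp (f := fun p : R * 'rV[R]_2 => enorm p.2)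
    (D := [set x | 0 < x])); last exact: open_gt.
  by move=> p _; exact: enorm_snd_continuous.
apply: (open_comp (f := fun p : R * 'rV[R]_2 => enorm (p.1 *: p.2))
    (D := [set x | x < 2^-1])); last exact: open_lt.
by move=> p _; exact: enorm_pair_continuous.
Qed.

Lemma blow_dom_near p : blow_dom R p -> \forall q \near p, blow_dom R q.
Proof. by move=> h; apply: open_nbhs_nbhs; split => //; exact: blow_dom_open. Qed.

Lemma surf_pt_continuous p : blow_dom R p ->
  surf_pt q.1 q.2 @[q --> p] --> surf_pt p.1 p.2.
Proof.
move=> h U nU.
have [W [oW Wp] WU] : exists2 W, open_nbhs (surf_pt p.1 p.2) W & W `<=` U.
  by move: nU; rewrite nbhsE.
have [B oB BE] : open (\pi_(surface R) @^-1` W) by exact: oW.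
have Bp : B p.
  have : (\pi_(surface R) @^-1` W) (insubd (@blow_base R) (p.1, p.2)) by exact: Wp.
  rewrite -BE /= /set_val /= val_insub_blow; first by rewrite -surjective_pairing.
  by rewrite -surjective_pairing.
have : \forall q \near p, B q by apply: open_nbhs_nbhs.
have := blow_dom_near h.
apply: filterS2 => q hq Bq; apply: WU.
suff : (\pi_(surface R) @^-1` W) (insubd (@blow_base R) (q.1, q.2)) by [].
rewrite -BE /= /set_val /= val_insub_blow; first by rewrite -surjective_pairing.
by rewrite -surjective_pairing.
Qed.

(** This trades the quotient topology for limits in R * R^2, where the usual
    rules apply. *)
Lemma surface_continuous (Z : topologicalType) (g : surface R -> Z) :
  (forall p, blow_dom R p ->
     g (surf_pt q.1 q.2) @[q --> p] --> g (surf_pt p.1 p.2)) ->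
  continuous g.
Proof.
move=> gc; apply/quotient_continuous => x.
have -> : g \o \pi_(surface R) =
    (fun p => g (surf_pt p.1 p.2)) \o (set_val : set_type (blow_dom R) -> R * 'rV[R]_2).
  apply/funext => y /=; congr g; rewrite /surf_pt /set_val /=.
  by rewrite -surjective_pairing valKd.
apply: continuous_comp; first exact: initial_continuous.
by apply: gc; exact: blow_domP.
Qed.

Lemma comp_surf_pt (Z : topologicalType) (g : surface R -> Z) p : continuous g ->
  blow_dom R p -> g (surf_pt q.1 q.2) @[q --> p] --> g (surf_pt p.1 p.2).
Proof.
by move=> gc h; apply: cvg_comp (surf_pt_continuous h) (gc _).
Qed.

(** Meaningful modulo the lattice: it is only composed with periodic
    functions. *)
Definition planar s : 'rV[R]_2 := let: (t, u) := val (repr s) in t *: u.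

Lemma planar_pt t u : blow_dom R (t, u) -> lattice (planar (surf_pt t u) - t *: u).
Proof.
move=> h; apply/torus_ptP; rewrite -blowdown_pt// /blowdown /planar.
by case: (val _).
Qed.

Definition lattice_periodic (Z : Type) (G : 'rV[R]_2 -> Z) :=
  forall v w, lattice (v - w) -> G v = G w.

Lemma periodic_planar (Z : Type) (G : 'rV[R]_2 -> Z) t u : lattice_periodic G ->
  blow_dom R (t, u) -> G (planar (surf_pt t u)) = G (t *: u).
Proof. by move=> pG h; apply: pG; exact: planar_pt. Qed.

Lemma latdist_periodic : lattice_periodic latdist.
Proof. by move=> v w; exact: latdist_per. Qed.

Lemma planar_continuous (Z : topologicalType) (G : 'rV[R]_2 -> Z) :
  lattice_periodic G -> continuous G -> continuous (G \o planar).
Proof.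
move=> pG cG; apply: surface_continuous => p h /=.
have -> : G (planar (surf_pt p.1 p.2)) = G (p.1 *: p.2).
  by apply: periodic_planar => //; rewrite -surjective_pairing.
have : G (q.1 *: q.2) @[q --> p] --> G (p.1 *: p.2).
  by apply: cvg_comp (@scale_pair_continuous p) (cG _).
apply: cvg_trans; apply: near_eq_cvg.
apply: filterS (blow_dom_near h) => q hq /=.
by rewrite periodic_planar// -surjective_pairing.
Qed.

Lemma planar_blowup s : \det A = 1 ->
  lattice (planar (blowup_map A s) - mxact A (planar s)).
Proof.
move=> dA; have [t [u [h ->]]] := surf_pt_surj s.
rewrite blowup_map_pt//.
have := lattice_act A (planar_pt h); have := planar_pt (blow_dom_act dA h).
rewrite mxactB mxactZ => l1 l2.
have := latticeB l1 l2; congr lattice.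
by apply/rowP => i; rewrite !mxE; ring.
Qed.

Lemma blow_dom0 u : u != 0 -> blow_dom R (0, u).
Proof. by move=> u0; split. Qed.

Lemma fibre_unit u (w := (enorm u)^-1 *: u) : u != 0 ->
  [/\ enorm w = 1, w != 0 & surf_pt 0 u = surf_pt 0 w].
Proof.
move=> u0; have eu : 0 < enorm u by rewrite enorm_gt0.
have w0 : w != 0 by rewrite scaler_eq0 invr_eq0 gt_eqF.
split => //; first by rewrite enormZ gtr0_norm ?invr_gt0// mulVf ?gt_eqF.
apply/surf_ptP; [exact: blow_dom0|exact: blow_dom0|].
by right; split => //; exists (enorm u); rewrite scalerA mulfV ?gt_eqF// scale1r.
Qed.

(** Off the fibre the radius may be any representative v of the point, not
    only t u. *)
Lemma off_fibre_unit t u v (w := (enorm v)^-1 *: v) :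
  blow_dom R (t, u) -> t != 0 -> lattice (t *: u - v) ->
  [/\ enorm w = 1, enorm v *: w = v, blow_dom R (enorm v, w) &
      surf_pt t u = surf_pt (enorm v) w].
Proof.
move=> h t0 l; have nv : ~ lattice v.
  move=> lv; have := latticeD l lv; rewrite subrK => /h.2 /= /eqP.
  by rewrite (negbTE t0).
have v0 : v != 0 by apply/eqP => e; apply: nv; rewrite e; exact: lattice0.
have ev : 0 < enorm v by rewrite enorm_gt0.
have e : enorm v *: w = v by rewrite scalerA mulfV ?gt_eqF// scale1r.
have hd : blow_dom R (enorm v, w).
  split => /=; first by rewrite scaler_eq0 invr_eq0 gt_eqF.
  by rewrite e => /nv.
split => //; first by rewrite enormZ gtr0_norm ?invr_gt0// mulVf ?gt_eqF.
by apply/surf_ptP => //; left; rewrite e; split => //; rewrite gt_eqF.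
Qed.

(** Subtract the nearest lattice vector and normalize. These coordinates range
    in the compact set [polar_box], which makes the surface compact. *)
Lemma polar s : exists t u, [/\ enorm u = 1, `|t *: u| <= 2^-1,
  blow_dom R (t, u) & s = surf_pt t u].
Proof.
have [t [u [h ->]]] := surf_pt_surj s.
have [t0|t0] := eqVneq t 0.
  have [w1 w0 e] := fibre_unit h.1; exists 0, ((enorm u)^-1 *: u).
  rewrite t0 scale0r normr0 invr_ge0 ler0n; split => //; exact: blow_dom0.
have [n ln nv] := lattice_round (t *: u).
have l : lattice (t *: u - (t *: u - n)) by rewrite opprB addrC subrK.
have [w1 we hd e] := off_fibre_unit h t0 l.
by exists (enorm (t *: u - n)), ((enorm (t *: u - n))^-1 *: (t *: u - n)); rewrite we.
Qed.

(** Near the fibre the polar radius is the distance to the lattice itself. *)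
Lemma near_polar s : latdist (planar s) < 2^-1 -> exists u,
  [/\ enorm u = 1, blow_dom R (latdist (planar s), u) &
      s = surf_pt (latdist (planar s)) u].
Proof.
have [t [u [h ->]]] := surf_pt_surj s.
rewrite (periodic_planar latdist_periodic h) => hd.
have [t0|t0] := eqVneq t 0.
  have [w1 w0 e] := fibre_unit h.1; exists ((enorm u)^-1 *: u).
  by rewrite t0 scale0r latdist0; split => //; exact: blow_dom0.
have [n ln nv] := latdist_lt hd.
have l : lattice (t *: u - (t *: u - n)) by rewrite opprB addrC subrK.
have [w1 we hw e] := off_fibre_unit h t0 l.
have -> : latdist (t *: u) = enorm (t *: u - n).
  by rewrite -(latdist_small (ltW nv)); exact: latdist_per.
by exists ((enorm (t *: u - n))^-1 *: (t *: u - n)).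
Qed.

Lemma sphere_compact : compact [set u : 'rV[R]_2 | enorm u = 1].
Proof.
apply: bounded_closed_compact.
  exists 1; split; first exact: num_real.
  move=> x x1 u /= u1; apply: le_trans (norm_le_enorm E u) _.
  by rewrite u1 ltW.
rewrite (_ : mkset _ = enorm @^-1` [set 1]); last by [].
apply: closed_comp; last exact: closed_eq.
by move=> x _; exact: enorm_continuous.
Qed.

Definition polar_box : set (R * 'rV[R]_2) :=
  [set p | enorm p.2 = 1 /\ `|p.1 *: p.2| <= 2^-1].

Lemma polar_box_dom : polar_box `<=` blow_dom R.
Proof.
move=> [t u] [/= u1 h]; have u0 : u != 0 by rewrite -(enorm_eq0 E) u1 oner_eq0.
split => //= l; have /eqP := lattice_half l h.
by rewrite scaler_eq0 (negbTE u0) orbF => /eqP.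
Qed.

Lemma polar_box_compact : compact polar_box.
Proof.
have h : compact ([set t : R | `|t| <= enorm_bound E] `*` [set u : 'rV[R]_2 | enorm u = 1]).
  apply: compact_setX; last exact: sphere_compact.
  rewrite (_ : mkset _ = `[- enorm_bound E, enorm_bound E]%classic).
    exact: segment_compact.
  by apply/seteqP; split => x /=; rewrite in_itv /= ler_norml.
apply: (subclosed_compact _ h) => [|[t u] /= [u1 h1]].
  apply: (@closedI _ ((fun p : R * 'rV[R]_2 => enorm p.2) @^-1` [set 1])
    ((fun p : R * 'rV[R]_2 => `|p.1 *: p.2|) @^-1` [set x | x <= 2^-1])).
    apply: closed_comp; last exact: closed_eq.
    by move=> p _; exact: enorm_snd_continuous.
  apply: closed_comp; last exact: closed_le.
  move=> p _; apply: (@continuous_comp _ _ _ (fun p : R * 'rV[R]_2 => p.1 *: p.2) Num.norm).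
    exact: scale_pair_continuous.
  exact: norm_continuous.
split => //; have := enorm_le E (t *: u); rewrite enormZ u1 mulr1.
move=> h2; apply: le_trans h2 _.
by rewrite ler_piMr ?ltW ?enorm_bound_gt0// (le_lt_trans h1)// invf_lt1// ltr1n.
Qed.

Lemma surface_bounded (g : surface R -> R) : continuous g ->
  exists2 M, 0 < M & forall s, `|g s| <= M.
Proof.
move=> gc.
have /compact_near_coveringP/(_ _ (@pinfty_nbhs R) (fun M p => `|g (surf_pt p.1 p.2)| <= M)) := polar_box_compact.
have cover p : polar_box p ->
  \forall p' \near p & M \near +oo%R, `|g (surf_pt p'.1 p'.2)| <= M.
  move=> /polar_box_dom /(comp_surf_pt gc) gp.
  exists ([set p' | `|g (surf_pt p.1 p.2) - g (surf_pt p'.1 p'.2)| < 1], [set M | `|g (surf_pt p.1 p.2)| + 1 < M]).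
    split => /=; last exact: nbhs_pinfty_gt.
    by move/(@cvgrPdist_lt _ _ _ (nbhs p)): gp; apply.
  move=> [p' M] [/= h hM]; apply: le_trans (ltW hM).
  have := ler_normD (g (surf_pt p'.1 p'.2) - g (surf_pt p.1 p.2)) (g (surf_pt p.1 p.2)).
  rewrite subrK distrC => /le_trans; apply.
  by rewrite addrC lerD2l ltW.
move=> /(_ _ cover) hM.
have [M [M0 hM']] : exists M : R, 0 < M /\ polar_box `<=` (fun p => `|g (surf_pt p.1 p.2)| <= M).
  have h0 : \forall M \near +oo%R, (0 : R) < M by exact: nbhs_pinfty_gt.
  have [M [M0 h]] := filter_ex (filterI h0 hM).
  by exists M.
exists M => // s; have [t [u [u1 h _ ->]]] := polar s.
by apply: (hM' (t, u)).
Qed.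

End SurfaceTopology.

(** * The expansion rate *)

Section Expansion.
Context (R : realType) (A : 'M[int]_2) (lam : R) (E : eigenframe A lam).
Hypotheses (dA : \det A = 1) (lam1 : 1 < lam).
Local Notation enorm := (enorm E).
Local Notation latdist := (latdist E).
Local Notation f := (blowup_map A).
Implicit Types (t : R) (u v : 'rV[R]_2) (p q : R * 'rV[R]_2) (s : surface R).

(** The distance to the lattice of the point t u in units of |t|, continued to
    t = 0 by the norm of u. The factor |t| cancels in the ratio of two such
    distances along the same line, so that growth rates make sense on the
    fibre. *)
Definition fibre_dist p : R :=
  if p.1 == 0 then enorm p.2 else latdist (p.1 *: p.2) / `|p.1|.

Lemma fibre_dist0 u : fibre_dist (0, u) = enorm u.
Proof. by rewrite /fibre_dist eqxx. Qed.

Lemma fibre_distE t u : t != 0 -> fibre_dist (t, u) = latdist (t *: u) / `|t|.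
Proof. by rewrite /fibre_dist /= => /negbTE ->. Qed.

Lemma fibre_dist_small p : enorm (p.1 *: p.2) <= 2^-1 -> fibre_dist p = enorm p.2.
Proof.
case: p => t u /= h; have [->|t0] := eqVneq t 0; first exact: fibre_dist0.
by rewrite fibre_distE// latdist_small// enormZ mulrAC mulfV ?mul1r// normr_eq0.
Qed.

Lemma fibre_dist_gt0 p : blow_dom R p -> 0 < fibre_dist p.
Proof.
case: p => t u h; have [t0|t0] := eqVneq t 0.
  by rewrite t0 fibre_dist0 enorm_gt0; exact: h.1.
by rewrite fibre_distE// divr_gt0 ?normr_gt0// blow_dom_latdist.
Qed.

(** When t u is short, its distance to the lattice is |t| times the norm of u,
    so the quotient does not depend on t near the fibre. *)
Lemma fibre_dist_continuous p : blow_dom R p ->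
  fibre_dist q @[q --> p] --> fibre_dist p.
Proof.
case: p => t u h; have [t0|t0] := eqVneq t 0.
  have hs : \forall q \near (t, u), enorm (q.1 *: q.2) < 2^-1.
    have c : enorm (q.1 *: q.2) @[q --> (t, u)] --> enorm (t *: u).
      exact: (@enorm_pair_continuous _ _ _ E (t, u)).
    move/(@cvgrPdist_lt _ _ _ (nbhs (t, u)))/(_ 2^-1): c.
    rewrite invr_gt0 ltr0n => /(_ isT); apply: filterS => q /=.
    by rewrite t0 scale0r enorm0 sub0r normrN ger0_norm ?enorm_ge0.
  have -> : fibre_dist (t, u) = enorm (t, u).2 by rewrite t0 fibre_dist0.
  apply: cvg_trans (@enorm_snd_continuous _ _ _ E (t, u)).
  apply: near_eq_cvg; apply: filterS hs => q hq.
  by rewrite fibre_dist_small// ltW.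
have hn : \forall q \near (t, u), q.1 != 0.
  have : open [set x : R | x != 0] by exact: open_neq.
  move=> o; have c : q.1 @[q --> (t, u)] --> t by exact: cvg_fst.
  exact: (c _ (open_nbhs_nbhs (conj o t0))).
have -> : fibre_dist (t, u) = latdist ((t, u).1 *: (t, u).2) / `|(t, u).1|.
  by rewrite fibre_distE.
have c : latdist (q.1 *: q.2) / `|q.1| @[q --> (t, u)] -->
    latdist ((t, u).1 *: (t, u).2) / `|(t, u).1|.
  apply: cvgM; first exact: latdist_pair_continuous.
  apply: cvgV; first by rewrite normr_eq0.
  by apply: cvg_norm; exact: cvg_fst.
apply: cvg_trans c; apply: near_eq_cvg; apply: filterS hn => -[a b] /= hq.
by rewrite fibre_distE.
Qed.

(** The logarithmic growth, in one step, of the distance to the origin of the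
    torus. *)
Definition expansion s : R :=
  let: (t, u) := val (repr s) in
  ln (fibre_dist (t, mxact A u)) - ln (fibre_dist (t, u)).

Lemma expansion_nz t u : blow_dom R (t, u) -> t != 0 ->
  ln (fibre_dist (t, mxact A u)) - ln (fibre_dist (t, u)) =
  ln (latdist (mxact A (t *: u))) - ln (latdist (t *: u)).
Proof.
move=> h t0; rewrite !fibre_distE//.
have h1 := blow_dom_latdist E h t0.
have h2 := blow_dom_latdist E (blow_dom_act dA h) t0.
rewrite !ln_div ?posrE ?normr_gt0// mxactZ opprB addrA subrK//.
Qed.

Lemma latdist_act_per v w : lattice (v - w) ->
  latdist (mxact A v) = latdist (mxact A w).
Proof. by move=> l; apply: latdist_per; rewrite -mxactB; exact: lattice_act. Qed.

Lemma enorm_act_gt0 u : u != 0 -> 0 < enorm (mxact A u).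
Proof.
move=> u0; rewrite enorm_gt0; apply: contra_neq u0 => e.
by rewrite -(mxactK dA u) e /mxact mul0mx.
Qed.

Lemma expansion_pt t u : blow_dom R (t, u) -> expansion (surf_pt t u) =
  ln (fibre_dist (t, mxact A u)) - ln (fibre_dist (t, u)).
Proof.
move=> h; rewrite /expansion; have [s [w [-> k e]]] := repr_surf_pt h.
case/(surf_ptP h k) : e => [[t0 s0 l]|[t0 s0 [c uE]]].
  by rewrite !expansion_nz// (latdist_act_per l) (latdist_per E l).
rewrite t0 s0 !fibre_dist0 uE mxactZ !enormZ.
have w0 : w != 0 by exact: k.1.
have c0 : 0 < `|c|.
  by rewrite normr_gt0; apply: contraTneq h.1 => /= c0; rewrite uE c0 scale0r eqxx.
rewrite !lnM ?posrE ?enorm_gt0//; last by rewrite -(enorm_gt0 E) enorm_act_gt0.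
by rewrite opprD addrACA subrr add0r.
Qed.

Lemma expansion_continuous : continuous expansion.
Proof.
apply: surface_continuous => p h.
have he q : blow_dom R q -> expansion (surf_pt q.1 q.2) =
    ln (fibre_dist (q.1, mxact A q.2)) - ln (fibre_dist q).
  by case: q => a b hq; rewrite expansion_pt.
have hact q : blow_dom R q -> blow_dom R (q.1, mxact A q.2).
  by case: q => a b hq; exact: blow_dom_act.
rewrite he//.
have a1 : q.1 @[q --> p] --> p.1 by exact: cvg_fst.
have a2 : mxact A q.2 @[q --> p] --> mxact A p.2.
  have a2' : q.2 @[q --> p] --> p.2 by exact: cvg_snd.
  apply: cvg_comp a2' _; exact: mxact_continuous.
have c : ln (fibre_dist (q.1, mxact A q.2)) - ln (fibre_dist q) @[q --> p] -->
   ln (fibre_dist (p.1, mxact A p.2)) - ln (fibre_dist p).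
  apply: cvgB.
    apply: (cvg_comp (fun q : R * 'rV[R]_2 => fibre_dist (q.1, mxact A q.2)) (@ln R)).
      apply: (cvg_comp (fun q : R * 'rV[R]_2 => (q.1, mxact A q.2)) fibre_dist).
        exact: cvg_pair a1 a2.
      exact: fibre_dist_continuous (hact _ h).
    exact: continuous_ln (fibre_dist_gt0 (hact _ h)).
  apply: (cvg_comp fibre_dist (@ln R)); first exact: fibre_dist_continuous h.
  exact: continuous_ln (fibre_dist_gt0 h).
apply: cvg_trans c; apply: near_eq_cvg.
by apply: filterS (blow_dom_near E h) => q hq; rewrite he.
Qed.

Lemma excP s : exceptional R s -> exists2 u, u != 0 & s = surf_pt 0 u.
Proof.
have [t [u [h ->]]] := surf_pt_surj s => /(exceptionalP h) t0.
by exists u; [exact: h.1|rewrite t0].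
Qed.

Lemma exc_latdist s : exceptional R s <-> latdist (planar s) = 0.
Proof.
have [t [u [h ->]]] := surf_pt_surj s.
rewrite (periodic_planar (@latdist_periodic _ _ _ E) h).
split=> [/(exceptionalP h) ->|].
  by rewrite scale0r latdist0.
by move/latdist_eq0 => /h.2 /= ?; apply/(exceptionalP h).
Qed.

Lemma exc_act s : exceptional R (f s) <-> exceptional R s.
Proof.
have [t [u [h ->]]] := surf_pt_surj s; rewrite blowup_map_pt//.
rewrite (exceptionalP h); exact: (exceptionalP (blow_dom_act dA h)).
Qed.

Lemma expansion_off s : ~ exceptional R s ->
  expansion s = ln (latdist (planar (f s))) - ln (latdist (planar s)).
Proof.
have [t [u [h ->]]] := surf_pt_surj s => /(exceptionalP h)/eqP t0.
rewrite expansion_pt// expansion_nz// blowup_map_pt//.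
rewrite !(periodic_planar (@latdist_periodic _ _ _ E))// ?mxactZ//.
exact: blow_dom_act.
Qed.

Lemma expansion_exc u : u != 0 ->
  expansion (surf_pt 0 u) = ln (enorm (mxact A u)) - ln (enorm u).
Proof. by move=> u0; rewrite expansion_pt ?fibre_dist0//; exact: blow_dom0. Qed.

Lemma expansion_excE u : u != 0 -> expansion (surf_pt 0 u) =
  ln ((lam * `|cu E u| + lam^-1 * `|cs E u|) / (`|cu E u| + `|cs E u|)).
Proof.
move=> u0; rewrite expansion_exc// -enorm_actE// -enormE ln_div//.
  by rewrite posrE enorm_act_gt0.
by rewrite posrE enorm_gt0.
Qed.

Let lam_pos : 0 < lam. Proof. exact: lam_gt0 lam1. Qed.
Local Hint Resolve lam_pos : core.

Lemma frame_neq0 u : u != 0 -> 0 < `|cu E u| + `|cs E u|.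
Proof. by rewrite -enormE enorm_gt0. Qed.

Lemma act_neq0 u : u != 0 -> mxact A u != 0.
Proof. by move=> u0; rewrite -(enorm_gt0 E) enorm_act_gt0. Qed.

(** With x and y the absolute eigencoordinates of u and l = lam, this is (l x
    + y / l)^2 <= (l^2 x + y / l^2) (x + y); the difference of the two sides
    is x y (l - 1 / l)^2. *)
Lemma expansion_mono u : u != 0 ->
  expansion (surf_pt 0 u) <= expansion (f (surf_pt 0 u)).
Proof.
move=> u0; rewrite blowup_map_pt//.
rewrite !expansion_excE ?act_neq0// cu_act cs_act !normrM.
rewrite (gtr0_norm lam_pos) (gtr0_norm (lamV_gt0 lam1)).
have := frame_neq0 u0; have := frame_neq0 (act_neq0 u0).
rewrite cu_act cs_act !normrM (gtr0_norm lam_pos) (gtr0_norm (lamV_gt0 lam1)).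
set x := `|cu E u|; set y := `|cs E u| => h1 h2.
have x0 : 0 <= x by exact: normr_ge0.
have y0 : 0 <= y by exact: normr_ge0.
have lv := lamV_gt0 lam1.
have lv1 : lam * lam^-1 = 1 by rewrite mulfV ?gt_eqF.
set k := lam^-1 in lv lv1 h1 *.
have h3 : 0 < lam * (lam * x) + k * (k * y).
  have [x00|x00] := eqVneq x 0.
    by rewrite x00 !mulr0 !add0r !mulr_gt0//; move: h2; rewrite x00 add0r.
  by rewrite ltr_pwDl ?mulr_gt0 ?mulr_ge0 ?(ltW lv)// lt_def x00.
rewrite ler_ln ?posrE ?divr_gt0//.
rewrite ler_pdivrMr// mulrAC ler_pdivlMr//.
have : 0 <= x * y * (lam - k) ^+ 2 by rewrite mulr_ge0 ?sqr_ge0// mulr_ge0.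
by nra.
Qed.

(** The difference x y (l - 1 / l)^2 of the two sides of the previous
    inequality vanishes only on the axes. *)
Lemma expansion_fix u : u != 0 ->
  expansion (f (surf_pt 0 u)) = expansion (surf_pt 0 u) ->
  cu E u = 0 \/ cs E u = 0.
Proof.
move=> u0; rewrite blowup_map_pt//.
rewrite !expansion_excE ?act_neq0// cu_act cs_act !normrM.
rewrite (gtr0_norm lam_pos) (gtr0_norm (lamV_gt0 lam1)).
have := frame_neq0 u0; have := frame_neq0 (act_neq0 u0).
rewrite cu_act cs_act !normrM (gtr0_norm lam_pos) (gtr0_norm (lamV_gt0 lam1)).
move=> h1 h2 h.
suff : `|cu E u| * `|cs E u| = 0.
  by move/eqP; rewrite mulf_eq0 !normr_eq0 => /orP[]/eqP; [left|right].
move: h1 h2 h.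
set x := `|cu E u|; set y := `|cs E u| => h1 h2.
have x0 : 0 <= x by exact: normr_ge0.
have y0 : 0 <= y by exact: normr_ge0.
have lv := lamV_gt0 lam1.
have lv1 : lam * lam^-1 = 1 by rewrite mulfV ?gt_eqF.
have lkl := lamV_lt1 lam1.
set k := lam^-1 in lv lv1 h1 lkl *.
have h3 : 0 < lam * (lam * x) + k * (k * y).
  have [x00|x00] := eqVneq x 0.
    by rewrite x00 !mulr0 !add0r !mulr_gt0//; move: h2; rewrite x00 add0r.
  by rewrite ltr_pwDl ?mulr_gt0 ?mulr_ge0 ?(ltW lv)// lt_def x00.
move/ln_inj; rewrite !posrE !divr_gt0// => /(_ isT isT)/eqP.
rewrite eqr_div; [|by rewrite gt_eqF|by rewrite gt_eqF] => /eqP h.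
have : x * y * (lam - k) ^+ 2 = 0.
  transitivity ((lam * (lam * x) + k * (k * y)) * (x + y) -
    (lam * x + k * y) * (lam * x + k * y)); first by ring.
  by rewrite h subrr.
move/eqP; rewrite mulf_eq0 expf_eq0 /= subr_eq0 orbC.
by case/orP => /eqP // lk; move: lkl; rewrite -lk ltNge ltW.
Qed.

Definition p_unst : surface R := surf_pt 0 (bu E).
Definition p_stab : surface R := surf_pt 0 (bs E).

Lemma bu_neq0 : bu E != 0.
Proof.
apply/eqP => e; have := cu_bu E; rewrite e linear0 => /eqP.
by rewrite eq_sym oner_eq0.
Qed.

Lemma bs_neq0 : bs E != 0.
Proof.
apply/eqP => e; have := cs_bs E; rewrite e linear0 => /eqP.
by rewrite eq_sym oner_eq0.
Qed.

Lemma unst_dir u : u != 0 -> cs E u = 0 -> surf_pt 0 u = p_unst.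
Proof.
move=> u0 h; apply/surf_ptP; [exact: blow_dom0|exact: blow_dom0 bu_neq0|].
right; split => //; exists (cu E u).
by rewrite {1}(frame_dec E u) h scale0r addr0.
Qed.

Lemma stab_dir u : u != 0 -> cu E u = 0 -> surf_pt 0 u = p_stab.
Proof.
move=> u0 h; apply/surf_ptP; [exact: blow_dom0|exact: blow_dom0 bs_neq0|].
right; split => //; exists (cs E u).
by rewrite {1}(frame_dec E u) h scale0r add0r.
Qed.

Lemma expansion_unst : expansion p_unst = ln lam.
Proof.
rewrite expansion_excE ?bu_neq0// cu_bu cs_bu normr0 normr1 mulr0 !addr0.
by rewrite mulr1 divr1.
Qed.

Lemma expansion_stab : expansion p_stab = - ln lam.
Proof.
rewrite expansion_excE ?bs_neq0// cu_bs cs_bs normr0 normr1 mulr0 !add0r.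
by rewrite mulr1 divr1 lnV// posrE.
Qed.

Lemma exc_unst : exceptional R p_unst.
Proof. by apply/exceptionalP => //; exact: blow_dom0 bu_neq0. Qed.

Lemma exc_stab : exceptional R p_stab.
Proof. by apply/exceptionalP => //; exact: blow_dom0 bs_neq0. Qed.

Lemma fix_unst : f p_unst = p_unst.
Proof.
rewrite blowup_map_pt//; last exact: blow_dom0 bu_neq0.
by apply: unst_dir; rewrite ?act_neq0 ?bu_neq0// cs_act cs_bu mulr0.
Qed.

Lemma fix_stab : f p_stab = p_stab.
Proof.
rewrite blowup_map_pt//; last exact: blow_dom0 bs_neq0.
by apply: stab_dir; rewrite ?act_neq0 ?bs_neq0// cu_act cu_bs mulr0.
Qed.

Lemma exc_expansion_fix s : exceptional R s -> expansion (f s) = expansion s ->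
  s = p_unst \/ s = p_stab.
Proof.
move=> /excP[u u0 ->] /(expansion_fix u0)[h|h].
  by right; exact: stab_dir.
by left; exact: unst_dir.
Qed.

Lemma exc_fix s : exceptional R s -> f s = s -> s = p_unst \/ s = p_stab.
Proof. by move=> es fs; apply: exc_expansion_fix => //; rewrite fs. Qed.

(** Together with its stable counterpart, this characterizes the two saddles
    by values of continuous functions, whence their measurability. *)
Lemma exc_expansion_unst s : exceptional R s -> expansion s = ln lam -> s = p_unst.
Proof.
move=> /excP[u u0 ->]; rewrite expansion_excE// => /ln_inj.
have h2 := frame_neq0 u0; have := frame_neq0 (act_neq0 u0).
rewrite cu_act cs_act !normrM (gtr0_norm lam_pos) (gtr0_norm (lamV_gt0 lam1)) => h1.
rewrite !posrE divr_gt0// => /(_ isT lam_pos).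
move/(congr1 (fun z => z * (`|cu E u| + `|cs E u|))).
rewrite divfK ?gt_eqF// => h.
have {}h : (lam - lam^-1) * `|cs E u| = 0 by lra.
move/eqP: h; rewrite mulf_eq0 normr_eq0 subr_eq0 => /orP[/eqP e|/eqP e].
  by have := lamV_lt1 lam1; rewrite -e ltNge ltW.
exact: unst_dir.
Qed.

Lemma exc_expansion_stab s : exceptional R s -> expansion s = - ln lam -> s = p_stab.
Proof.
move=> /excP[u u0 ->]; rewrite expansion_excE// -lnV ?posrE// => /ln_inj.
have h2 := frame_neq0 u0; have := frame_neq0 (act_neq0 u0).
rewrite cu_act cs_act !normrM (gtr0_norm lam_pos) (gtr0_norm (lamV_gt0 lam1)) => h1.
rewrite !posrE divr_gt0 ?invr_gt0// => /(_ isT lam_pos).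
move/(congr1 (fun z => z * (`|cu E u| + `|cs E u|))).
rewrite divfK ?gt_eqF// => h.
have {}h : (lam - lam^-1) * `|cu E u| = 0 by lra.
move/eqP: h; rewrite mulf_eq0 normr_eq0 subr_eq0 => /orP[/eqP e|/eqP e].
  by have := lamV_lt1 lam1; rewrite -e ltNge ltW.
exact: stab_dir.
Qed.

Lemma ln_lam_gt0 : 0 < ln lam. Proof. exact: ln_gt0. Qed.

Lemma unst_neq_stab : p_unst <> p_stab.
Proof.
move=> e; have := expansion_unst; rewrite e expansion_stab => h.
by have := ln_lam_gt0; lra.
Qed.

End Expansion.

(** * Means under invariant measures *)

Section BorelIntegral.
Context {R : realType} {T : ptopologicalType}.
Implicit Types (f : T -> T) (mu nu : probability (borel T) R) (g h : T -> R).

Lemma continuous_borel (g : T -> R) : continuous g ->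
  measurable_fun [set: borel T] (g : borel T -> R).
Proof.
move=> /continuousP cg; apply: (measurability _ (RGenOpens.measurableE R)).
move=> _ [_ [a [b ->] <-]]; rewrite setTI; apply: sub_sigma_algebra.
exact/cg/interval_open.
Qed.

Lemma continuous_borel_self f : continuous f ->
  measurable_fun [set: borel T] (f : borel T -> borel T).
Proof.
move=> /continuousP cf; apply: (@measurability _ _ (borel T) (borel T) setT f (@open T)) => //.
by move=> _ [U oU <-]; rewrite setTI; apply: sub_sigma_algebra; exact: cf.
Qed.

Definition bounded_borel g :=
  measurable_fun [set: borel T] (g : borel T -> R) /\
  exists M, forall x, `|g x| <= M.

Lemma bounded_borel_integrable mu g (D : set (borel T)) : measurable D ->
  bounded_borel g -> mu.-integrable D (EFin \o (g : borel T -> R)).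
Proof.
move=> mD [mg [M gM]]; apply: measurable_bounded_integrable => //.
- by rewrite (le_lt_trans (probability_le1 _ mD))// ltry.
- exact: measurable_funTS.
- exists M; split; first exact: num_real.
  by move=> N MN x _ /=; rewrite (le_trans (gM x))// ltW.
Qed.

Lemma bounded_borelD g h : bounded_borel g -> bounded_borel h ->
  bounded_borel (fun x => g x + h x).
Proof.
move=> [mg [M gM]] [mh [N hN]]; split; first exact: measurable_funD.
by exists (M + N) => x; apply: le_trans (ler_normD _ _) _; rewrite lerD.
Qed.

Lemma bounded_borelB g h : bounded_borel g -> bounded_borel h ->
  bounded_borel (fun x => g x - h x).
Proof.
move=> [mg [M gM]] [mh [N hN]]; split; first exact: measurable_funB.
by exists (M + N) => x; apply: le_trans (ler_normB _ _) _; rewrite lerD.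
Qed.

Lemma bounded_borelM g h : bounded_borel g -> bounded_borel h ->
  bounded_borel (fun x => g x * h x).
Proof.
move=> [mg [M gM]] [mh [N hN]]; split; first exact: measurable_funM.
by exists (M * N) => x; rewrite normrM ler_pM.
Qed.

Lemma bounded_borel_cst (c : R) : bounded_borel (fun=> c).
Proof. by split; [exact: measurable_cst|exists `|c|]. Qed.

Lemma bounded_borel_sum (I : Type) (r : seq I) (g : I -> T -> R) :
  (forall i, bounded_borel (g i)) -> bounded_borel (fun x => \sum_(i <- r) g i x).
Proof.
move=> bg; elim: r => [|i r ih].
  rewrite (_ : (fun _ => _) = fun=> 0); first exact: bounded_borel_cst.
  by apply/funext => x; rewrite big_nil.
rewrite (_ : (fun _ => _) = fun x => g i x + \sum_(j <- r) g j x).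
  exact: bounded_borelD.
by apply/funext => x; rewrite big_cons.
Qed.

Lemma bounded_borel_comp f g : continuous f -> bounded_borel g ->
  bounded_borel (g \o f).
Proof.
move=> cf [mg [M gM]]; split; last by exists M => x; exact: gM.
exact: (measurableT_comp mg (continuous_borel_self cf)).
Qed.

Definition mean mu g : R := \int[mu]_(x in [set: borel T]) g x.

Lemma meanE mu g : bounded_borel g ->
  (\int[mu]_x (g x)%:E = (mean mu g)%:E)%E.
Proof.
move=> bg; rewrite /mean /Rintegral fineK//.
exact/integrable_fin_num/bounded_borel_integrable.
Qed.

Lemma meanD mu g h : bounded_borel g -> bounded_borel h ->
  mean mu (fun x => g x + h x) = mean mu g + mean mu h.
Proof. by move=> bg bh; rewrite /mean RintegralD//; exact: bounded_borel_integrable. Qed.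

Lemma meanB mu g h : bounded_borel g -> bounded_borel h ->
  mean mu (fun x => g x - h x) = mean mu g - mean mu h.
Proof. by move=> bg bh; rewrite /mean RintegralB//; exact: bounded_borel_integrable. Qed.

Lemma meanZ mu g (c : R) : bounded_borel g ->
  mean mu (fun x => c * g x) = c * mean mu g.
Proof. by move=> bg; rewrite /mean RintegralZl//; exact: bounded_borel_integrable. Qed.

Lemma mean_cst mu (c : R) : mean mu (fun=> c) = c.
Proof.
rewrite /mean Rintegral_cst; last exact: measurableT.
transitivity (c * 1); last by rewrite mulr1.
congr (_ * _); rewrite -[RHS]/(fine 1%E); congr fine; exact: probability_setT.
Qed.

Lemma mean_le mu g h : bounded_borel g -> bounded_borel h ->
  (forall x, g x <= h x) -> mean mu g <= mean mu h.
Proof.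
by move=> bg bh gh; rewrite /mean le_Rintegral//; exact: bounded_borel_integrable.
Qed.

Lemma mean_sum mu (I : Type) (r : seq I) (g : I -> T -> R) :
  (forall i, bounded_borel (g i)) ->
  mean mu (fun x => \sum_(i <- r) g i x) = \sum_(i <- r) mean mu (g i).
Proof.
move=> bg; elim: r => [|i r ih].
  rewrite big_nil (_ : (fun _ => _) = fun=> 0) ?mean_cst//.
  by apply/funext => x; rewrite big_nil.
rewrite big_cons -ih -meanD//; last exact: bounded_borel_sum.
by congr mean; apply/funext => x; rewrite big_cons.
Qed.

Lemma mean_dist mu g h (e : R) : bounded_borel g -> bounded_borel h ->
  (forall x, `|g x - h x| <= e) -> `|mean mu g - mean mu h| <= e.
Proof.
move=> bg bh gh; rewrite -meanB// ler_norml; apply/andP; split.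
  rewrite -(mean_cst mu (- e)); apply: mean_le => [||x].
  - exact: bounded_borel_cst.
  - exact: bounded_borelB.
  - by have := gh x; rewrite ler_norml => /andP[].
rewrite -[leRHS](mean_cst mu e); apply: mean_le => [||x].
- exact: bounded_borelB.
- exact: bounded_borel_cst.
- by have := gh x; rewrite ler_norml => /andP[].
Qed.

(** The tolerance [e] spares a discussion of strict positivity of integrals. *)
Lemma mean_exists_le mu g (e : R) : bounded_borel g -> 0 < e ->
  exists x, g x <= mean mu g + e.
Proof.
move=> bg e0; apply: contrapT => /forallNP h.
have : mean mu (fun=> mean mu g + e) <= mean mu g.
  apply: mean_le => //; first exact: bounded_borel_cst.
  by move=> x; apply: ltW; rewrite ltNge; apply/negP; exact: h.
by rewrite mean_cst; lra.
Qed.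

Section Invariance.
Variables (f : T -> T) (mu : probability (borel T) R).
Hypotheses (cf : continuous f) (mu_inv : invariant_measure f mu).

Lemma invariant_integral (B : set (borel T)) g : measurable B ->
  f @^-1` B = B -> bounded_borel g ->
  \int[mu]_(x in B) g (f x) = \int[mu]_(x in B) g x.
Proof.
move=> mB fB bg; rewrite /Rintegral; congr fine.
have bgf := bounded_borel_comp cf bg.
have := @integral_pushforward _ _ (borel T) (borel T) R f (continuous_borel_self cf) mu B (EFin \o (g : borel T -> R)).
rewrite /= fB => <-//.
- apply: eq_measure_integral; first exact: continuous_borel_self.
  by move=> mf C mC _; exact: (mu_inv mC).
- by case: bg => mg _; exact/measurable_EFinP.
- exact: (bounded_borel_integrable _ _ bgf).
Qed.

Lemma invariant_mean g : bounded_borel g -> mean mu (g \o f) = mean mu g.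
Proof. by move=> bg; apply: invariant_integral => //; rewrite preimage_setT. Qed.

Lemma invariant_mean_iter n g : bounded_borel g ->
  mean mu (g \o iter n f) = mean mu g.
Proof.
elim: n g => [//|n ih] g bg.
rewrite -(invariant_mean bg) -(ih (g \o f)); last exact: bounded_borel_comp.
by congr mean; apply/funext => x /=; rewrite -iterS.
Qed.

(** Truncating [h] at height n gives bounded coboundaries, whose integrals
    vanish by invariance; they are dominated by |phi|, since truncation is
    1-Lipschitz, and converge to phi. *)
Lemma coboundary_integral0 (B : set (borel T)) (h phi : T -> R) :
  measurable B -> f @^-1` B = B ->
  measurable_fun [set: borel T] (h : borel T -> R) -> bounded_borel phi ->
  (forall x, B x -> phi x = h (f x) - h x) ->
  \int[mu]_(x in B) phi x = 0.
Proof.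
move=> mB fB mh bphi hphi.
pose hn (n : nat) x := Num.min (Num.max (h x) (- n%:R)) n%:R.
have bhn n : bounded_borel (hn n).
  split.
    apply: measurable_minr; last exact: measurable_cst.
    by apply: measurable_maxr; last exact: measurable_cst.
  exists n%:R => x; rewrite ler_norml /hn ge_min lexx orbT andbT.
  by rewrite le_min le_max lexx orbT /= (@le_trans _ _ 0)// oppr_le0.
have dn n x : `|hn n (f x) - hn n x| <= `|h (f x) - h x|.
  rewrite /hn; set a := h (f x); set b := h x.
  have n0 : 0 <= n%:R :> R by [].
  have h1 := ler_norm (a - b); have := ler_norm (b - a); rewrite distrC => h2.
  rewrite ler_norml; set c := `|a - b| in h1 h2 *.
  by rewrite /Num.min /Num.max; do !case: ifPn; rewrite ?ltNge ?negbK => *;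
    apply/andP; split; lra.
have int0 n : \int[mu]_(x in B) (hn n (f x) - hn n x) = 0.
  rewrite RintegralB//.
  - by rewrite invariant_integral// subrr.
  - exact: (bounded_borel_integrable _ mB (bounded_borel_comp cf (bhn n))).
  - exact: (bounded_borel_integrable _ mB (bhn n)).
case: (bphi) => mphi [M phiM].
have [] := @dominated_convergence _ (borel T) R mu B mB
  (fun n x => (hn n (f x) - hn n x)%:E) (EFin \o phi) (cst M%:E).
- move=> n; apply/measurable_EFinP; apply: measurable_funTS.
  by case: (bounded_borelB (bounded_borel_comp cf (bhn n)) (bhn n)).
- by apply/measurable_EFinP; exact: measurable_funTS.
- apply: aeW => x Bx.
  apply: cvg_near_cst; near=> n; rewrite /= hphi//.
  suff H (y : R) : `|y| <= n%:R -> Num.min (Num.max y (- n%:R)) n%:R = y.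
    by rewrite /hn !H//; near: n; exact: nbhs_infty_ger.
  by rewrite ler_norml => /andP[h1 h2]; rewrite max_l// min_l.
- exact: (bounded_borel_integrable mu mB (bounded_borel_cst M)).
- apply: aeW => x n Bx /=; rewrite lee_fin (le_trans (dn n x))//.
  by rewrite -hphi.
move=> _ _; rewrite /Rintegral.
rewrite (_ : (fun n => _) = fun=> 0%E).
  by move/cvg_lim => <-//; rewrite lim_cst.
apply/funext => n; have := int0 n; rewrite /Rintegral => h0.
rewrite -[LHS]fineK ?h0//; apply: integrable_fin_num => //.
exact: (bounded_borel_integrable _ mB (bounded_borelB (bounded_borel_comp cf (bhn n)) (bhn n))).
Unshelve. all: by end_near. Qed.

End Invariance.
End BorelIntegral.

(** * The mean of the expansion rate *)

Section NullSet.
Context {R : realType} {T : ptopologicalType}.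

Lemma zero_integral_null (mu : probability (borel T) R) (B : set (borel T)) (g : T -> R) :
  measurable B -> bounded_borel g -> (forall x, B x -> 0 <= g x) ->
  \int[mu]_(x in B) g x = 0 -> mu (B `&` [set x | g x != 0]) = 0%E.
Proof.
move=> mB bg g0 int0.
have mg : measurable_fun B (EFin \o (g : borel T -> R)).
  by apply/measurable_EFinP; apply: measurable_funTS; case: bg.
have : (\int[mu]_(x in B) `|(EFin \o (g : borel T -> R)) x| = 0)%E.
  transitivity (\int[mu]_(x in B) (g x)%:E)%E.
    by apply: eq_integral => x; rewrite inE => Bx /=; rewrite ger0_norm// g0.
  rewrite -[LHS]fineK; first exact: (congr1 EFin int0).
  exact/integrable_fin_num/bounded_borel_integrable.
move/(ae_eq_integral_abs mu mB mg).
have mN : measurable (B `&` [set x : borel T | g x != 0]).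
  rewrite (_ : [set x | g x != 0] = ~` (g @^-1` [set 0])).
    apply: measurableI => //; apply: measurableC.
    by rewrite -[X in measurable X]setTI; apply: bg.1.
  by apply/seteqP; split => x /= => [/eqP|] h; [|apply/eqP].
case=> N [mN' N0 sub]; apply: (subset_measure0 _ _ _ N0) => //.
apply: subset_trans sub => x [Bx gx] /= /(_ Bx)[g0'].
by move: gx; rewrite /= g0' eqxx.
Qed.

End NullSet.

Section KeyLemma.
Context (R : realType) (A : 'M[int]_2) (lam : R) (E : eigenframe A lam).
Hypotheses (dA : \det A = 1) (lam1 : 1 < lam).
Local Notation latdist := (latdist E).
Local Notation f := (blowup_map A : surface R -> surface R).
Local Notation phi := (expansion E).
Local Notation pu := (p_unst E).
Local Notation ps := (p_stab E).

Lemma continuous_bounded_borel (g : surface R -> R) : continuous g ->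
  bounded_borel g.
Proof.
move=> cg; split; first exact: continuous_borel.
by have [M _ h] := surface_bounded E cg; exists M.
Qed.

Lemma blowup_continuous : continuous f.
Proof. exact: blowup_map_continuous. Qed.

Lemma expansion_bounded : bounded_borel phi.
Proof. exact/continuous_bounded_borel/expansion_continuous. Qed.

Lemma measurable_level (g : surface R -> R) (c : R) : continuous g ->
  measurable ([set s | g s = c] : set (borel (surface R))).
Proof.
move=> /continuous_borel mg; rewrite -[X in measurable X]setTI.
exact: (mg measurableT [set c] (measurable_set1 c)).
Qed.

Lemma latdist_planar_continuous : continuous (latdist \o @planar R).
Proof.
apply: (planar_continuous E); first exact: latdist_periodic.
exact: latdist_continuous.
Qed.

Lemma exceptionalE : exceptional R = [set s | (latdist \o @planar R) s = 0].
Proof. by apply/seteqP; split => s /(exc_latdist E). Qed.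

Lemma measurable_exc : measurable (exceptional R : set (borel (surface R))).
Proof.
by rewrite exceptionalE; apply: measurable_level; exact: latdist_planar_continuous.
Qed.

Lemma unst_setE : [set pu] = exceptional R `&` [set s | phi s = ln lam].
Proof.
apply/seteqP; split => s /=.
  by move=> ->; split; [exact: exc_unst|exact: expansion_unst].
by move=> [h1 h2]; exact: (exc_expansion_unst dA lam1).
Qed.

Lemma stab_setE : [set ps] = exceptional R `&` [set s | phi s = - ln lam].
Proof.
apply/seteqP; split => s /=.
  by move=> ->; split; [exact: exc_stab|exact: expansion_stab].
by move=> [h1 h2]; exact: (exc_expansion_stab dA lam1).
Qed.

Lemma measurable_unst : measurable ([set pu] : set (borel (surface R))).
Proof.
rewrite unst_setE; apply: measurableI; first exact: measurable_exc.
by apply: measurable_level; exact: expansion_continuous.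
Qed.

Lemma measurable_stab : measurable ([set ps] : set (borel (surface R))).
Proof.
rewrite stab_setE; apply: measurableI; first exact: measurable_exc.
by apply: measurable_level; exact: expansion_continuous.
Qed.

Section Mu.
Variable mu : probability (borel (surface R)) R.
Hypothesis mu_inv : invariant_measure f mu.

Lemma exc_preimage : f @^-1` exceptional R = exceptional R.
Proof. by apply/seteqP; split => s /(exc_act dA). Qed.

(** Along fibre orbits the expansion rate does not decrease, and its increment
    has integral zero by invariance. So the increment vanishes almost
    everywhere, while it is positive away from the two saddles. *)
Lemma exc_null : mu (exceptional R `\` [set pu; ps]) = 0%E.
Proof.
have bphi := expansion_bounded.
have mU := measurable_unst; have mS := measurable_stab.
have bphif := bounded_borel_comp blowup_continuous bphi.
have : \int[mu]_(x in exceptional R) (phi (f x) - phi x) = 0.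
  rewrite RintegralB.
  - rewrite (invariant_integral blowup_continuous mu_inv) ?subrr//.
      exact: measurable_exc.
    exact: exc_preimage.
  - exact: measurable_exc.
  - exact: (bounded_borel_integrable _ measurable_exc bphif).
  - exact: (bounded_borel_integrable _ measurable_exc bphi).
move/(zero_integral_null measurable_exc (bounded_borelB bphif bphi)).
have h0 s : exceptional R s -> 0 <= (phi \o f) s - phi s.
  by move=> /excP[u u0 ->]; rewrite subr_ge0; exact: expansion_mono.
move/(_ h0) => N0.
apply: (subset_measure0 _ _ _ N0).
- apply: measurableD; first exact: measurable_exc.
  by apply: measurableU mU mS.
- apply: measurableI; first exact: measurable_exc.
  rewrite (_ : [set x | _] = ~` [set x | (phi \o f) x - phi x = 0]).
    apply: measurableC; apply: (@measurable_level (fun x => (phi \o f) x - phi x)).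
    move=> x; apply: (@cvgB _ _ _ (nbhs x) _ (phi \o f) phi); last exact: expansion_continuous.
    apply: (@continuous_comp _ _ _ f phi); first exact: blowup_continuous.
    exact: expansion_continuous.
  by apply/seteqP; split => x /= => [/eqP|] h; [|apply/eqP].
move=> s [es nps]; split => //=; rewrite subr_eq0; apply/eqP => h; apply: nps.
by have [->|->] := exc_expansion_fix dA lam1 es h; [left|right].
Qed.

(** Off the fibre the expansion rate is the coboundary of the logarithm of the
    distance to the origin and contributes nothing; on the fibre only the two
    saddles are charged. *)
Lemma expansion_mean :
  mean mu phi = ln lam * (fine (mu [set pu]) - fine (mu [set ps])).
Proof.
have bphi := expansion_bounded.
have mE := measurable_exc; have mU := measurable_unst; have mS := measurable_stab.
have m2 : measurable ([set pu; ps] : set (borel (surface R))) by exact: measurableU.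
have mD : measurable (exceptional R `\` [set pu; ps] : set (borel (surface R))).
  exact: measurableD.
have Esub : [set pu; ps] `<=` exceptional R.
  by move=> s [->|->]; [exact: exc_unst|exact: exc_stab].
have split1 : [set: borel (surface R)] = ~` exceptional R `|` exceptional R.
  by rewrite setUC setUv.
have split2 : exceptional R = (exceptional R `\` [set pu; ps]) `|` [set pu; ps].
  by rewrite setUC setDUK.
have off0 : \int[mu]_(x in ~` exceptional R) phi x = 0.
  apply: (coboundary_integral0 blowup_continuous mu_inv
     (h := fun s => ln (latdist (planar s)))) => //.
  - exact: measurableC.
  - rewrite preimage_setC; congr (~` _); exact: exc_preimage.
  - apply: (measurableT_comp (@measurable_ln R)).
    exact: continuous_borel latdist_planar_continuous.
  - by move=> s; exact: expansion_off.
have null0 : \int[mu]_(x in exceptional R `\` [set pu; ps]) phi x = 0.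
  rewrite /Rintegral null_set_integral//; last exact: exc_null.
  by apply/measurable_EFinP; apply: measurable_funTS; case: bphi.
have single p : measurable ([set p] : set (borel (surface R))) ->
    \int[mu]_(x in [set p]) phi x = phi p * fine (mu [set p]).
  move=> mp; rewrite -Rintegral_cst//; apply: eq_Rintegral => x.
  by rewrite inE => ->.
have int D : measurable D -> mu.-integrable D (EFin \o (phi : borel (surface R) -> R)).
  by move=> mD'; exact: bounded_borel_integrable.
rewrite /mean split1 Rintegral_setU//; first last.
- by rewrite disj_set2E setICl.
- by apply: int; rewrite -split1.
- exact: measurableC.
rewrite off0 add0r split2 Rintegral_setU//; first last.
- by rewrite disj_set2E; apply/eqP/seteqP; split => // s [[_ h1] h2]; exact: h1.
- by apply: int; rewrite -split2.
rewrite null0 add0r Rintegral_setU//; first last.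
- rewrite disj_set2E; apply/eqP/seteqP; split => // s [-> e].
  by have := unst_neq_stab dA lam1 (E := E); rewrite e.
- exact: int.
rewrite !single// expansion_unst// expansion_stab//.
by rewrite mulNr -mulrBr.
Qed.

End Mu.
End KeyLemma.

(** * Weak-star limits of ergodic measures *)

Section WeakStar.
Context {R : realType} {T : ptopologicalType}.
Implicit Types (mu : probability (borel T) R).

Lemma atom_same_measure mu (p : T) : measurable ([set p] : set (borel T)) ->
  mu [set p] = 1%E -> same_measure mu (\d_(p : borel T)).
Proof.
move=> mp mu1 B mB; rewrite diracE.
have [|] := boolP (p \in B); rewrite ?inE ?notin_setE => pB.
  apply: le_anti; apply/andP; split; first exact: probability_le1.
  rewrite -mu1; apply: le_measure; rewrite ?inE//.
  by move=> x ->.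
have : (mu B <= mu (~` [set p]))%E.
  apply: le_measure; rewrite ?inE//; first exact: measurableC.
  by move=> x Bx /= xp; apply: pB; rewrite -xp.
rewrite probability_setC// mu1 subee// => h.
by apply: le_anti; rewrite h measure_ge0.
Qed.

Lemma weak_star_meanP (nu : nat -> probability (borel T) R) mu :
  (forall g : T -> R, continuous g -> bounded_borel g) ->
  weak_star_cvg nu mu <->
  forall g : T -> R, continuous g -> mean (nu n) g @[n --> \oo] --> mean mu g.
Proof.
move=> bb; split => H g cg; have bg := bb _ cg.
  have := H g cg; rewrite (meanE mu bg).
  under eq_cvg do rewrite (meanE _ bg).
  by move/fine_cvg.
rewrite (meanE mu bg).
under eq_cvg do rewrite (meanE _ bg).
by apply: cvg_EFin; [exact: nearW|exact: H].
Qed.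

End WeakStar.

Section Necessity.
Context (R : realType) (A : 'M[int]_2) (lam : R) (E : eigenframe A lam).
Hypotheses (dA : \det A = 1) (lam1 : 1 < lam).
Local Notation f := (blowup_map A : surface R -> surface R).
Local Notation pu := (p_unst E).
Local Notation ps := (p_stab E).

Lemma unst_preimage : f @^-1` [set pu] = [set pu].
Proof.
apply/seteqP; split => s /=; last by move=> ->; exact: (fix_unst E dA).
move=> fs; have es : exceptional R s by apply/(exc_act dA); rewrite fs; exact: exc_unst.
have [u u0 su] := excP es; move: fs; rewrite su blowup_map_pt//.
have au0 : mxact A u != 0 by exact: (act_neq0 E dA).
move/(surf_ptP (blow_dom0 au0) (blow_dom0 (bu_neq0 E))) => [[/eqP//]|[_ _ [c e]]].
apply: unst_dir => //; have := cs_act E u.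
rewrite e linearZ /= cs_bu mulr0 => /esym/eqP.
by rewrite mulf_eq0 invr_eq0 gt_eqF ?(lam_gt0 lam1)//= => /eqP.
Qed.

Lemma stab_preimage : f @^-1` [set ps] = [set ps].
Proof.
apply/seteqP; split => s /=; last by move=> ->; exact: (fix_stab E dA).
move=> fs; have es : exceptional R s by apply/(exc_act dA); rewrite fs; exact: exc_stab.
have [u u0 su] := excP es; move: fs; rewrite su blowup_map_pt//.
have au0 : mxact A u != 0 by exact: (act_neq0 E dA).
move/(surf_ptP (blow_dom0 au0) (blow_dom0 (bs_neq0 E))) => [[/eqP//]|[_ _ [c e]]].
apply: stab_dir => //; have := cu_act E u.
rewrite e linearZ /= cu_bs mulr0 => /esym/eqP.
by rewrite mulf_eq0 gt_eqF ?(lam_gt0 lam1)//= => /eqP.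
Qed.

(** Up to the factor ln lam this is the mean of the expansion rate, hence a
    weak-star continuous quantity. *)
Definition atom_gap (mu : probability (borel (surface R)) R) : R :=
  fine (mu [set pu]) - fine (mu [set ps]).

Lemma two_atoms (mu : probability (borel (surface R)) R) :
  [/\ 0 <= fine (mu [set pu]), 0 <= fine (mu [set ps]) &
      fine (mu [set pu]) + fine (mu [set ps]) <= 1].
Proof.
have mU := measurable_unst E dA lam1; have mS := measurable_stab E dA lam1.
have fin (B : set (borel (surface R))) : measurable B -> mu B \is a fin_num.
  exact: fin_num_measure.
split; [by apply: fine_ge0|by apply: fine_ge0|].
rewrite -fineD ?fin// -measureU//; last first.
  apply/seteqP; split => // s [-> e].
  by have := unst_neq_stab dA lam1 (E := E); rewrite e.
rewrite -[leRHS]/(fine 1%E) fine_le ?fin//; first exact: measurableU.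
by apply: probability_le1; exact: measurableU.
Qed.

Lemma atom1 (mu : probability (borel (surface R)) R) (p : surface R) :
  measurable ([set p] : set (borel (surface R))) ->
  fine (mu [set p]) = 1 -> mu [set p] = 1%E.
Proof.
move=> mp h; rewrite -[LHS]fineK; last exact: fin_num_measure.
by rewrite h.
Qed.

(** Each saddle is an invariant set by itself, so an ergodic measure gives it
    mass 0 or 1. *)
Lemma ergodic_gap (nu : probability (borel (surface R)) R) :
  ergodic_measure f nu ->
  [\/ atom_gap nu = 0, atom_gap nu = 1 /\ nu [set pu] = 1%E |
      atom_gap nu = -1 /\ nu [set ps] = 1%E].
Proof.
move=> [_ erg]; have mU := measurable_unst E dA lam1.
have mS := measurable_stab E dA lam1.
have [_ _] := two_atoms nu; rewrite /atom_gap.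
have [hu|hu] := erg _ mU unst_preimage; have [hs|hs] := erg _ mS stab_preimage.
- by rewrite hu hs /= subrr => _; constructor 1.
- by rewrite hu hs /= sub0r => _; constructor 3.
- by rewrite hu hs /= subr0 => _; constructor 2.
- by rewrite hu hs /=; lra.
Qed.

Section Limit.
Variables (nu : nat -> probability (borel (surface R)) R).
Variable mu : probability (borel (surface R)) R.
Hypotheses (mu_inv : invariant_measure f mu).
Hypotheses (nu_erg : forall n, ergodic_measure f (nu n)).
Hypothesis cvg_mu : weak_star_cvg nu mu.

Lemma gap_cvg (e : R) : 0 < e ->
  \forall n \near \oo, `|atom_gap mu - atom_gap (nu n)| < e.
Proof.
move=> e0; have l0 := ln_lam_gt0 lam1.
have := (weak_star_meanP nu mu (@continuous_bounded_borel _ _ _ E)).1 cvg_mu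
  _ (expansion_continuous dA (E := E)).
move/(@cvgrPdist_lt _ _ _ \oo)/(_ (ln lam * e)).
rewrite mulr_gt0// => /(_ isT); apply: filterS => n.
rewrite !(expansion_mean E dA lam1)//; last by case: (nu_erg n).
by rewrite -mulrBr normrM gtr0_norm// ltr_pM2l.
Qed.

(** The gap is weak-star continuous and the set {0, 1, -1} of its values on
    ergodic measures is closed. *)
Lemma limit_gap : mu [set pu] = mu [set ps] \/
  (mu [set pu] = 1%E \/ mu [set ps] = 1%E).
Proof.
have [hu hs hus] := two_atoms mu.
have mU := measurable_unst E dA lam1; have mS := measurable_stab E dA lam1.
have near_int (e : R) : 0 < e ->
   [\/ `|atom_gap mu| < e, `|atom_gap mu - 1| < e | `|atom_gap mu + 1| < e].
  move=> /gap_cvg/filter_ex[n]; have [->|[-> _]|[-> _]] := ergodic_gap (nu_erg n).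
  - by rewrite subr0; constructor 1.
  - by constructor 2.
  - by rewrite opprK; constructor 3.
have [h|h] := eqVneq (atom_gap mu) 0.
  left; move/eqP: h; rewrite subr_eq0 => /eqP h.
  by rewrite -[LHS]fineK ?fin_num_measure// h fineK ?fin_num_measure.
right; have [h1|h1] := eqVneq (atom_gap mu) 1.
  by left; apply: atom1 => //; move: h1 hu hs hus; rewrite /atom_gap; lra.
have [h2|h2] := eqVneq (atom_gap mu) (-1).
  by right; apply: atom1 => //; move: h2 hu hs hus; rewrite /atom_gap; lra.
exfalso; pose e := Num.min `|atom_gap mu| (Num.min `|atom_gap mu - 1| `|atom_gap mu + 1|).
have e0 : 0 < e.
  by rewrite !lt_min !normr_gt0 h subr_eq0 h1 -(opprK 1) subr_eq0 h2.
have := near_int e e0; rewrite /e; case.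
- by rewrite lt_min ltxx.
- by rewrite !lt_min ltxx andbF.
- by rewrite !lt_min ltxx !andbF.
Qed.

(** The set {0, 1, -1} is discrete, so the gap of [nu n] is eventually equal
    to 1. *)
Lemma limit_unst : mu [set pu] = 1%E ->
  \forall n \near \oo, nu n [set pu] = 1%E.
Proof.
move=> h; have [hu hs hus] := two_atoms mu.
have := @gap_cvg 1 ltr01; apply: filterS => n.
have [->|[_ ->]//|[-> _]] := ergodic_gap (nu_erg n).
  by move: hs hus; rewrite subr0 /atom_gap h /= => hs hus; rewrite ltNge ler_normr => /negP[]; lra.
by move: hs hus; rewrite /atom_gap h /= => hs hus; rewrite ltNge ler_normr => /negP[]; lra.
Qed.

Lemma limit_stab : mu [set ps] = 1%E ->
  \forall n \near \oo, nu n [set ps] = 1%E.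
Proof.
move=> h; have [hu hs hus] := two_atoms mu.
have := @gap_cvg 1 ltr01; apply: filterS => n.
have [->|[-> _]|[_ ->]//] := ergodic_gap (nu_erg n).
  by move: hu hus; rewrite subr0 /atom_gap h /= => hu' hus'; rewrite ltNge ler_normr => /negP[]; lra.
by move: hu hus; rewrite /atom_gap h /= => hu' hus'; rewrite ltNge ler_normr => /negP[]; lra.
Qed.

End Limit.
End Necessity.

(** * Shadowing closed pseudo-orbits *)

Section IntegerAction.
Context (R : realType) (A : 'M[int]_2).
Hypothesis dA : \det A = 1.
Implicit Types (v w : 'rV[R]_2).

Lemma mxactE v j : mxact A v ord0 j =
  v ord0 ord0 * (A j ord0)%:~R + v ord0 ord_max * (A j ord_max)%:~R.
Proof.
rewrite /mxact mxE !big_ord_recl big_ord0 addr0 !mxE.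
by rewrite (_ : lift ord0 ord0 = ord_max) //; apply/val_inj.
Qed.

Lemma det2 : A ord0 ord0 * A ord_max ord_max - A ord0 ord_max * A ord_max ord0 = 1.
Proof.
rewrite -dA (expand_det_row _ ord0) !big_ord_recl big_ord0 addr0.
rewrite /cofactor !det_mx11 !mxE /= expr0 expr1 mul1r.
rewrite (_ : lift ord0 ord0 = ord_max :> 'I_2); last exact/val_inj.
rewrite (_ : lift ord_max ord0 = ord0 :> 'I_2); last exact/val_inj.
by rewrite mulN1r mulrN.
Qed.

Lemma cayley2 v : mxact A (mxact A v) =
  (A ord0 ord0 + A ord_max ord_max)%:~R *: mxact A v - v.
Proof.
have := congr1 (fun k : int => k%:~R : R) det2; rewrite /= intrB !intrM => h.
have e (t : R) (w : 'rV[R]_2) i : (t *: w - v) ord0 i = t * w ord0 i - v ord0 i.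
  by rewrite !mxE.
apply: row2P; rewrite e !mxactE intrD.
  rewrite -[X in _ - X]mulr1 -[X in _ - _ * X]h; ring.
rewrite -[X in _ - X]mulr1 -[X in _ - _ * X]h; ring.
Qed.

Definition even_lattice v := exists2 w, lattice w & v = 2 *: w.

Lemma lattice_int (k : int) v : lattice v -> lattice (k%:~R *: v).
Proof.
by move=> [m ->]; exists (k *: m); apply/rowP => i; rewrite !mxE intrM.
Qed.

(** The group SL(2, Z/2) has order 6. Concretely, A^2 = t A - 1 gives A^6 - 1
    = (t^2 - 3) t (t^2 - 1) A + (t^2 - 1) (2 - t^2), where t (t^2 - 1) and
    (t^2 - 1) (2 - t^2) are even. *)
Lemma iter6_even v : lattice v -> even_lattice (iter 6 (mxact A) v - v).
Proof.
move=> lv; pose t := A ord0 ord0 + A ord_max ord_max.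
have [a ta] : exists a, t = 2 * a \/ t = 2 * a + 1.
  exists (t %/ 2)%Z; have := divz_eq t 2; have := modz_ge0 t (isT : 2 != 0 :> int).
  by have := ltz_pmod t (isT : 0 < 2 :> int); lia.
have [b [c [hb hc]]] : exists b c, 2 * b = t * (t ^+ 2 - 1) /\
    2 * c = (t ^+ 2 - 1) * (2 - t ^+ 2).
  case: ta => ->.
    by exists (a * ((2 * a) ^+ 2 - 1)), (((2 * a) ^+ 2 - 1) * (1 - 2 * a ^+ 2)); split; ring.
  exists ((2 * a + 1) * (2 * a ^+ 2 + 2 * a)),
    ((2 * a ^+ 2 + 2 * a) * (2 - (2 * a + 1) ^+ 2)).
  by split; ring.
exists (((t ^+ 2 - 3) * b)%:~R *: mxact A v + c%:~R *: v).
  by apply: latticeD; apply: lattice_int => //; exact: lattice_act.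
have cay w : mxact A (mxact A w) = t%:~R *: mxact A w - w by exact: cayley2.
rewrite /= !(cay, mxactB, mxactZ).
have {}hb : 2 * b%:~R = t%:~R * (t%:~R ^+ 2 - 1) :> R.
  by have := congr1 (fun k : int => k%:~R : R) hb; rewrite /= !(intrM, intrB, rmorphXn).
have {}hc : 2 * c%:~R = (t%:~R ^+ 2 - 1) * (2 - t%:~R ^+ 2) :> R.
  by have := congr1 (fun k : int => k%:~R : R) hc; rewrite /= !(intrM, intrB, rmorphXn).
move: (mxact A v) => w; apply/rowP => i; rewrite !mxE !(intrM, intrB, rmorphXn) /=.
set x := w ord0 i; set y := v ord0 i; set q := t%:~R.
transitivity ((q ^+ 2 - 3) * (2 * b%:~R) * x + (2 * c%:~R) * y); last by ring.
rewrite hb hc -/q; ring.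
Qed.

End IntegerAction.

Section Shadowing.
Context (R : realType) (A : 'M[int]_2) (lam : R) (E : eigenframe A lam).
Hypothesis lam1 : 1 < lam.
Local Notation enorm := (enorm E).
Local Notation latdist := (latdist E).
Implicit Types (v w z : 'rV[R]_2) (l y : nat -> 'rV[R]_2).

(** When the [l i] are lattice vectors, this is a planar lift of a true orbit
    on the torus. *)
Fixpoint pseudo l z n : 'rV[R]_2 :=
  if n is m.+1 then mxact A (pseudo l z m) + l m else z.

Lemma frame_inj v w : cu E v = cu E w -> cs E v = cs E w -> v = w.
Proof. by move=> h1 h2; rewrite (frame_dec E v) (frame_dec E w) h1 h2. Qed.

Lemma cu_pseudo l z n : cu E (pseudo l z n) = lam ^+ n * cu E z + cu E (pseudo l 0 n).
Proof.
elim: n => [|n ih] /=; first by rewrite expr0 mul1r linear0 addr0.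
by rewrite !linearD !cu_act ih exprS mulrDr mulrA addrA.
Qed.

Lemma cs_pseudo l z n :
  cs E (pseudo l z n) = lam^-1 ^+ n * cs E z + cs E (pseudo l 0 n).
Proof.
elim: n => [|n ih] /=; first by rewrite expr0 mul1r linear0 addr0.
by rewrite !linearD !cs_act ih exprS mulrDr mulrA addrA.
Qed.

(** In eigencoordinates the closing condition is a scalar affine equation with
    leading coefficient 1 - lam^P or 1 - lam^-P, which is not zero. *)
Lemma pseudo_periodic l P : (0 < P)%N -> exists z, pseudo l z P = z.
Proof.
move=> P0; set c := pseudo l 0 P.
have a1 : 1 - lam ^+ P != 0.
  by rewrite subr_eq0 eq_sym gt_eqF// exprn_egt1// -lt0n.
have a2 : 1 - lam^-1 ^+ P != 0.
  by rewrite subr_eq0 eq_sym lt_eqF// exprn_ilt1 ?(lamV_lt1 lam1)// ?(ltW (lamV_gt0 lam1))// -lt0n.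
exists ((cu E c / (1 - lam ^+ P)) *: bu E + (cs E c / (1 - lam^-1 ^+ P)) *: bs E).
apply: frame_inj.
  rewrite cu_pseudo -/c !linearD !linearZ /= cu_bu cu_bs mulr0 addr0 mulr1.
  by set q := lam ^+ P in a1 *; field; exact: a1.
rewrite cs_pseudo -/c !linearD !linearZ /= cs_bu cs_bs mulr0 add0r mulr1.
by set q := lam^-1 ^+ P in a2 *; field; exact: a2.
Qed.

(** The unstable error is bounded through the next one and the stable error
    through the previous one, each time with a factor 1 / lam. Summed over a
    cycle, the shifted sums are equal and can be absorbed. *)
Lemma error_sum (e d : nat -> 'rV[R]_2) P :
  (forall i, e i.+1 = mxact A (e i) - d i) -> e P = e 0%N ->
  \sum_(i < P) enorm (e i) <= lam / (lam - 1) * \sum_(i < P) enorm (d i).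
Proof.
move=> eS eP.
have shift (g : 'rV[R]_2 -> R) :
    \sum_(i < P) g (e i.+1) = \sum_(i < P) g (e i).
  case: P eP => [|P] eP; first by rewrite !big_ord0.
  by rewrite big_ord_recr big_ord_recl /= eP addrC.
have l0 := lam_gt0 lam1; have l1 : 0 < lam - 1 by rewrite subr_gt0.
have lv := lamV_gt0 lam1.
have sU : \sum_(i < P) `|cu E (e i)| <= lam / (lam - 1) * \sum_(i < P) `|cu E (d i)|.
  have h : lam * \sum_(i < P) `|cu E (e i)| <=
      \sum_(i < P) `|cu E (e i)| + \sum_(i < P) `|cu E (d i)|.
    rewrite -[X in _ <= X + _](shift (fun v => `|cu E v|)) mulr_sumr -big_split /=.
    apply: ler_sum => i _; rewrite eS linearB cu_act.
    have := ler_normD (lam * cu E (e i) - cu E (d i)) (cu E (d i)).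
    by rewrite subrK normrM gtr0_norm.
  have s0 : 0 <= \sum_(i < P) `|cu E (d i)| by rewrite sumr_ge0.
  rewrite mulrAC ler_pdivlMr//.
  have s1 := ler_peMl s0 (ltW lam1).
  move: h s1; set s := \sum_(i < P) _; set t := \sum_(i < P) _ => h s1; lra.
have sS : \sum_(i < P) `|cs E (e i)| <= lam / (lam - 1) * \sum_(i < P) `|cs E (d i)|.
  have h : \sum_(i < P) `|cs E (e i)| <=
      lam^-1 * \sum_(i < P) `|cs E (e i)| + \sum_(i < P) `|cs E (d i)|.
    rewrite -[X in X <= _](shift (fun v => `|cs E v|)) mulr_sumr -big_split /=.
    apply: ler_sum => i _; rewrite eS linearB cs_act.
    by apply: le_trans (ler_normB _ _) _; rewrite normrM gtr0_norm.
  rewrite mulrAC ler_pdivlMr//.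
  move: h; set s := \sum_(i < P) _; set t := \sum_(i < P) _ => h.
  have := ler_wpM2l (ltW l0) h; rewrite mulrDr mulrA mulfV ?gt_eqF// mul1r.
  by lra.
have := lerD sU sS; rewrite -mulrDr -!big_split /=.
have -> : \sum_(i < P) (`|cu E (d i)| + `|cs E (d i)|) = \sum_(i < P) enorm (d i).
  by apply: eq_bigr => i _; rewrite enormE.
have -> : \sum_(i < P) (`|cu E (e i)| + `|cs E (e i)|) = \sum_(i < P) enorm (e i).
  by apply: eq_bigr => i _; rewrite enormE.
by [].
Qed.

(** Only the total size of the jumps matters. Long exact segments joined by
    bounded jumps are thus shadowed well on average, without connecting
    segments. *)
Lemma shadowing l y P z : pseudo l z P = z -> y P = y 0%N ->
  \sum_(i < P) enorm (pseudo l z i - y i) <=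
  lam / (lam - 1) * \sum_(i < P) enorm (y i.+1 - mxact A (y i) - l i).
Proof.
move=> zP yP.
apply: (@error_sum (fun i => pseudo l z i - y i)
  (fun i => y i.+1 - mxact A (y i) - l i)) => [i|]; last by rewrite /= zP yP.
by rewrite /= mxactB; apply/rowP => j; rewrite !mxE; ring.
Qed.

Lemma pseudo_lattice l z n : (forall i, lattice (l i)) ->
  lattice (pseudo l z n - iter n (mxact A) z).
Proof.
move=> ll; elim: n => [|n ih] /=; first by rewrite subrr; exact: lattice0.
rewrite addrAC -mxactB; apply: latticeD => //; exact: lattice_act.
Qed.

End Shadowing.

Section Closing.
Context (R : realType) (A : 'M[int]_2) (lam : R) (E : eigenframe A lam).
Hypotheses (dA : \det A = 1) (lam1 : 1 < lam).
Local Notation enorm := (enorm E).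
Local Notation latdist := (latdist E).
Local Notation e0 := (delta_mx ord0 ord0 : 'rV[R]_2).
Implicit Types (v w z : 'rV[R]_2) (l y : nat -> 'rV[R]_2).

Lemma iter_mxact_lattice v n : lattice v -> lattice (iter n (mxact A) v).
Proof. by move=> lv; elim: n => //= n; exact: lattice_act. Qed.

Lemma iter_mxactB n v w :
  iter n (mxact A) (v - w) = iter n (mxact A) v - iter n (mxact A) w.
Proof. by elim: n => //= n ->; rewrite mxactB. Qed.

Lemma iter6m_even m v : lattice v -> even_lattice (iter (6 * m) (mxact A) v - v).
Proof.
move=> lv; elim: m => [|m [w lw h]].
  by exists 0; [exact: lattice0|rewrite muln0 /= subrr scaler0].
have [w' lw' h'] := iter6_even dA (iter_mxact_lattice (6 * m) lv).
exists (w + w'); first exact: latticeD.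
rewrite mulnS iterD scalerDr -h -h'.
by rewrite [RHS]addrC addrA subrK.
Qed.

Lemma e0_not_even : ~ even_lattice e0.
Proof.
move=> [w [n ->]] /rowP/(_ ord0); rewrite !mxE /= => h.
have : (2 * n ord0 ord0)%:~R = 1%:~R :> R by rewrite intrM -h.
by move/intr_inj; lia.
Qed.

Lemma lattice_e0 : lattice e0.
Proof.
exists (delta_mx ord0 ord0); apply/rowP => i; rewrite !mxE.
by case: (_ && _).
Qed.

Lemma even_latticeN v : even_lattice v -> even_lattice (- v).
Proof. by move=> [w lw ->]; exists (- w); [exact: latticeN|rewrite scalerN]. Qed.

(** If the point that shadows [y] is a lattice vector, replace the last
    lattice jump by its translate by e0. If the new point is a lattice vector
    too, the difference w of the two satisfies A^(6 m) w + e0 = w; since A^(6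
    m) is the identity modulo 2, e0 would be even. *)
Lemma closing_lemma l y m : (forall i, lattice (l i)) -> y (6 * m)%N = y 0%N ->
  (0 < m)%N ->
  exists z, [/\ ~ lattice z, lattice (iter (6 * m) (mxact A) z - z) &
    \sum_(i < 6 * m) latdist (iter i (mxact A) z - y i) <=
    lam / (lam - 1) *
     (\sum_(i < 6 * m) enorm (y i.+1 - mxact A (y i) - l i) + enorm e0)].
Proof.
move=> ll yP m0; have P0 : (0 < 6 * m)%N by rewrite muln_gt0.
have k0 : 0 < lam / (lam - 1).
  by rewrite divr_gt0 ?(lam_gt0 lam1)// subr_gt0.
have fin (l' : nat -> 'rV[R]_2) z : (forall i, lattice (l' i)) ->
    pseudo A l' z (6 * m) = z ->
    (forall i, enorm (y i.+1 - mxact A (y i) - l' i) <=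
      enorm (y i.+1 - mxact A (y i) - l i) + (i == (6 * m).-1)%:R * enorm e0) ->
    lattice (iter (6 * m) (mxact A) z - z) /\
    \sum_(i < 6 * m) latdist (iter i (mxact A) z - y i) <=
    lam / (lam - 1) *
     (\sum_(i < 6 * m) enorm (y i.+1 - mxact A (y i) - l i) + enorm e0).
  move=> ll' zP hl; split.
    have := latticeN (pseudo_lattice A z (6 * m) ll').
    by rewrite opprB zP.
  apply: (@le_trans _ _ (\sum_(i < 6 * m) enorm (pseudo A l' z i - y i))).
    apply: ler_sum => i _.
    rewrite (latdist_per E (w := pseudo A l' z i - y i)) ?latdist_le_enorm//.
    have := latticeN (pseudo_lattice A z i ll'); congr lattice.
    by apply/rowP => j; rewrite !mxE; ring.
  apply: le_trans (shadowing E lam1 zP yP) _.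
  rewrite ler_wpM2l ?(ltW k0)//.
  apply: (@le_trans _ _ (\sum_(i < 6 * m) (enorm (y i.+1 - mxact A (y i) - l i) +
     (i == (6 * m).-1 :> nat)%:R * enorm e0))).
    by apply: ler_sum => i _; exact: hl.
  rewrite big_split /= lerD2l -mulr_suml ler_piMl ?enorm_ge0//.
  have hlast : ((6 * m).-1 < 6 * m)%N by rewrite prednK.
  rewrite (bigD1 (Ordinal hlast)) //= eqxx big1 ?addr0// => i.
  by rewrite -val_eqE /= => /negbTE ->.
have [z zP] := pseudo_periodic E lam1 l P0.
have [lz|nlz] := pselect (lattice z); last first.
  exists z; have [|||h1 h2] := fin l z => //.
  by move=> i; rewrite lerDl mulr_ge0 ?enorm_ge0.
pose l' i := if i == (6 * m).-1 then l i + e0 else l i.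
have ll' i : lattice (l' i).
  by rewrite /l'; case: ifP => // _; apply: latticeD => //; exact: lattice_e0.
have [z' zP'] := pseudo_periodic E lam1 l' P0.
exists z'; have [|||h1 h2] := fin l' z' => //.
  move=> i; rewrite /l'; case: ifP => [_|_].
    rewrite mul1r opprD addrA; apply: le_trans (enormD _ _ _) _.
    by rewrite enormN.
  by rewrite mul0r addr0.
split => //; move=> lz'.
have hn n : (n <= (6 * m).-1)%N ->
    pseudo A l' z' n - pseudo A l z n = iter n (mxact A) (z' - z).
  elim: n => [//|n ih] hn /=; rewrite -ih; last exact: ltnW.
  rewrite /l' ltn_eqF// mxactB.
  by apply/rowP => i; rewrite !mxE; ring.
have : pseudo A l' z' (6 * m) - pseudo A l z (6 * m) =
    iter (6 * m) (mxact A) (z' - z) + e0.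
  rewrite -(prednK P0) /= -hn// /l' eqxx mxactB.
  by apply/rowP => i; rewrite !mxE; ring.
rewrite zP zP' => h.
apply: e0_not_even.
have : even_lattice (iter (6 * m) (mxact A) (z' - z) - (z' - z)).
  by apply: iter6m_even; exact: latticeB.
move/even_latticeN; congr even_lattice.
by rewrite opprB {1}h addrC addKr.
Qed.

End Closing.

(** * Sampling a measure at finitely many points *)

Section Sampling.
Context {R : realType} {T : ptopologicalType}.
Variable mu : probability (borel T) R.

(** Each new point is chosen so that its deviation vector has an almost
    nonpositive scalar product with the sum of the previous ones, which is
    possible because deviations have mean zero. The squared norm of the sum
    then grows linearly, as it would for independent samples. *)
Lemma greedy_sample (I : finType) (H : I -> T -> R) :
  (forall i, bounded_borel (H i)) ->
  (forall i x, `|H i x - mean mu (H i)| <= 1) ->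
  forall K, exists x : nat -> T,
    \sum_i (\sum_(j < K) (H i (x j) - mean mu (H i))) ^+ 2 <=
    K%:R * (#|I|%:R + 1).
Proof.
move=> bH H1; elim=> [|K [x hx]].
  exists (fun=> point); rewrite mul0r; apply: sumr_le0 => i _.
  by rewrite big_ord0 expr0n.
pose S i := \sum_(j < K) (H i (x j) - mean mu (H i)).
have bS i : bounded_borel (fun s => S i * (H i s - mean mu (H i))).
  apply: bounded_borelM; first exact: bounded_borel_cst.
  by apply: bounded_borelB => //; exact: bounded_borel_cst.
have m0 : mean mu (fun x => \sum_(i <- index_enum I) S i * (H i x - mean mu (H i))) = 0.
  rewrite mean_sum// big1// => i _.
  rewrite meanZ; last by apply: bounded_borelB => //; exact: bounded_borel_cst.
  by rewrite meanB ?mean_cst ?subrr ?mulr0//; exact: bounded_borel_cst.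
(* The slack 1/2 contributes 1 to the square of the norm. *)
have [s' hs'] : exists s, \sum_i S i * (H i s - mean mu (H i)) <= 2^-1.
  have h2 : 0 < 2^-1 :> R by rewrite invr_gt0.
  have [s' hs'] := mean_exists_le mu (bounded_borel_sum (index_enum I) bS) h2.
  by exists s'; rewrite m0 add0r in hs'.
exists (fun j => if (j < K)%N then x j else s').
have step i : \sum_(j < K.+1) (H i (if (j < K)%N then x j else s') - mean mu (H i)) =
    S i + (H i s' - mean mu (H i)).
  rewrite big_ord_recr /= ltnn; congr (_ + _); apply: eq_bigr => j _.
  by rewrite ltn_ord.
under eq_bigr do rewrite step sqrrD.
rewrite !big_split /=.
have h3 : \sum_i (H i s' - mean mu (H i)) ^+ 2 <= #|I|%:R.
  rewrite -sum1_card natr_sum; apply: ler_sum => i _.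
  by rewrite -real_normK ?num_real// expr_le1.
rewrite -natr1 mulrDl mul1r -addrA; apply: lerD => //.
by rewrite addrC; apply: lerD => //; move: hs'; lra.
Qed.

Lemma finite_sample (I : finType) (H : I -> T -> R) (e : R) : 0 < e ->
  (forall i, bounded_borel (H i)) ->
  (forall i x, `|H i x - mean mu (H i)| <= 1) ->
  exists (K : nat) (x : nat -> T), (0 < K)%N /\
   forall i, `|K%:R^-1 * (\sum_(j < K) H i (x j)) - mean mu (H i)| <= e.
Proof.
move=> e0 bH H1.
(* The mean square deviation is at most (#|I| + 1) / K. *)
pose K := (Num.truncn ((#|I|%:R + 1) / e ^+ 2)).+1.
have hK : (#|I|%:R + 1) / e ^+ 2 < K%:R by exact: truncnS_gt.
have [x hx] := greedy_sample bH H1 K.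
exists K, x; split => // i.
have K0 : 0 < K%:R :> R by rewrite ltr0n.
have -> : K%:R^-1 * (\sum_(j < K) H i (x j)) - mean mu (H i) =
   K%:R^-1 * \sum_(j < K) (H i (x j) - mean mu (H i)).
  rewrite big_split /= sumr_const card_ord mulrDr; congr (_ + _).
  by rewrite -[(- _) *+ K]mulr_natl mulrA mulVf ?mul1r// gt_eqF.
rewrite normrM gtr0_norm ?invr_gt0// mulrC ler_pdivrMr//.
rewrite -(@ler_pXn2r _ 2) ?nnegrE// ?mulr_ge0// ?(ltW e0)//.
rewrite real_normK ?num_real//.
apply: (@le_trans _ _ (K%:R * (#|I|%:R + 1))).
  apply: le_trans hx; rewrite (bigD1 i) //= lerDl sumr_ge0// => j _.
  exact: sqr_ge0.
rewrite ltr_pdivrMr ?exprn_gt0// in hK.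
rewrite (_ : (e * K%:R) ^+ 2 = K%:R * (K%:R * e ^+ 2)); last by ring.
by rewrite ler_wpM2l ?(ltW K0)// ltW.
Qed.

End Sampling.

Section Grid.
Context (R : realType) (A : 'M[int]_2) (lam : R) (E : eigenframe A lam).
Local Notation enorm := (enorm E).
Local Notation latdist := (latdist E).
Variable n : nat.
Implicit Types (v w : 'rV[R]_2) (c : 'I_n.+1 * 'I_n.+1).

Definition grid_pt c : 'rV[R]_2 :=
  \row_j ((if j == ord0 then c.1 : nat else c.2 : nat)%:R / n.+1%:R).

Definition grid_radius : R := 2 * enorm_bound E / n.+1%:R.

Lemma grid_radius_gt0 : 0 < grid_radius.
Proof. by rewrite divr_gt0 ?ltr0n// mulr_gt0 ?enorm_bound_gt0. Qed.

Lemma frac_grid (x : R) : exists (k : 'I_n.+1) (z : int),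
  `|x - z%:~R - (k : nat)%:R / n.+1%:R| <= n.+1%:R^-1.
Proof.
have nR : 0 < n.+1%:R :> R by rewrite ltr0n.
pose k := Num.floor (n.+1%:R * x).
have n0 : n.+1%:Z != 0 by [].
have kp := ltz_pmod k (isT : 0 < n.+1%:Z); have k0 := modz_ge0 k n0.
have kb : (`|(k %% n.+1%:Z)%Z| < n.+1)%N by lia.
exists (Ordinal kb), (k %/ n.+1%:Z)%Z; rewrite /=.
have kE : k%:~R = (k %/ n.+1%:Z)%Z%:~R * n.+1%:R + `|(k %% n.+1%:Z)%Z|%N%:R :> R.
  rewrite {1}(divz_eq k n.+1%:Z) intrD intrM; congr (_ + _).
  by rewrite pmulrn gez0_abs.
have := floor_le (n.+1%:R * x); have := floorD1_gt (n.+1%:R * x).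
rewrite -/k intrD kE => h1 h2.
rewrite -(ler_pM2l nR) mulfV ?gt_eqF// -[X in X * _](gtr0_norm nR) -normrM.
rewrite !mulrBr mulrCA mulfV ?gt_eqF// mulr1.
by rewrite ler_norml; apply/andP; split; lra.
Qed.

Lemma row_norm_le v (r : R) : `|v ord0 ord0| <= r -> `|v ord0 ord_max| <= r -> `|v| <= r.
Proof.
move=> h0 h1; rewrite [leLHS]/Num.norm /= mx_normrE; apply/bigmax_leP; split.
  exact: le_trans h0.
move=> [i j] _ /=; rewrite (ord1 i); case: (unliftP ord0 j) => [j' ->|-> //].
by rewrite (_ : lift ord0 j' = ord_max) //; apply/val_inj => /=; case: j' => [[]].
Qed.

Lemma grid_near v : exists c, latdist (v - grid_pt c) <= grid_radius / 2.
Proof.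
have [c1 [z1 h1]] := frac_grid (v ord0 ord0).
have [c2 [z2 h2]] := frac_grid (v ord0 ord_max).
exists (c1, c2).
pose z : 'rV[R]_2 := \row_j (if j == ord0 then z1%:~R else z2%:~R).
have lz : lattice z.
  exists (\row_j (if j == ord0 then z1 else z2)); apply/rowP => j; rewrite !mxE.
  by case: ifP.
apply: le_trans (latdist_le E _ lz) _; apply: le_trans (enorm_le _ _) _.
have -> : grid_radius / 2 = enorm_bound E * n.+1%:R^-1.
  by rewrite /grid_radius mulrC mulrA mulrA mulVf// mul1r.
rewrite ler_wpM2l ?(ltW (enorm_bound_gt0 E))//.
by apply: row_norm_le; rewrite !mxE /= addrAC.
Qed.

Definition tent c v : R := Num.max 0 (grid_radius - latdist (v - grid_pt c)).
Definition tent_sum v : R := \sum_c tent c v.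
(** A partition of unity whose members are supported near the points of a
    grid. *)
Definition tent_part c v : R := tent c v / tent_sum v.

Lemma tent_ge0 c v : 0 <= tent c v.
Proof. by rewrite le_max lexx. Qed.

Lemma tent_sum_gt0 v : 0 < tent_sum v.
Proof.
have [c h] := grid_near v; have r0 := grid_radius_gt0.
rewrite /tent_sum (bigD1 c) //= ltr_pwDl//; last first.
  by apply: sumr_ge0 => i _; exact: tent_ge0.
by rewrite lt_max; apply/orP; right; lra.
Qed.

Lemma tent_part_ge0 c v : 0 <= tent_part c v.
Proof. by rewrite divr_ge0 ?tent_ge0// ltW// tent_sum_gt0. Qed.

Lemma tent_part_sum v : \sum_c tent_part c v = 1.
Proof. by rewrite -mulr_suml mulfV// gt_eqF// tent_sum_gt0. Qed.

Lemma tent_part_le1 c v : tent_part c v <= 1.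
Proof.
rewrite -(tent_part_sum v) (bigD1 c) //= lerDl sumr_ge0// => i _.
exact: tent_part_ge0.
Qed.

Lemma tent_part_near c v : tent_part c v != 0 -> latdist (v - grid_pt c) <= grid_radius.
Proof.
apply: contraR; rewrite -ltNge => h; rewrite /tent_part /tent max_l ?mul0r//.
by rewrite subr_le0 ltW.
Qed.

Lemma tent_lip c v w : `|tent c v - tent c w| <= enorm (v - w).
Proof.
have := latdist_lip E (v - grid_pt c) (w - grid_pt c).
rewrite (_ : v - grid_pt c - (w - grid_pt c) = v - w); last first.
  by apply/rowP => j; rewrite !mxE; ring.
apply: le_trans; rewrite /tent.
set a := latdist _; set b := latdist _; set r := grid_radius.
have h1 := ler_norm (a - b); have := ler_norm (b - a); rewrite distrC => h2.
rewrite ler_norml; set c0 := `|a - b| in h1 h2 *.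
by rewrite /Num.max; do !case: ifPn; rewrite ?ltNge ?negbK => *; apply/andP; split; lra.
Qed.

Lemma tent_part_continuous c : continuous (tent_part c).
Proof.
move=> v; apply: (@cvgM _ _ (nbhs v) _ (tent c) (fun w => (tent_sum w)^-1)).
  apply: (@lip_continuous _ _ _ E _ 1) => a b; rewrite mul1r; exact: tent_lip.
apply: (@cvgV _ _ (nbhs v)); first by rewrite gt_eqF// tent_sum_gt0.
apply: (@lip_continuous _ _ _ E _ (#|{: 'I_n.+1 * 'I_n.+1}|%:R)) => a b.
rewrite /tent_sum -sumrB; apply: le_trans (ler_norm_sum _ _ _) _.
apply: (@le_trans _ _ (\sum_(c0 : 'I_n.+1 * 'I_n.+1) enorm (a - b))).
  by apply: ler_sum => i _; exact: tent_lip.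
by rewrite sumr_const mulr_natl.
Qed.

Lemma tent_part_periodic c : lattice_periodic (tent_part c).
Proof.
have h d : lattice_periodic (tent d).
  move=> v w l; rewrite /tent (latdist_per E (w := w - grid_pt d))//.
  by rewrite (_ : v - grid_pt d - (w - grid_pt d) = v - w)//; apply/rowP => j; rewrite !mxE; ring.
move=> v w l; rewrite /tent_part (h c v w l) /tent_sum.
by under eq_bigr do rewrite (h _ v w l).
Qed.

End Grid.

Section Modulus.
Context (R : realType) (A : 'M[int]_2) (lam : R) (E : eigenframe A lam).
Local Notation enorm := (enorm E).
Local Notation latdist := (latdist E).

Lemma box_compact : compact [set v : 'rV[R]_2 | `|v| <= 2^-1].
Proof.
apply: bounded_closed_compact.
  exists (2^-1); split; first exact: num_real.
  by move=> x x1 v /= h; rewrite (le_trans h)// ltW.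
apply: (closed_comp (f := @Num.norm _ 'rV[R]_2) (D := [set x | x <= 2^-1])).
  by move=> x _; exact: norm_continuous.
exact: closed_le.
Qed.

Lemma periodic_bounded (G : 'rV[R]_2 -> R) : lattice_periodic G -> continuous G ->
  exists2 M, 0 < M & forall v, `|G v| <= M.
Proof.
move=> pG cG.
have [M M0 hM] := surface_bounded E (planar_continuous E pG cG).
exists M => // v.
have [lv|nlv] := pselect (lattice v).
  have h := hM (surf_pt 0 (bu E)); rewrite /= (periodic_planar pG) in h.
    by rewrite (pG v (0 *: bu E))// scale0r subr0.
  exact: blow_dom0 (bu_neq0 E).
have hd : blow_dom R (1, v).
  split => /=; first by apply/eqP => e; apply: nlv; rewrite e; exact: lattice0.
  by rewrite scale1r.
by have := hM (surf_pt 1 v); rewrite /= (periodic_planar pG hd) scale1r.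
Qed.

(** Uniform continuity on the torus, in an affine form that can be averaged
    along orbits: at distances where continuity says nothing, the linear term
    exceeds the oscillation of [G]. *)
Lemma periodic_modulus (G : 'rV[R]_2 -> R) (eta : R) : lattice_periodic G -> continuous G ->
  0 < eta -> exists2 k, 0 <= k &
  forall a b, `|G a - G b| <= eta + k * latdist (a - b).
Proof.
move=> pG cG eta0; have [M M0 hM] := periodic_bounded pG cG.
have /compact_near_coveringP/(_ _ (@pinfty_nbhs R)
  (fun k a => forall b, `|G a - G b| <= eta + k * latdist (a - b))) := box_compact.
have cover (a : 'rV[R]_2) : [set v : 'rV[R]_2 | `|v| <= 2^-1] a ->
  \forall a' \near a & k \near +oo%R,
    forall b, `|G a' - G b| <= eta + k * latdist (a' - b).
  move=> _.
  have e2 : 0 < eta / 2 by rewrite divr_gt0.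
  have hn : \forall w \near a, `|G a - G w| < eta / 2.
    by have := cG a; move/(@cvgrPdist_lt _ _ _ (nbhs a)); apply.
  have [d /= d0 hd] := proj1 (nbhs_ballP _ _) hn.
  have d2 : 0 < d / 2 by rewrite divr_gt0.
  exists (ball a (d / 2), [set k | 2 * M / (d / 2) < k]).
    split => /=; last by apply: nbhs_pinfty_gt; exact: num_real.
    exact: nbhsx_ballx.
  move=> [a' k] [/= ha hk] b.
  have k0 : 0 < k by apply: lt_trans hk; rewrite divr_gt0// mulr_gt0.
  have [hb|hb] := ltP (latdist (a' - b)) (d / 2); last first.
    apply: (@le_trans _ _ (2 * M)).
      apply: le_trans (ler_normB _ _) _; rewrite mulr_natl mulr2n.
      by apply: lerD; exact: hM.
    apply: ler_wpDl; first exact: ltW.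
    move: hk; rewrite ltr_pdivrMr// => /ltW/le_trans; apply.
    by rewrite ler_wpM2l// ltW.
  have [m lm hm] := latdist_lt hb.
  rewrite (pG b (b + m)); last first.
    by rewrite opprD addrA subrr sub0r; exact: latticeN.
  have h1 : `|G a - G a'| < eta / 2.
    apply: hd; rewrite -ball_normE /= in ha *.
    by apply: lt_le_trans ha _; rewrite ler_pdivrMr// ler_peMr ?(ltW d0)// ler1n.
  have h2 : `|G a - G (b + m)| < eta / 2.
    apply: hd; rewrite -ball_normE /= in ha *.
    rewrite (_ : a - (b + m) = (a - a') + (a' - b - m)); last first.
      by apply/rowP => j; rewrite !mxE; ring.
    apply: le_lt_trans (ler_normD _ _) _.
    rewrite [ltRHS](splitr d); apply: ltrD => //.
    by apply: le_lt_trans (norm_le_enorm E _) hm.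
  apply: (@le_trans _ _ eta); last by rewrite lerDl mulr_ge0 ?latdist_ge0// ltW.
  rewrite (_ : G a' - G (b + m) = (G a - G (b + m)) - (G a - G a')); last by ring.
  apply: le_trans (ler_normB _ _) _.
  by rewrite [leRHS](splitr eta) lerD// ltW.
move=> /(_ _ cover) hk.
have h0 : \forall k \near +oo%R, (0 : R) < k by exact: nbhs_pinfty_gt.
have [k [k0 hk']] := filter_ex (filterI h0 hk).
exists k => [|a b]; first exact: ltW.
have [m lm hm] := lattice_round a.
rewrite (pG a (a - m)); last by rewrite opprB addrC subrK.
rewrite (latdist_per E (v := a - b) (w := a - m - b)).
  by apply: hk'.
by rewrite (_ : a - b - (a - m - b) = m)//; apply/rowP => j; rewrite !mxE; ring.
Qed.

End Modulus.

(** * Equidistribution of periodic orbits on the torus *)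

(** Division with remainder by N identifies indices below K N with pairs
    (block, position in the block). *)
Lemma block_sum (R : realType) (F : nat -> nat -> R) (N K : nat) : (0 < N)%N ->
  \sum_(i < K * N) F (i %/ N)%N (i %% N)%N = \sum_(j < K) \sum_(k < N) F j k.
Proof.
move=> N0; elim: K => [|K ih]; first by rewrite mul0n !big_ord0.
rewrite big_ord_recr /= -ih mulSn addnC big_split_ord /=; congr (_ + _).
by apply: eq_bigr => k _; rewrite divnMDl// modnMDl divn_small// addn0 modn_small.
Qed.

Section Equidistribution.
Context (R : realType) (A : 'M[int]_2) (lam : R) (E : eigenframe A lam).
Hypotheses (dA : \det A = 1) (lam1 : 1 < lam).
Local Notation enorm := (enorm E).
Local Notation latdist := (latdist E).
Local Notation f := (blowup_map A : surface R -> surface R).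
Variable mu : probability (borel (surface R)) R.
Hypothesis mu_inv : invariant_measure f mu.

Lemma planar_iter k s : lattice (planar (iter k f s) - iter k (mxact A) (planar s)).
Proof.
elim: k => [|k ih] /=; first by rewrite subrr; exact: lattice0.
have := latticeD (planar_blowup (iter k f s) dA) (lattice_act A ih).
by rewrite mxactB addrA subrK.
Qed.

Lemma planar_bounded (G : 'rV[R]_2 -> R) : lattice_periodic G -> continuous G ->
  bounded_borel (G \o @planar R).
Proof.
move=> pG cG; apply: (@continuous_bounded_borel _ _ _ E).
exact (planar_continuous E pG cG).
Qed.

Lemma iter_continuous k : continuous (iter k f).
Proof.
elim: k => [|k ih] s; first exact: cvg_id.
apply: (@continuous_comp _ _ _ (iter k f) f); first exact: ih.
exact: blowup_continuous.
Qed.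

Section Scale.
Variables n N : nat.
Hypothesis NE : N = (6 * n.+1)%N.
Local Notation I := ('I_n.+1 * 'I_n.+1)%type.
Local Notation part := (@tent_part R A lam E n).

Let N_gt0 : (0 < N)%N. Proof. by rewrite NE muln_gt0. Qed.

Definition block_avg (c : I) (s : surface R) : R :=
  N%:R^-1 * \sum_(k < N) part c (planar (iter k f s)).

Lemma part_bounded c : bounded_borel (part c \o @planar R).
Proof.
by apply: planar_bounded; [exact: tent_part_periodic|exact: tent_part_continuous].
Qed.

Lemma part_iter_bounded c k : bounded_borel (fun s => part c (planar (iter k f s))).
Proof. exact: bounded_borel_comp (@iter_continuous k) (part_bounded c). Qed.

Lemma block_avg_bounded c : bounded_borel (block_avg c).
Proof.
apply: bounded_borelM; first exact: bounded_borel_cst.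
by apply: bounded_borel_sum => k; exact: part_iter_bounded.
Qed.

Lemma block_avg_mean c : mean mu (block_avg c) = mean mu (part c \o @planar R).
Proof.
rewrite meanZ; last by apply: bounded_borel_sum => k; exact: part_iter_bounded.
rewrite mean_sum; last by move=> k; exact: part_iter_bounded.
rewrite (eq_bigr (fun=> mean mu (part c \o @planar R))); last first.
  move=> k _.
  exact (invariant_mean_iter (@blowup_continuous _ _ dA) mu_inv k (part_bounded c)).
rewrite sumr_const card_ord -[X in _ * X]mulr_natl mulrA mulVf ?mul1r//.
by rewrite pnatr_eq0 -lt0n.
Qed.

Lemma block_avg_le1 c s : 0 <= block_avg c s <= 1.
Proof.
rewrite /block_avg mulr_ge0 ?invr_ge0//=; last first.
  by apply: sumr_ge0 => k _; exact: tent_part_ge0.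
rewrite mulrC ler_pdivrMr ?ltr0n// mul1r.
apply: (@le_trans _ _ (\sum_(k < N) (1 : R))).
  by apply: ler_sum => k _; exact: tent_part_le1.
by rewrite sumr_const card_ord.
Qed.

Lemma block_avg_dev c s : `|block_avg c s - mean mu (block_avg c)| <= 1.
Proof.
have /andP[h1 h2] := block_avg_le1 c s.
have h3 : 0 <= mean mu (block_avg c).
  rewrite -(mean_cst mu 0); apply: mean_le => [||x].
  - exact: bounded_borel_cst.
  - exact: block_avg_bounded.
  - by have /andP[] := block_avg_le1 c x.
have h4 : mean mu (block_avg c) <= 1.
  rewrite -[leRHS](mean_cst mu 1); apply: mean_le => [||x].
  - exact: block_avg_bounded.
  - exact: bounded_borel_cst.
  - by have /andP[] := block_avg_le1 c x.
by rewrite ler_norml; apply/andP; split; lra.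
Qed.

(** By invariance, averaging over a block does not change means. Sampling the
    block averages therefore provides starting points of orbit segments which,
    put end to end, have almost the means of the measure. *)
Lemma sample_blocks : exists (K : nat) (x : nat -> 'rV[R]_2), (0 < K)%N /\
  forall c : I, `|(K * N)%:R^-1 * (\sum_(i < K * N)
      part c (iter (i %% N) (mxact A) (x ((i %/ N) %% K)%N))) -
     mean mu (part c \o @planar R)| <= (#|{: I}| * n.+1)%:R^-1.
Proof.
have e0 : 0 < (#|{: I}| * n.+1)%:R^-1 :> R.
  by rewrite invr_gt0 ltr0n muln_gt0 andbT card_prod card_ord.
have [K [x [K0 hx]]] := finite_sample e0 block_avg_bounded block_avg_dev.
exists K, (fun j => planar (x j)); split => // c.
have := hx c; rewrite block_avg_mean.
suff -> : K%:R^-1 * (\sum_(j < K) block_avg c (x j)) = (K * N)%:R^-1 * (\sum_(i < K * N)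
      part c (iter (i %% N) (mxact A) (planar (x ((i %/ N) %% K)%N)))) by [].
rewrite (block_sum (fun j k => part c (iter k (mxact A) (planar (x (j %% K)%N)))))//.
rewrite /block_avg -mulr_sumr mulrA natrM invfM; congr (_ * _).
apply: eq_bigr => j _; apply: eq_bigr => k _.
rewrite modn_small//; apply: tent_part_periodic; exact: planar_iter.
Qed.

(** Interpolation of [G] on the grid. *)
Lemma part_approx (G : 'rV[R]_2 -> R) (eta k : R) v : 0 <= k ->
  (forall a b, `|G a - G b| <= eta + k * latdist (a - b)) ->
  `|G v - \sum_(c : I) G (grid_pt R c) * part c v| <= eta + k * grid_radius E n.
Proof.
move=> k0 hG.
have -> : G v = \sum_(c : I) G v * part c v.
  by rewrite -mulr_sumr tent_part_sum mulr1.
rewrite -sumrB; apply: le_trans (ler_norm_sum _ _ _) _.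
rewrite -[leRHS]mulr1 -(tent_part_sum E n v) mulr_sumr.
apply: ler_sum => c _; rewrite -mulrBl normrM (ger0_norm (tent_part_ge0 _ _ _)).
have [->|pc] := eqVneq (part c v) 0; first by rewrite !mulr0.
rewrite ler_wpM2r ?tent_part_ge0// (le_trans (hG _ _))// lerD2l ler_wpM2l//.
exact: tent_part_near.
Qed.

Definition shadow_cst : R :=
  2 * enorm_bound E * (lam / (lam - 1)) + 4 * enorm_bound E.

Lemma enorm_e0_le : enorm (delta_mx ord0 ord0) <= enorm_bound E.
Proof. by rewrite /enorm_bound lerDl enorm_ge0. Qed.

(** The segments put end to end form a closed pseudo-orbit with one jump per
    block. Rounding by lattice vectors bounds the jumps, so the mean error is
    of order 1 / N. *)
Lemma shadow_blocks K (x : nat -> 'rV[R]_2) : (0 < K)%N ->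
  let y i := iter (i %% N) (mxact A) (x ((i %/ N) %% K)%N) in
  exists z, [/\ ~ lattice z, lattice (iter (K * N) (mxact A) z - z) &
    (K * N)%:R^-1 * \sum_(i < K * N) latdist (iter i (mxact A) z - y i) <=
      2 * enorm_bound E * (lam / (lam - 1)) / n.+1%:R].
Proof.
move=> K0 y.
have [rd hrd] := choice (fun v : 'rV[R]_2 =>
  let: ex_intro2 m lm hm := lattice_round v in ex_intro (fun m => lattice m /\ `|v - m| <= 2^-1) m (conj lm hm)).
(* The orbit of a block is exact; only at the end of a block is there a jump. *)
pose l i := if (N %| i.+1)%N then rd (y i.+1 - mxact A (y i)) else 0.
have ll i : lattice (l i).
  by rewrite /l; case: ifP => _; [case: (hrd (y i.+1 - mxact A (y i)))|exact: lattice0].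
have KN : (K * N = 6 * (K * n.+1))%N by rewrite NE mulnCA.
have yP : y (6 * (K * n.+1))%N = y 0%N.
  by rewrite -KN /y modnMl mod0n div0n mulnK// modnn mod0n.
have m0 : (0 < K * n.+1)%N by rewrite muln_gt0 K0.
have [z [nlz lz hz]] := closing_lemma E dA lam1 ll yP m0.
exists z; rewrite KN; split => //; rewrite -KN in hz *.
have b0 := enorm_bound_gt0 E.
have k0 : 0 < lam / (lam - 1).
  by rewrite divr_gt0 ?(lam_gt0 lam1)// subr_gt0.
have hd i : enorm (y i.+1 - mxact A (y i) - l i) <=
    ((i %% N).+1 == N)%:R * enorm_bound E.
  have hN : (N %| i.+1)%N = ((i %% N).+1 == N).
    rewrite {1}(divn_eq i N) -addnS dvdn_addr ?dvdn_mull//.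
    have hr := ltn_pmod i N_gt0; apply/idP/eqP => [/(dvdn_leq (ltn0Sn _)) h|->//].
    by apply/eqP; rewrite eqn_leq hr.
  rewrite /l -hN; case: ifP => [_|h].
    have [_ h] := hrd (y i.+1 - mxact A (y i)).
    apply: le_trans (enorm_le _ _) _; rewrite mul1r ler_piMr ?(ltW b0)//.
    by apply: le_trans h _; rewrite invf_le1// ler1n.
  rewrite subr0 mul0r (_ : y i.+1 = mxact A (y i)) ?subrr ?enorm0//.
  by rewrite /y modnS divnS// h add0n.
have sd : \sum_(i < K * N) enorm (y i.+1 - mxact A (y i) - l i) <= K%:R * enorm_bound E.
  apply: (@le_trans _ _ (\sum_(i < K * N) ((i %% N).+1 == N)%:R * enorm_bound E)).
    by apply: ler_sum => i _; exact: hd.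
  rewrite (block_sum (fun _ k => (k.+1 == N)%:R * enorm_bound E))//.
  have -> : \sum_(k < N) (k.+1 == N)%:R * enorm_bound E = enorm_bound E.
    have hN : (N.-1 < N)%N by rewrite prednK.
    rewrite (bigD1 (Ordinal hN)) //= prednK// eqxx mul1r big1 ?addr0// => i.
    rewrite -val_eqE /= => h; rewrite (_ : (i.+1 == N) = false) ?mul0r//.
    by apply/negbTE; apply: contra h => /eqP e; apply/eqP; rewrite -[LHS]/(i.+1.-1) e.
  by rewrite sumr_const card_ord mulr_natl.
have K0R : 0 < K%:R :> R by rewrite ltr0n.
have N0R : 0 < N%:R :> R by rewrite ltr0n.
rewrite natrM ler_pdivrMl ?mulr_gt0//.
apply: le_trans hz _; have := enorm_e0_le => he.
apply: (@le_trans _ _ (lam / (lam - 1) * (2 * K%:R * enorm_bound E))).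
  rewrite ler_wpM2l ?(ltW k0)//.
  apply: (@le_trans _ _ (K%:R * enorm_bound E + enorm_bound E)); first exact: lerD.
  have : enorm_bound E <= K%:R * enorm_bound E.
    by rewrite ler_peMl ?(ltW b0)// ler1n.
  by lra.
have hN : 1 <= N%:R / n.+1%:R :> R.
  by rewrite ler_pdivlMr ?ltr0n// mul1r ler_nat NE leq_pmull.
rewrite [leRHS](_ : _ = (lam / (lam - 1) * (2 * K%:R * enorm_bound E)) * (N%:R / n.+1%:R)); last first.
  by ring.
by rewrite ler_peMr// mulr_ge0 ?(ltW k0)// !mulr_ge0// ltW.
Qed.

(** The average of [G] along the periodic orbit is compared with its average
    along the pseudo-orbit; there [G] is interpolated on the grid, where the
    averages are those of the measure up to 1 / n, and the same interpolation
    is undone under the measure. *)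
Lemma approx_orbit : exists (z : 'rV[R]_2) (P : nat),
  [/\ (0 < P)%N, ~ lattice z, lattice (iter P (mxact A) z - z) &
   forall (G : 'rV[R]_2 -> R) (eta k M : R), lattice_periodic G -> continuous G ->
     0 <= k ->
     (forall a b, `|G a - G b| <= eta + k * latdist (a - b)) ->
     (forall v, `|G v| <= M) ->
     `|P%:R^-1 * \sum_(i < P) G (iter i (mxact A) z) - mean mu (G \o @planar R)| <=
     3 * eta + (k * shadow_cst + M) / n.+1%:R].
Proof.
have [K [x [K0 hx]]] := sample_blocks.
have [z [nlz lz hz]] := shadow_blocks x K0.
have P0 : (0 < K * N)%N by rewrite muln_gt0 K0.
exists z, (K * N)%N; split => // G eta k M pG cG k0 hG GM.
move: hx hz; set P := (K * N)%N in P0 *.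
set y := fun i => iter (i %% N) (mxact A) (x ((i %/ N) %% K)%N) => hx hz.
have PR : 0 < P%:R :> R by rewrite ltr0n.
have n0 : 0 < n.+1%:R :> R by rewrite ltr0n.
pose avg (g : nat -> R) := P%:R^-1 * \sum_(i < P) g i.
have avg_le (g h : nat -> R) (e : nat -> R) : (forall i, `|g i - h i| <= e i) ->
    `|avg g - avg h| <= avg e.
  move=> gh; rewrite /avg -mulrBr -sumrB normrM gtr0_norm ?invr_gt0//.
  rewrite ler_wpM2l ?invr_ge0// ?(ltW PR)//.
  by apply: le_trans (ler_norm_sum _ _ _) _; apply: ler_sum => i _.
have avg_cst e : avg (fun=> e) = e.
  rewrite /avg sumr_const card_ord -[X in _ * X]mulr_natl mulrA mulVf ?mul1r//.
  by rewrite gt_eqF.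
pose Ga v := \sum_(c : I) G (grid_pt R c) * part c v.
have M0 : 0 <= M by apply: le_trans (GM 0).
have h1 : `|avg (fun i => G (iter i (mxact A) z)) - avg (fun i => G (y i))| <=
   eta + k * (2 * enorm_bound E * (lam / (lam - 1)) / n.+1%:R).
  apply: (@le_trans _ _ (avg (fun i => eta + k * latdist (iter i (mxact A) z - y i)))).
    by apply: avg_le => i; exact: hG.
  rewrite /avg big_split /= mulrDr -[X in X + _]/(avg (fun=> eta)) avg_cst lerD2l.
  by rewrite -mulr_sumr mulrCA ler_wpM2l.
have h2 : `|avg (fun i => G (y i)) - avg (fun i => Ga (y i))| <=
    eta + k * grid_radius E n.
  rewrite -[leRHS]avg_cst; apply: avg_le => i; exact: part_approx.
have bGa : bounded_borel (Ga \o @planar R).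
  apply: bounded_borel_sum => c; apply: bounded_borelM; first exact: bounded_borel_cst.
  exact: part_bounded.
have h3 : `|avg (fun i => Ga (y i)) - mean mu (Ga \o @planar R)| <= M / n.+1%:R.
  rewrite /Ga (_ : (fun v => _) \o @planar R = fun s => \sum_(c : I) G (grid_pt R c) * (part c \o @planar R) s)//.
  rewrite mean_sum; last first.
    by move=> c; apply: bounded_borelM; [exact: bounded_borel_cst|exact: part_bounded].
  have -> : avg (fun i => \sum_(c : I) G (grid_pt R c) * part c (y i)) =
      \sum_(c : I) G (grid_pt R c) * avg (fun i => part c (y i)).
    rewrite /avg exchange_big /= mulr_sumr; apply: eq_bigr => c _.
    by rewrite -mulr_sumr mulrCA.
  rewrite -sumrB; apply: le_trans (ler_norm_sum _ _ _) _.
  apply: (@le_trans _ _ (\sum_(c : I) M * (#|{: I}| * n.+1)%:R^-1)).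
    apply: ler_sum => c _; rewrite meanZ; last exact: part_bounded.
    by rewrite -mulrBr normrM ler_pM//; exact: hx.
  rewrite sumr_const -mulrnAr ler_wpM2l//.
  rewrite natrM invfM -mulrnAl -[X in X * _]mulr_natl mulfV ?mul1r//.
  by rewrite pnatr_eq0 -lt0n card_prod card_ord.
have h4 : `|mean mu (Ga \o @planar R) - mean mu (G \o @planar R)| <=
    eta + k * grid_radius E n.
  apply: mean_dist => //; first exact: planar_bounded.
  by move=> s /=; rewrite distrC; exact: part_approx.
rewrite -[X in `|X - _|]/(avg (fun i => G (iter i (mxact A) z))).
move: h1 h2 h3 h4; set a1 := avg _; set a2 := avg _; set a3 := avg _.
set m1 := mean _ _; set m2 := mean _ _ => h1 h2 h3 h4.
rewrite (_ : a1 - m2 = (a1 - a2) + (a2 - a3) + (a3 - m1) + (m1 - m2)); last by ring.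
apply: le_trans (ler_normD _ _) _.
apply: (@le_trans _ _ ((eta + k * (2 * enorm_bound E * (lam / (lam - 1)) / n.+1%:R)) +
  (eta + k * grid_radius E n) + M / n.+1%:R + (eta + k * grid_radius E n))).
  apply: lerD => //; apply: le_trans (ler_normD _ _) _.
  by apply: lerD => //; apply: le_trans (ler_normD _ _) _; apply: lerD.
rewrite le_eqVlt; apply/orP; left; apply/eqP.
by rewrite /shadow_cst /grid_radius; ring.
Qed.

End Scale.

(** One sequence serves all [G]: the n-th orbit imitates the measure on a
    partition of unity of mesh 1 / n. *)
Theorem periodic_equidistribution :
  exists (z : nat -> 'rV[R]_2) (P : nat -> nat),
  (forall n, [/\ (0 < P n)%N, ~ lattice (z n) &
      lattice (iter (P n) (mxact A) (z n) - z n)]) /\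
  forall G : 'rV[R]_2 -> R, lattice_periodic G -> continuous G ->
    (P n)%:R^-1 * (\sum_(i < P n) G (iter i (mxact A) (z n))) @[n --> \oo] -->
    mean mu (G \o @planar R).
Proof.
have [z hz] := choice (fun n => approx_orbit (erefl (6 * n.+1)%N)); have [P hP] := choice hz.
exists z, P; split=> [n|G pG cG]; first by have [] := hP n.
apply/(@cvgrPdist_le _ _ _ \oo) => e e0.
have e6 : 0 < e / 6 by rewrite divr_gt0.
have [k k0 hk] := periodic_modulus E pG cG e6.
have [M M0 hM] := periodic_bounded E pG cG.
pose C := k * shadow_cst + M.
have : \forall n \near \oo, C / (e / 2) <= n%:R by exact: nbhs_infty_ger.
apply: filterS => n hn; have [_ _ _ /(_ G (e / 6) k M pG cG k0 hk hM)] := hP n.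
rewrite distrC => /le_trans; apply.
have : C / n.+1%:R <= e / 2.
  rewrite ler_pdivrMr ?ltr0n//; move: hn; rewrite ler_pdivrMr ?divr_gt0// => /le_trans; apply.
  by rewrite mulrC ler_wpM2l ?divr_ge0 ?(ltW e0)// ler_nat.
rewrite -[X in _ -> _ + X <= _]/(C / n.+1%:R).
by move: (C / n.+1%:R) => y; lra.
Qed.

End Equidistribution.

(** * Orbit measures and averages near the fibre *)

Section RealContinuity.
Context {R : realType} {T : topologicalType}.
Implicit Types (g h : T -> R).

Lemma continuous_add g h : continuous g -> continuous h ->
  continuous (fun x => g x + h x).
Proof. by move=> cg ch x; exact: (@cvgD _ _ _ (nbhs x) _ g h _ _ (cg x) (ch x)). Qed.

Lemma continuous_sub g h : continuous g -> continuous h ->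
  continuous (fun x => g x - h x).
Proof. by move=> cg ch x; exact: (@cvgB _ _ _ (nbhs x) _ g h _ _ (cg x) (ch x)). Qed.

Lemma continuous_mul g h : continuous g -> continuous h ->
  continuous (fun x => g x * h x).
Proof. by move=> cg ch x; exact: (@cvgM _ _ (nbhs x) _ g h _ _ (cg x) (ch x)). Qed.

Lemma continuous_const (c : R) : continuous (fun _ : T => c).
Proof. by move=> x; exact: cvg_cst. Qed.

Lemma continuous_bigsum (I : Type) (r : seq I) (g : I -> T -> R) :
  (forall i, continuous (g i)) -> continuous (fun x => \sum_(i <- r) g i x).
Proof.
move=> cg; elim: r => [|i r ih].
  rewrite (_ : (fun _ => _) = fun=> 0); first exact: continuous_const.
  by apply/funext => x; rewrite big_nil.
rewrite (_ : (fun _ => _) = fun x => g i x + \sum_(j <- r) g j x).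
  exact: continuous_add.
by apply/funext => x; rewrite big_cons.
Qed.

End RealContinuity.

Section OrbitMeasure.
Context {R : realType} {T : ptopologicalType}.
Implicit Types (f : T -> T) (x : T) (g : T -> R).

Definition orbit_count f x P (B : set T) : R :=
  P%:R^-1 * \sum_(i < P) (iter i f x \in B)%:R.

(** Parametrized by the predecessor of the number of points, which keeps that
    number positive. *)
Definition orbit_measure f x p : set (borel T) -> \bar R :=
  mscale ((p.+1%:R^-1)%:nng : {nonneg R})
    (msum (fun i => \d_(iter i f x : borel T)) p.+1).

HB.instance Definition _ f x p := Measure.on (orbit_measure f x p).

Lemma orbit_measureE f x p (B : set T) :
  orbit_measure f x p B = (orbit_count f x p.+1 B)%:E.
Proof.
by rewrite /orbit_measure /mscale /= /msum /orbit_count EFinM -sumEFin.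
Qed.

Lemma orbit_measure_setT f x p : orbit_measure f x p setT = 1%E.
Proof.
rewrite orbit_measureE /orbit_count; under eq_bigr do rewrite in_setT.
by rewrite sumr_const card_ord mulVf// gt_eqF.
Qed.

HB.instance Definition _ f x p :=
  Measure_isProbability.Build _ _ _ (orbit_measure f x p) (orbit_measure_setT f x p).

Definition orbit_prob f x p : probability (borel T) R := orbit_measure f x p.

Lemma orbit_prob_mean f x p g : bounded_borel g ->
  mean (orbit_prob f x p) g = p.+1%:R^-1 * \sum_(i < p.+1) g (iter i f x).
Proof.
have pos h : bounded_borel h -> (forall y, 0 <= h y) ->
    mean (orbit_prob f x p) h = p.+1%:R^-1 * \sum_(i < p.+1) h (iter i f x).
  move=> bh h0; rewrite /mean /Rintegral.
  have mh : measurable_fun [set: borel T] (EFin \o (h : borel T -> R)).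
    by apply/measurable_EFinP; case: bh.
  rewrite ge0_integral_mscale//=; last by move=> y _; rewrite lee_fin.
  rewrite ge0_integral_measure_sum//; last by move=> y _; rewrite lee_fin.
  rewrite (eq_bigr (fun i : 'I_p.+1 => (h (iter i f x))%:E)); last first.
    by move=> i _; rewrite integral_dirac// diracT mul1e.
  by rewrite sumEFin -EFinM.
move=> bg; have [_ [M gM]] := bg.
have bgM : bounded_borel (fun y => g y + M).
  by apply: bounded_borelD => //; exact: bounded_borel_cst.
have := pos _ bgM.
rewrite meanD ?mean_cst//; last exact: bounded_borel_cst.
move=> /(_ _)/(canRL (addrK _)) ->; last first.
  by move=> y; have := gM y; rewrite ler_norml => /andP[h _]; rewrite -(opprK M) subr_ge0.
rewrite big_split /= sumr_const card_ord mulrDr -[M *+ _]mulr_natl.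
by rewrite mulKf ?addrK// pnatr_eq0.
Qed.

Section Periodic.
Variables (f : T -> T) (x : T) (P : nat).
Hypotheses (P0 : (0 < P)%N) (xP : iter P f x = x).
Variable nu : probability (borel T) R.
Hypothesis nuE : forall B : set T, nu B = (orbit_count f x P B)%:E.

Lemma orbit_shift g : \sum_(i < P) g (f (iter i f x)) = \sum_(i < P) g (iter i f x) :> R.
Proof.
move: P0 xP; case: P => // p _ xp.
rewrite big_ord_recr [RHS]big_ord_recl /= addrC -iterS xp; congr (_ + _).
Qed.

Lemma orbit_invariant : invariant_measure f nu.
Proof.
move=> B mB; rewrite !nuE; congr (_%:E); rewrite /orbit_count; congr (_ * _).
rewrite -(orbit_shift (fun y => (y \in B)%:R)); apply: eq_bigr => i _.
by congr (_%:R); congr nat_of_bool; apply/idP/idP; rewrite !inE.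
Qed.

Lemma orbit_full : nu (full_orbit f x) = 1%E.
Proof.
rewrite nuE /orbit_count (eq_bigr (fun=> 1)); last first.
  by move=> i _; rewrite mem_set//; exists (i : nat).
by rewrite sumr_const card_ord mulVf// pnatr_eq0 -lt0n.
Qed.

Lemma orbit_ergodic : ergodic_measure f nu.
Proof.
split; first exact: orbit_invariant.
move=> B mB fB; have hx i : (iter i f x \in B) = (x \in B).
  elim: i => //= i <-; rewrite -{2}fB.
  by apply/idP/idP; rewrite !inE.
rewrite nuE /orbit_count; under eq_bigr do rewrite hx.
case: (x \in B); [right|left].
  by rewrite sumr_const card_ord mulVf// pnatr_eq0 -lt0n.
by rewrite sumr_const mul0rn mulr0.
Qed.

End Periodic.
End OrbitMeasure.

Section NearFibre.
Context (R : realType) (A : 'M[int]_2) (lam : R) (E : eigenframe A lam).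
Hypotheses (dA : \det A = 1) (lam1 : 1 < lam).
Local Notation enorm := (enorm E).
Local Notation latdist := (latdist E).
Local Notation f := (blowup_map A : surface R -> surface R).
Local Notation phi := (expansion E).
Local Notation pu := (p_unst E).
Local Notation ps := (p_stab E).
Implicit Types (g : surface R -> R).

Lemma expansion_step_continuous : continuous (fun s => phi (f s) - phi s).
Proof.
apply: continuous_sub; last exact: expansion_continuous.
move=> s; apply: (@continuous_comp _ _ _ f phi); first exact: blowup_continuous.
exact: expansion_continuous.
Qed.

Lemma fibre_cvg g (u : 'rV[R]_2) : continuous g -> u != 0 ->
  g (surf_pt 0 w) @[w --> u] --> g (surf_pt 0 u).
Proof.
move=> cg u0.
have h := @comp_surf_pt _ _ _ E R g (0, u) cg (blow_dom0 u0).
have a1 : (fun _ : 'rV[R]_2 => 0 : R) @ u --> (0 : R) by exact: (@cvg_cst R (0 : R) _ (nbhs u) _).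
have a2 : (fun w : 'rV[R]_2 => w) @ u --> u by exact: cvg_id.
exact: (cvg_comp _ _ (cvg_pair a1 a2) h).
Qed.

(** The increment of the expansion rate vanishes only at the two saddles,
    where [g] is zero; elsewhere a large multiple of it exceeds |g|.
    Compactness of the fibre makes the multiple uniform. *)
Lemma fibre_domination g (e : R) : continuous g -> g pu = 0 -> g ps = 0 -> 0 < e ->
  exists2 K, 0 < K & forall u, u != 0 ->
    `|g (surf_pt 0 u)| <= e + K * (phi (f (surf_pt 0 u)) - phi (surf_pt 0 u)).
Proof.
move=> cg gu gs e0.
pose th s := phi (f s) - phi s.
have cth : continuous th by exact: expansion_step_continuous.
have th0 u : u != 0 -> 0 <= th (surf_pt 0 u).
  by move=> u0; rewrite subr_ge0; exact: expansion_mono.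
have /compact_near_coveringP/(_ _ (@pinfty_nbhs R)
  (fun K u => u != 0 -> `|g (surf_pt 0 u)| <= e + K * th (surf_pt 0 u))) := @sphere_compact R A lam E.
have cover (u : 'rV[R]_2) : [set u : 'rV[R]_2 | enorm u = 1] u ->
  \forall u' \near u & K \near +oo%R,
    u' != 0 -> `|g (surf_pt 0 u')| <= e + K * th (surf_pt 0 u').
  move=> /= u1; have u0 : u != 0 by rewrite -(enorm_eq0 E) u1 oner_eq0.
  have gc := fibre_cvg cg u0; have tc := fibre_cvg cth u0.
  have [t0|t0] := eqVneq (th (surf_pt 0 u)) 0.
    have g0 : g (surf_pt 0 u) = 0.
      have fe : phi (f (surf_pt 0 u)) = phi (surf_pt 0 u).
        by apply/eqP; rewrite -subr_eq0; apply/eqP.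
      have ex : exceptional R (surf_pt 0 u).
        by apply/exceptionalP => //; exact: blow_dom0.
      by have [->|->] := exc_expansion_fix dA lam1 ex fe.
    exists ([set u' | `|g (surf_pt 0 u) - g (surf_pt 0 u')| < e], [set K | 0 < K]).
      split => /=; last by apply: nbhs_pinfty_gt; exact: num_real.
      by move/(@cvgrPdist_lt _ _ _ (nbhs u)): gc; apply.
    move=> [u' K] [/=]; rewrite g0 sub0r normrN => h K0 u'0.
    by apply: ler_wpDr; [rewrite mulr_ge0 ?(ltW K0)// th0|exact: ltW].
  have tp : 0 < th (surf_pt 0 u) by rewrite lt_def t0 th0.
  have [M M0 hM] := surface_bounded E cg.
  have tp2 : 0 < th (surf_pt 0 u) / 2 by rewrite divr_gt0.
  exists ([set u' | `|th (surf_pt 0 u) - th (surf_pt 0 u')| < th (surf_pt 0 u) / 2],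
    [set K | M / (th (surf_pt 0 u) / 2) < K]).
    split => /=; last by apply: nbhs_pinfty_gt; exact: num_real.
    by move/(@cvgrPdist_lt _ _ _ (nbhs u)): tc; apply.
  move=> [u' K] [/= h hK] u'0; apply: le_trans (hM _) _.
  apply: ler_wpDl; first exact: ltW.
  have K0 : 0 < K by apply: lt_trans hK; rewrite divr_gt0.
  move: hK; rewrite ltr_pdivrMr// => /ltW/le_trans; apply.
  rewrite ler_wpM2l ?(ltW K0)//.
  by have := ler_norm (th (surf_pt 0 u) - th (surf_pt 0 u')); move: h; lra.
move=> /(_ _ cover) hK.
have h0 : \forall K \near +oo%R, (0 : R) < K by apply: nbhs_pinfty_gt; exact: num_real.
have [K [K0 hK']] := filter_ex (filterI h0 hK).
exists K => // u u0.
have [w1 w0 ->] := fibre_unit E u0.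
exact: hK'.
Qed.

Definition birkhoff g N s : R := N%:R^-1 * \sum_(k < N) g (iter k f s).

(** Summed along an orbit, the increments in the previous bound telescope to a
    bounded quantity. *)
Lemma birkhoff_fibre g (e : R) : continuous g -> g pu = 0 -> g ps = 0 -> 0 < e ->
  exists2 N, (0 < N)%N & forall s, exceptional R s -> `|birkhoff g N s| <= e.
Proof.
move=> cg gu gs e0; have e2 : 0 < e / 2 by rewrite divr_gt0.
have [K K0 hK] := fibre_domination cg gu gs e2.
have [M M0 hM] := surface_bounded E (expansion_continuous dA (E := E)).
(* The increments telescope to at most 2 M, with weight K. *)
pose N := (Num.truncn (2 * K * M / (e / 2))).+1.
have hN : 2 * K * M / (e / 2) < N%:R by exact: truncnS_gt.
exists N => // s es.
have NR : 0 < N%:R :> R by rewrite ltr0n.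
have exck k : exceptional R (iter k f s) by elim: k => //= k ih; apply/(exc_act dA).
rewrite /birkhoff normrM gtr0_norm ?invr_gt0// mulrC ler_pdivrMr//.
apply: le_trans (ler_norm_sum _ _ _) _.
apply: (@le_trans _ _ (\sum_(k < N) (e / 2 + K * (phi (iter k.+1 f s) - phi (iter k f s))))).
  apply: ler_sum => k _; have [u u0 su] := excP (exck k).
  by rewrite /= su; exact: hK.
rewrite big_split /= sumr_const card_ord -mulr_sumr.
have -> : \sum_(k < N) (phi (iter k.+1 f s) - phi (iter k f s)) = phi (iter N f s) - phi s.
  rewrite -(big_mkord xpredT (fun k => phi (iter k.+1 f s) - phi (iter k f s))).
  by rewrite (@telescope_sumr _ 0 N (fun k => phi (iter k f s))).
apply: (@le_trans _ _ (e / 2 *+ N + K * (2 * M))).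
  rewrite lerD2l ler_wpM2l ?(ltW K0)//.
  apply: le_trans (ler_norm _) _; apply: le_trans (ler_normB _ _) _.
  by rewrite mulr_natl mulr2n lerD.
rewrite -[_ *+ N]mulr_natr; move: hN; rewrite ltr_pdivrMr// => hN.
have : 2 * K * M = K * (2 * M) by ring.
by move: hN; set a := 2 * K * M; set b := K * (2 * M); lra.
Qed.

(** A tube around the fibre, by compactness of the unit circle of directions. *)
Lemma near_fibre g (e : R) : continuous g ->
  (forall s, exceptional R s -> `|g s| < e) ->
  exists2 d, 0 < d & forall s, latdist (planar s) < d -> `|g s| <= e.
Proof.
move=> cg ge.
have /compact_near_coveringP/(_ _ (nbhs (0 : R))
  (fun t u => u != 0 -> blow_dom R (t, u) -> `|g (surf_pt t u)| <= e)) := @sphere_compact R A lam E.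
have cover (u : 'rV[R]_2) : [set u : 'rV[R]_2 | enorm u = 1] u ->
  \forall u' \near u & t \near (0 : R),
    u' != 0 -> blow_dom R (t, u') -> `|g (surf_pt t u')| <= e.
  move=> /= u1; have u0 : u != 0 by rewrite -(enorm_eq0 E) u1 oner_eq0.
  have h := @comp_surf_pt _ _ _ E R g (0, u) cg (blow_dom0 u0).
  have g1 : `|g (surf_pt 0 u)| < e.
    by apply: ge; apply/exceptionalP => //; exact: blow_dom0.
  have e0 : 0 < e - `|g (surf_pt 0 u)| by rewrite subr_gt0.
  have : \forall q \near (0 : R, u), `|g (surf_pt 0 u) - g (surf_pt q.1 q.2)| < e - `|g (surf_pt 0 u)|.
    by move/(@cvgrPdist_lt _ _ _ (nbhs (0 : R, u))): h; apply.
  move=> [[B1 B2] /= [hB1 hB2] hB].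
  exists (B2, B1); first by split.
  move=> [u' t] [/= h1 h2] _ _; have := hB (t, u') (conj h2 h1); rewrite /=.
  have := ler_normB (g (surf_pt 0 u)) (g (surf_pt 0 u) - g (surf_pt t u')).
  by rewrite subKr; lra.
move=> /(_ _ cover) /nbhs_ballP[d /= d0 hd].
exists (Num.min d 2^-1); first by rewrite lt_min d0 /= invr_gt0 ltr0n.
move=> s; rewrite lt_min => /andP[sd s2].
have [u [u1 hb ->]] := near_polar s2.
apply: (hd (latdist (planar s))) => //.
  by rewrite -ball_normE /= sub0r normrN ger0_norm ?latdist_ge0.
by rewrite -(enorm_eq0 E) u1 oner_eq0.
Qed.

End NearFibre.

(** * Periodic approximation on the surface *)

Section OffFibre.
Context (R : realType) (A : 'M[int]_2) (lam : R) (E : eigenframe A lam).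
Hypotheses (dA : \det A = 1) (lam1 : 1 < lam).
Local Notation latdist := (latdist E).
Local Notation f := (blowup_map A : surface R -> surface R).
Implicit Types (v w : 'rV[R]_2) (k : surface R -> R).

Lemma blow_dom1 v : ~ lattice v -> blow_dom R (1, v).
Proof.
move=> nlv; split => /=; first by apply/eqP => e; apply: nlv; rewrite e; exact: lattice0.
by rewrite scale1r.
Qed.

Lemma surf_pt1_eq v w : ~ lattice v -> lattice (v - w) -> surf_pt 1 v = surf_pt 1 w.
Proof.
move=> nlv l; have nlw : ~ lattice w.
  by move=> lw; apply: nlv; have := latticeD l lw; rewrite subrK.
apply/surf_ptP; [exact: blow_dom1|exact: blow_dom1|].
by left; rewrite oner_eq0 !scale1r.
Qed.

Lemma nonlattice_act v : ~ lattice v -> ~ lattice (mxact A v).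
Proof. by move=> nlv l; apply: nlv; rewrite -(mxactK dA v); exact: lattice_act. Qed.

Lemma nonlattice_iter n v : ~ lattice v -> ~ lattice (iter n (mxact A) v).
Proof. by move=> nlv; elim: n => //= n; exact: nonlattice_act. Qed.

Lemma surf_pt1_iter n v : ~ lattice v ->
  iter n f (surf_pt 1 v) = surf_pt 1 (iter n (mxact A) v).
Proof.
move=> nlv; elim: n => //= n ->; rewrite blowup_map_pt//.
by apply: blow_dom1; exact: nonlattice_iter.
Qed.

Lemma surf_pt1_planar s : ~ exceptional R s -> surf_pt 1 (planar s) = s /\ ~ lattice (planar s).
Proof.
have [t [u [h ->]]] := surf_pt_surj s => /(exceptionalP h)/eqP t0.
have l := planar_pt h.
have nl : ~ lattice (t *: u) by move/h.2 => /= /eqP; rewrite (negbTE t0).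
have nlp : ~ lattice (planar (surf_pt t u)).
  by move=> lp; apply: nl; have := latticeB lp l; rewrite opprB addrC subrK.
split => //; rewrite (surf_pt1_eq nlp l).
apply/surf_ptP => //; first exact: blow_dom1.
by left; rewrite oner_eq0 scale1r subrr; split => //; exact: lattice0.
Qed.

(** The function on the plane induced by a function that vanishes on the
    fibre. *)
Definition plane_fun k v : R := if `[< lattice v >] then 0 else k (surf_pt 1 v).

Lemma plane_fun_periodic k : lattice_periodic (plane_fun k).
Proof.
move=> v w l; rewrite /plane_fun; case: asboolP => lv; case: asboolP => lw //.
- by case: lw; have := latticeB lv l; rewrite opprB addrC subrK.
- by case: lv; have := latticeD l lw; rewrite subrK.
- by rewrite (surf_pt1_eq lv l).
Qed.

Lemma planar_surf_pt1 v : ~ lattice v -> latdist (planar (surf_pt 1 v)) = latdist v.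
Proof.
move=> nlv; rewrite (periodic_planar (@latdist_periodic _ _ _ E) (blow_dom1 nlv)).
by rewrite scale1r.
Qed.

Variables (k : surface R -> R) (C : R).
Hypothesis C0 : 0 < C.
Hypothesis kC : forall s, `|k s| <= C * latdist (planar s).
Hypothesis ck : continuous k.

Lemma plane_fun_planar s : plane_fun k (planar s) = k s.
Proof.
have [es|nes] := pselect (exceptional R s).
  have d0 := (exc_latdist E s).1 es.
  rewrite /plane_fun asboolT; last by apply/(latdist_eq0 E).
  by apply/esym/eqP; rewrite -normr_le0; have := kC s; rewrite d0 mulr0.
by have [h nl] := surf_pt1_planar nes; rewrite /plane_fun asboolF// h.
Qed.

(** The bound by the distance gives continuity at lattice points; elsewhere
    the function is read in the chart v |-> (v, R v). *)
Lemma plane_fun_continuous : continuous (plane_fun k).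
Proof.
have bound v : `|plane_fun k v| <= C * latdist v.
  rewrite /plane_fun; case: asboolP => lv.
    by rewrite normr0 mulr_ge0 ?latdist_ge0// ltW.
  by rewrite -(planar_surf_pt1 lv); exact: kC.
move=> v; rewrite /continuous_at; have [lv|nlv] := pselect (lattice v).
  have fv : plane_fun k v = 0 by rewrite /plane_fun asboolT.
  rewrite fv; apply/(@cvgrPdist_lt _ _ _ (nbhs v)) => e e0.
  have c := @latdist_continuous _ _ _ E v.
  have eC : 0 < e / C by rewrite divr_gt0.
  have : \forall w \near v, `|latdist v - latdist w| < e / C.
    by move/(@cvgrPdist_lt _ _ _ (nbhs v)): c; apply.
  apply: filterS => w; rewrite (latdist_eq0 E v).2// sub0r normrN ger0_norm ?latdist_ge0//.
  move=> h; rewrite sub0r normrN; apply: le_lt_trans (bound w) _.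
  by rewrite mulrC -ltr_pdivlMr.
have h := @comp_surf_pt _ _ _ E R k (1, v) ck (blow_dom1 nlv).
have a1 : (fun _ : 'rV[R]_2 => 1 : R) @ v --> (1 : R).
  exact: (@cvg_cst R (1 : R) _ (nbhs v) _).
have a2 : (fun w : 'rV[R]_2 => w) @ v --> v by exact: cvg_id.
have c : (fun w => k (surf_pt 1 w)) @ v --> k (surf_pt 1 v).
  exact: (cvg_comp _ _ (cvg_pair a1 a2) h).
have -> : plane_fun k v = k (surf_pt 1 v) by rewrite /plane_fun asboolF.
apply: cvg_trans c; apply: (@near_eq_cvg _ _ (nbhs v)).
have hn : \forall w \near v, 0 < latdist w.
  have d0 : 0 < latdist v by exact: latdist_gt0.
  have : open [set x : R | 0 < x] by exact: open_gt.
  move=> o; exact: (@latdist_continuous _ _ _ E v _ (open_nbhs_nbhs (conj o d0))).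
apply: filterS hn => w dw; rewrite /plane_fun asboolF// => /(latdist_eq0 E) e.
by rewrite e ltxx in dw.
Qed.

End OffFibre.

Section Sufficiency.
Context (R : realType) (A : 'M[int]_2) (lam : R) (E : eigenframe A lam).
Hypotheses (dA : \det A = 1) (lam1 : 1 < lam).
Local Notation latdist := (latdist E).
Local Notation f := (blowup_map A : surface R -> surface R).
Local Notation phi := (expansion E).
Local Notation pu := (p_unst E).
Local Notation ps := (p_stab E).
Implicit Types (g : surface R -> R).

Lemma birkhoff_continuous g N : continuous g -> continuous (birkhoff A g N).
Proof.
move=> cg; apply: continuous_mul; first exact: continuous_const.
apply: continuous_bigsum => k s.
apply: (@continuous_comp _ _ _ (iter k f) g); last exact: cg.
exact: iter_continuous.
Qed.

Lemma birkhoff_mean g N (mu : probability (borel (surface R)) R) :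
  (0 < N)%N -> continuous g -> invariant_measure f mu ->
  mean mu (birkhoff A g N) = mean mu g.
Proof.
move=> N0 cg mu_inv.
have bk k : bounded_borel (fun s => g (iter k f s)).
  apply: (continuous_bounded_borel E) => s.
  apply: (@continuous_comp _ _ _ (iter k f) g); last exact: cg.
  exact: iter_continuous.
rewrite meanZ; last exact: bounded_borel_sum.
rewrite mean_sum// (eq_bigr (fun=> mean mu g)); last first.
  move=> k _; exact (invariant_mean_iter (@blowup_continuous _ _ dA) mu_inv k (continuous_bounded_borel E cg)).
by rewrite sumr_const card_ord -[mean mu g *+ _]mulr_natl mulKf// pnatr_eq0 -lt0n.
Qed.

Lemma normalize_mean g (mu : probability (borel (surface R)) R) (c c' : R) :
  continuous g -> invariant_measure f mu -> mu [set pu] = mu [set ps] ->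
  mean mu (fun s => g s - c - c' * phi s) = mean mu g - c.
Proof.
move=> cg mu_inv gap.
have bg := continuous_bounded_borel E cg.
have bphi := expansion_bounded E dA.
rewrite meanB; last 2 first.
- by apply: bounded_borelB => //; exact: bounded_borel_cst.
- by apply: bounded_borelM => //; exact: bounded_borel_cst.
rewrite meanB//; last exact: bounded_borel_cst.
rewrite mean_cst meanZ// (expansion_mean E dA lam1 mu_inv).
by rewrite gap subrr !mulr0 subr0.
Qed.

Section Cvg.
Variables (mu : probability (borel (surface R)) R)
  (nu : nat -> probability (borel (surface R)) R).
Hypotheses (mu_inv : invariant_measure f mu)
  (nu_inv : forall n, invariant_measure f (nu n)).
Hypotheses (mu_gap : mu [set pu] = mu [set ps])
  (nu_gap : forall n, nu n [set pu] = nu n [set ps]).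
Hypothesis off_cvg : forall (k : surface R -> R) (C : R), 0 < C -> continuous k ->
  (forall s, `|k s| <= C * latdist (planar s)) ->
  mean (nu n) k @[n --> \oo] --> mean mu k.

(** Subtracting a constant and a multiple of the expansion rate makes [g]
    vanish at both saddles and shifts all the means by the same amount.
    Birkhoff averages of the result keep its means and are small near the
    fibre, so they can be cut off there. *)
Lemma off_fibre_criterion g : continuous g ->
  mean (nu n) g @[n --> \oo] --> mean mu g.
Proof.
move=> cg; have l0 := ln_lam_gt0 lam1.
(* These constants make g0 vanish at both saddles. *)
pose c := (g pu + g ps) / 2; pose c' := (g pu - g ps) / (2 * ln lam).
pose g0 s := g s - c - c' * phi s.
have cphi := expansion_continuous dA (E := E).
have cg0 : continuous g0.
  apply: continuous_sub; first by apply: continuous_sub => //; exact: continuous_const.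
  by apply: continuous_mul => //; exact: continuous_const.
have gu : g0 pu = 0.
  rewrite /g0 expansion_unst// /c /c'; field.
  by rewrite gt_eqF.
have gs : g0 ps = 0.
  rewrite /g0 expansion_stab// /c /c'; field.
  by rewrite gt_eqF.
apply/(@cvgrPdist_le _ _ _ \oo) => e e0.
have e3 : 0 < e / 3 by rewrite divr_gt0.
have e6 : 0 < e / 6 by rewrite divr_gt0.
have [N N0 hN] := birkhoff_fibre dA lam1 cg0 gu gs e6.
pose b := birkhoff A g0 N.
have cb : continuous b by exact: birkhoff_continuous.
have hb s : exceptional R s -> `|b s| < e / 3.
  by move=> /hN/le_lt_trans; apply; lra.
have [d d0 hd] := near_fibre E cb hb.
(* The average b, cut off near the fibre. *)
pose k s := b s * Num.min 1 (latdist (planar s) / d).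
have cD := @latdist_planar_continuous _ _ _ E.
have ck : continuous k.
  apply: continuous_mul => // s.
  apply: (@continuous_min _ _ (fun=> 1 : R) (fun s => latdist (planar s) / d)).
    exact: continuous_const.
  by apply: (continuous_mul cD); exact: continuous_const.
have [M M0 hM] := surface_bounded E cb.
have kC s : `|k s| <= M / d * latdist (planar s).
  rewrite /k normrM (_ : M / d * _ = M * (latdist (planar s) / d)); last by ring.
  apply: ler_pM => //; rewrite ger0_norm; first by rewrite ge_min lexx orbT.
  by rewrite le_min ler01 divr_ge0 ?latdist_ge0// ltW.
have bk s : `|b s - k s| <= e / 3.
  rewrite /k -{1}[b s]mulr1 -mulrBr normrM.
  have [sd|sd] := ltP (latdist (planar s)) d; last first.
    have h1 : 1 <= latdist (planar s) / d by rewrite ler_pdivlMr// mul1r.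
    by rewrite min_l// subrr normr0 mulr0 ltW.
  rewrite -[leRHS]mulr1; apply: ler_pM => //; first exact: hd.
  have h1 : latdist (planar s) / d <= 1 by rewrite ler_pdivrMr// mul1r ltW.
  have h2 : 0 <= latdist (planar s) / d by rewrite divr_ge0 ?latdist_ge0// ltW.
  by rewrite min_r// ger0_norm; lra.
have bb := continuous_bounded_borel E cb.
have bkb := continuous_bounded_borel E ck.
have key m : invariant_measure f m -> m [set pu] = m [set ps] ->
    `|(mean m g - c) - mean m k| <= e / 3.
  move=> m_inv m_gap; rewrite -(@normalize_mean g m c c')//.
  by rewrite -(birkhoff_mean N0 cg0 m_inv); exact: mean_dist.
have Md : 0 < M / d by rewrite divr_gt0.
have : \forall n \near \oo, `|mean mu k - mean (nu n) k| <= e / 3.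
  by have := off_cvg Md ck kC; move/(@cvgrPdist_le _ _ _ \oo); apply.
apply: filterS => n hn.
have h1 := key mu mu_inv mu_gap; have h2 := key (nu n) (nu_inv n) (nu_gap n).
rewrite (_ : mean mu g - mean (nu n) g = ((mean mu g - c) - mean mu k) +
  (mean mu k - mean (nu n) k) - ((mean (nu n) g - c) - mean (nu n) k)); last by ring.
apply: le_trans (ler_normB _ _) _.
have := ler_normD (mean mu g - c - mean mu k) (mean mu k - mean (nu n) k).
move: h1 h2 hn; set x := `|_ - mean mu k|; set y := `|_ - mean (nu n) k|; lra.
Qed.

End Cvg.

(** The periodic orbits found on the torus avoid the origin, so they lift to
    the surface and charge neither saddle. *)
Theorem periodic_approximation (mu : probability (borel (surface R)) R) :
  invariant_measure f mu -> mu [set pu] = mu [set ps] ->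
  exists (z : nat -> 'rV[R]_2) (p : nat -> nat),
    (forall n, ~ lattice (z n) /\
       iter (p n).+1 f (surf_pt 1 (z n)) = surf_pt 1 (z n)) /\
    weak_star_cvg (fun n => orbit_prob (R := R) f (surf_pt 1 (z n)) (p n)) mu.
Proof.
move=> mu_inv mu_gap.
have [z [P [hz hG]]] := periodic_equidistribution E dA lam1 mu_inv.
exists z, (fun n => (P n).-1).
have PE n : (P n).-1.+1 = P n by apply: prednK; case: (hz n).
have nl n : ~ lattice (z n) by case: (hz n).
have per n : iter (P n).-1.+1 f (surf_pt 1 (z n)) = surf_pt 1 (z n).
  rewrite PE surf_pt1_iter//; apply: surf_pt1_eq; first exact: nonlattice_iter.
  by case: (hz n).
split => [n|]; first by split.
set nu := fun n => _.
have nuE n (B : set (surface R)) :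
    nu n B = (orbit_count f (surf_pt 1 (z n)) (P n).-1.+1 B)%:E.
  exact: orbit_measureE.
have nu_inv n : invariant_measure f (nu n) by exact: (orbit_invariant (ltn0Sn _) (per n) (nuE n)).
apply/(weak_star_meanP nu mu (@continuous_bounded_borel _ _ _ E)) => g cg.
apply: off_fibre_criterion => // [n|k C C0 ck kC].
  rewrite !nuE /orbit_count !big1// => i _; rewrite surf_pt1_iter//;
  have h := blow_dom1 (@nonlattice_iter _ _ dA i _ (nl n));
  rewrite memNset//= => e.
    have := exc_stab E; rewrite -e => /(exceptionalP h)/eqP.
    by rewrite oner_eq0.
  have := exc_unst E; rewrite -e => /(exceptionalP h)/eqP.
  by rewrite oner_eq0.
have -> : k = plane_fun k \o @planar R.
  by apply/funext => s; rewrite /= (plane_fun_planar kC).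
have := hG _ (plane_fun_periodic k) (plane_fun_continuous C0 kC ck).
apply: cvg_trans; apply: near_eq_cvg; apply: nearW => n.
rewrite orbit_prob_mean; last first.
  rewrite (_ : _ \o _ = k); first exact: (continuous_bounded_borel E).
  by apply/funext => s; rewrite /= (plane_fun_planar kC).
rewrite PE; congr (_ * _); apply: eq_bigr => i _.
rewrite /= (plane_fun_planar kC) surf_pt1_iter// /plane_fun asboolF//.
exact: nonlattice_iter.
Qed.

End Sufficiency.

(** * Charts and their tangent maps *)

Section Charts.
Context (R : realType).
Implicit Types (y v w : 'rV[R]_2) (i j : 'I_2).

Definition other i : 'I_2 := if i == ord0 then ord_max else ord0.

Lemma ord2P i : i = ord0 \/ i = ord_max.
Proof.
case: (unliftP ord0 i) => [j ->|->]; last by left.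
by right; apply/val_inj => /=; case: j => [[]].
Qed.

Definition chart_axis i : 'rV[R]_2 := \row_j (j == i)%:R.

(** The blow-down in the chart i: (s, m) |-> s (e_i + m e_j), with j the other
    index. *)
Definition chart_plane i y : 'rV[R]_2 :=
  y ord0 ord0 *: chart_axis i + (y ord0 ord0 * y ord0 ord_max) *: chart_axis (other i).

(** The differential of [chart_plane i] at [y]. *)
Definition chart_tangent i y v : 'rV[R]_2 :=
  v ord0 ord0 *: chart_axis i +
  (y ord0 ord0 * v ord0 ord_max + y ord0 ord_max * v ord0 ord0) *: chart_axis (other i).

Lemma chart_planeE i y : chart_plane i y =
  y ord0 ord0 *: (\row_(j < 2) (if j == i then 1 else y ord0 ord_max)).
Proof. by apply: row2P; rewrite !mxE /other; case: (ord2P i) => -> /=; ring. Qed.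

Lemma chart_coord i (a b : R) (u := a *: chart_axis i + b *: chart_axis (other i)) :
  u ord0 i = a /\ u ord0 (other i) = b.
Proof. by rewrite /u !mxE /other; case: (ord2P i) => -> /=; split; ring. Qed.

Lemma chart_norm i (a b r : R) : `|a| <= r -> `|b| <= r ->
  `|a *: chart_axis i + b *: chart_axis (other i)| <= r.
Proof.
move=> ha hb; apply: row_norm_le; rewrite !mxE /other; case: (ord2P i) => -> /=;
  by rewrite !(mulr1, mulr0, addr0, add0r).
Qed.

Lemma chart_plane_nonlattice i y : `|y ord0 ord0| < 1 -> y ord0 ord0 != 0 ->
  ~ lattice (chart_plane i y).
Proof.
move=> h1 h0 [m e]; have := (chart_coord i (y ord0 ord0) (y ord0 ord0 * y ord0 ord_max)).1.
rewrite -/(chart_plane i y) e mxE => e'.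
rewrite -e' in h0 h1; move: h1; rewrite -intr_norm -[1]/(1%:~R) ltr_int.
by move: h0; rewrite intr_eq0 => h0; have := normr_gt0 (m ord0 i); rewrite h0; lia.
Qed.

Lemma surf_chart_plane i y : ~ lattice (chart_plane i y) ->
  surf_chart i y = surf_pt 1 (chart_plane i y).
Proof.
move=> nl; have y0 : y ord0 ord0 != 0.
  by apply/eqP => e; apply: nl; rewrite chart_planeE e scale0r; exact: lattice0.
apply/surf_ptP; last first.
- by left; rewrite oner_eq0 scale1r -chart_planeE subrr; split => //; exact: lattice0.
- exact: blow_dom1.
split => /=; last by rewrite -chart_planeE.
apply/eqP => e; apply: nl; rewrite chart_planeE e scaler0; exact: lattice0.
Qed.

Lemma coord_is_diff (M : 'rV[R]_2) j :
  differentiable (fun N : 'rV[R]_2 => N ord0 j : R) M /\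
  ('d (fun N : 'rV[R]_2 => N ord0 j : R) M = (fun N : 'rV[R]_2 => N ord0 j) :> (_ -> _)).
Proof.
split; first exact: differentiable_coord.
have lin : linear (fun N : 'rV[R]_2 => N ord0 j : R).
  by move=> a u v; rewrite !mxE.
pose fM := GRing.isLinear.Build _ _ _ _ _ lin.
pose fL : {linear 'rV[R]_2 -> R} := HB.pack (fun N : 'rV[R]_2 => N ord0 j : R) fM.
exact: (@diff_lin _ _ _ fL M (@coord_continuous _ _ _ _ _)).
Qed.

Lemma chart_plane_diff i y : differentiable (chart_plane i) y /\
  forall v, 'd (chart_plane i) y v = chart_tangent i y v.
Proof.
have [da dA] := coord_is_diff y ord0; have [db dB] := coord_is_diff y ord_max.
set a := (fun N : 'rV[R]_2 => N ord0 ord0 : R) in da dA.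
set b := (fun N : 'rV[R]_2 => N ord0 ord_max : R) in db dB.
have dab : differentiable (a * b) y by exact: differentiableM.
have E : chart_plane i = (fun z => a z *: chart_axis i) + (fun z => (a * b) z *: chart_axis (other i)).
  by apply/funext.
have d1 : differentiable (fun z => a z *: chart_axis i) y by exact: differentiableZl.
have d2 : differentiable (fun z => (a * b) z *: chart_axis (other i)) y.
  exact: differentiableZl.
split; first by rewrite E; apply: differentiableD.
move=> v; rewrite E (diffD d1 d2) /=.
have h1 := congr1 (fun g : 'rV[R]_2 -> 'rV[R]_2 => g v) (diffZl (chart_axis i) da).
have h2 := congr1 (fun g : 'rV[R]_2 -> 'rV[R]_2 => g v) (diffZl (chart_axis (other i)) dab).
have h3 := congr1 (fun g : 'rV[R]_2 -> R => g v) (diffM da db).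
have h4 := congr1 (fun g : 'rV[R]_2 -> R => g v) dA.
have h5 := congr1 (fun g : 'rV[R]_2 -> R => g v) dB.
rewrite /= in h1 h2 h3 h4 h5.
apply: (etrans (f_equal2 +%R h1 h2)).
rewrite /chart_tangent; congr (_ *: _ + _ *: _); first exact: h4.
apply: (etrans h3); apply: (f_equal2 +%R).
  by apply: (f_equal2 *%R _ h5).
by apply: (f_equal2 *%R _ h4).
Qed.

End Charts.

Section Differential.
Context (R : realType) (A : 'M[int]_2).
Hypothesis dA : \det A = 1.
Local Notation f := (blowup_map A : surface R -> surface R).
Implicit Types (y z v w : 'rV[R]_2) (i j : 'I_2).

Lemma chart_near i y : `|y ord0 ord0| < 1 -> y ord0 ord0 != 0 ->
  \forall y' \near y, ~ lattice (chart_plane i y').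
Proof.
move=> h1 h0.
have c : (fun N : 'rV[R]_2 => N ord0 ord0) @ y --> y ord0 ord0.
  exact: (@coord_continuous _ _ _ ord0 ord0 y).
have n0 : \forall y' \near y, (y' : 'rV[R]_2) ord0 ord0 != 0.
  have o : open [set x : R | x != 0] by exact: open_neq.
  exact: (c _ (open_nbhs_nbhs (conj o h0))).
have n1 : \forall y' \near y, `|(y' : 'rV[R]_2) ord0 ord0| < 1.
  have o : open [set x : R | `|x| < 1].
    apply: (open_comp (f := Num.norm : R -> R) (D := [set x | x < 1])).
      by move=> x _; exact: norm_continuous.
    exact: open_lt.
  exact: (c _ (open_nbhs_nbhs (conj o h1))).
by apply: filterS2 n0 n1 => y' *; exact: chart_plane_nonlattice.
Qed.

Lemma iter_mxact_linear n : linear (iter n (mxact A) : 'rV[R]_2 -> 'rV[R]_2).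
Proof.
elim: n => [|n ih] a u v //=; rewrite ih /mxact mulmxDl.
by rewrite scalemxAl.
Qed.

Lemma iter_mxact_continuous n : continuous (iter n (mxact A) : 'rV[R]_2 -> 'rV[R]_2).
Proof.
elim: n => [|n ih] v; first exact: cvg_id.
apply: (@continuous_comp _ _ _ (iter n (mxact A)) (mxact A)); first exact: ih.
exact: mxact_continuous.
Qed.

Lemma iter_mxact_diff n w :
  differentiable (iter n (mxact A) : 'rV[R]_2 -> 'rV[R]_2) w /\
  'd (iter n (mxact A)) w = iter n (mxact A) :> ('rV[R]_2 -> 'rV[R]_2).
Proof.
pose fM := GRing.isLinear.Build _ _ _ _ _ (@iter_mxact_linear n).
pose fL : {linear 'rV[R]_2 -> 'rV[R]_2} := HB.pack (iter n (mxact A) : 'rV[R]_2 -> 'rV[R]_2) fM.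
split; first exact: (@linear_differentiable _ _ _ fL w (@iter_mxact_continuous n)).
exact: (@diff_lin _ _ _ fL w (@iter_mxact_continuous n)).
Qed.

Lemma plane_iter_diff n i y (c : 'rV[R]_2) (F := fun y' => iter n (mxact A) (chart_plane i y') - c) :
  differentiable F y /\ forall v, 'd F y v = iter n (mxact A) (chart_tangent i y v).
Proof.
have [dp dpE] := chart_plane_diff i y.
have [di diE] := iter_mxact_diff n (chart_plane i y).
have dc : differentiable (iter n (mxact A) \o chart_plane i) y by exact: differentiable_comp.
have dk : differentiable (cst (- c) : 'rV[R]_2 -> 'rV[R]_2) y by exact: differentiable_cst.
have FE : F = (iter n (mxact A) \o chart_plane i) + cst (- c) by apply/funext.
split; first by rewrite FE; exact: differentiableD.
move=> v; rewrite FE (diffD dc dk) /=.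
have h1 := congr1 (fun g : 'rV[R]_2 -> 'rV[R]_2 => g v) (diff_comp dp di).
have h2 := congr1 (fun g : 'rV[R]_2 -> 'rV[R]_2 => g v) (diff_cst (- c) y).
apply: (etrans (f_equal2 +%R h1 h2)); rewrite addr0 /=.
apply: (etrans (congr1 (fun g : 'rV[R]_2 -> 'rV[R]_2 => g _) diE)).
by congr iter; exact: dpE.
Qed.

Lemma chart_iter n i y : ~ lattice (chart_plane i y) ->
  iter n f (surf_chart i y) = surf_pt 1 (iter n (mxact A) (chart_plane i y)).
Proof. by move=> nl; rewrite surf_chart_plane// surf_pt1_iter. Qed.

Lemma surf_pt1_inj v w : ~ lattice v -> ~ lattice w ->
  surf_pt 1 v = surf_pt 1 w -> lattice (v - w).
Proof.
move=> nv nw /(surf_ptP (blow_dom1 nv) (blow_dom1 nw)) [[_ _]|[/eqP]].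
  by rewrite !scale1r.
by rewrite oner_eq0.
Qed.

(** Read in the plane, both G and A^n lift the same map of the torus. They
    differ by a continuous function with values in the lattice, which is
    locally constant and disappears in the differential. *)
Lemma chart_differential_tangent n i y j z (J : 'M[R]_2) :
  `|y ord0 ord0| < 1 -> y ord0 ord0 != 0 ->
  `|z ord0 ord0| < 1 -> z ord0 ord0 != 0 ->
  chart_differential (iter n f) i y j z J ->
  forall v, chart_tangent j z (v *m J) = iter n (mxact A) (chart_tangent i y v).
Proof.
move=> y1 y0 z1 z0 [G [Gy dG hG JE]] v.
have nG : \forall y' \near y, ~ lattice (chart_plane j (G y')).
  have c : G @ y --> z by rewrite -Gy; exact: differentiable_continuous.
  exact: (c _ (chart_near j z1 z0)).
have [dj djE] := chart_plane_diff j z.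
have [di diE] := plane_iter_diff n i y 0.
have dj' : differentiable (chart_plane j) (G y) by rewrite Gy.
have dc : differentiable (chart_plane j \o G) y by exact: differentiable_comp.
pose e y' := chart_plane j (G y') - (iter n (mxact A) (chart_plane i y') - 0).
have ce : e @ y --> e y.
  apply: (@cvgB _ _ _ (nbhs y) _ (chart_plane j \o G)).
    exact: (differentiable_continuous dc).
  exact: (differentiable_continuous di).
have le : \forall y' \near y, lattice (e y').
  apply: filterS3 (chart_near i y1 y0) nG hG => y' h1 h2.
  rewrite surf_chart_plane// chart_iter// => /surf_pt1_inj.
  rewrite /e subr0; apply => //; exact: nonlattice_iter.
have ey : lattice (e y) by exact: (nbhs_singleton le).
(* A lattice vector of norm at most 1/2 is zero, so e is constant near y. *)
have const : \forall y' \near y, chart_plane j (G y') = iter n (mxact A) (chart_plane i y') - (- e y).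
  have h2 : 0 < 2^-1 :> R by rewrite invr_gt0.
  have hn : \forall y' \near y, `|e y - e y'| < 2^-1.
    by move/(@cvgrPdist_lt _ _ _ (nbhs y)): ce; apply.
  apply: filterS2 le hn => y' l h.
  have /eqP := lattice_half (latticeB ey l) (ltW h).
  by rewrite subr_eq0 opprK => /eqP ->; rewrite /e subr0 addrC subrK.
have [di2 diE2] := plane_iter_diff n i y (- e y).
have h1 := congr1 (fun g : 'rV[R]_2 -> 'rV[R]_2 => g v) (diff_comp dG dj').
have k := near_eq_derive v const.
have k1 := deriveE v dc.
have k2 := deriveE v di2.
have s1 : chart_tangent j z (v *m J) = 'd (chart_plane j) (G y) ('d G y v).
  rewrite JE /jacobian mul_rV_lin1 Gy; exact: (esym (djE _)).
exact (etrans s1 (etrans (esym h1) (etrans (esym k1) (etrans k (etrans k2 (diE2 v)))))).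
Qed.

(** Slope coordinates, inverse to [chart_plane j] where the j-th coordinate is
    not zero. *)
Definition chart_coords j w : 'rV[R]_2 := \row_(k < 2)
  (if k == ord0 then w ord0 j else w ord0 (other j) / w ord0 j).

Lemma chart_coordsK j w : w ord0 j != 0 -> chart_plane j (chart_coords j w) = w.
Proof.
move=> wj; rewrite /chart_plane !mxE /=; apply: row2P; rewrite !mxE /other;
  move: wj; case: (ord2P j) => -> /= wj; field; rewrite ?wj//.
Qed.

Lemma chart_planeK j z : z ord0 ord0 != 0 -> chart_coords j (chart_plane j z) = z.
Proof.
move=> z0; have [h1 h2] := chart_coord j (z ord0 ord0) (z ord0 ord0 * z ord0 ord_max).
rewrite -/(chart_plane j z) in h1 h2.
apply: row2P; rewrite mxE /= ?h1// h2 mulrAC mulfV ?mul1r//.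
Qed.

Lemma chart_coords_diff j w : w ord0 j != 0 -> differentiable (chart_coords j) w.
Proof.
move=> wj; have [da _] := coord_is_diff w j; have [db _] := coord_is_diff w (other j).
have E : chart_coords j = (fun u : 'rV[R]_2 => (u ord0 j) *: chart_axis R ord0) +
   (fun u : 'rV[R]_2 => (u ord0 (other j) * (u ord0 j)^-1) *: chart_axis R ord_max).
  by apply/funext => u; apply: row2P; rewrite !mxE /=; ring.
rewrite E; apply: differentiableD; apply: differentiableZl => //.
apply: (differentiableM db); exact: differentiableV.
Qed.

(** The local expression of the map is A^n followed by a lattice translation,
    read in slope coordinates. *)
Lemma chart_differential_exists n i y j z :
  `|y ord0 ord0| < 1 -> y ord0 ord0 != 0 ->
  `|z ord0 ord0| < 1 -> z ord0 ord0 != 0 ->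
  surf_chart j z = iter n f (surf_chart i y) ->
  exists J, chart_differential (iter n f) i y j z J.
Proof.
move=> y1 y0 z1 z0 h.
have ny := chart_plane_nonlattice (i := i) y1 y0.
have nz := chart_plane_nonlattice (i := j) z1 z0.
pose c := iter n (mxact A) (chart_plane i y) - chart_plane j z.
have lc : lattice c.
  move: h; rewrite chart_iter// surf_chart_plane// => /esym /surf_pt1_inj; apply => //.
  exact: nonlattice_iter.
pose F y' := iter n (mxact A) (chart_plane i y') - c.
have Fy : F y = chart_plane j z by rewrite /F /c subKr.
have [dF _] := plane_iter_diff n i y c.
have Fj : F y ord0 j = z ord0 ord0.
  by rewrite Fy; exact: (chart_coord j _ _).1.
have dC : differentiable (chart_coords j) (F y).
  by apply: chart_coords_diff; rewrite Fj.
exists (jacobian (chart_coords j \o F) y), (chart_coords j \o F); split => //.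
- by rewrite /= Fy chart_planeK.
- exact: differentiable_comp.
have nF : \forall y' \near y, F y' ord0 j != 0.
  have c1 : (fun y' => F y' ord0 j) @ y --> F y ord0 j.
    apply: (@cvg_comp _ _ _ F (fun N : 'rV[R]_2 => N ord0 j) (nbhs y) (nbhs (F y))).
      exact: (differentiable_continuous dF).
    exact: (@coord_continuous _ _ _ ord0 j (F y)).
  have o : open [set x : R | x != 0] by exact: open_neq.
  have h0 : F y ord0 j != 0 by rewrite Fj.
  exact: (c1 _ (open_nbhs_nbhs (conj o h0))).
apply: filterS2 (chart_near i y1 y0) nF => y' ny' fj /=.
have nF' : ~ lattice (F y').
  move=> lF; apply: (nonlattice_iter dA (n := n) ny').
  by have := latticeD lF lc; rewrite subrK.
rewrite surf_chart_plane ?chart_coordsK// chart_iter//.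
by apply: surf_pt1_eq => //; rewrite /F addrAC subrr sub0r; exact: latticeN.
Qed.

End Differential.

(** * Lyapunov exponents of periodic orbits *)

Section Lyapunov.
Context (R : realType) (A : 'M[int]_2) (lam : R) (E : eigenframe A lam).
Hypotheses (dA : \det A = 1) (lam1 : 1 < lam).
Local Notation enorm := (enorm E).
Local Notation latdist := (latdist E).
Local Notation f := (blowup_map A : surface R -> surface R).
Implicit Types (y z v w : 'rV[R]_2).

Lemma growth_rate (u : nat -> R) (a b r : R) : 0 < a -> 0 < b -> 0 < r ->
  (forall n, a * r ^+ n <= u n <= b * r ^+ n) ->
  ln (u n) / n%:R @[n --> \oo] --> ln r.
Proof.
move=> a0 b0 r0 hu; apply/(@cvgrPdist_le _ _ _ \oo) => e e0.
pose C := `|ln a| + `|ln b|.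
have n1 : \forall n \near \oo, (0 < n)%N by exact: nbhs_infty_gt.
have n2 : \forall n \near \oo, C / e <= n%:R by exact: nbhs_infty_ger.
apply: filterS2 n1 n2 => n n0 hn; have nR : 0 < n%:R :> R by rewrite ltr0n.
have rn : 0 < r ^+ n by rewrite exprn_gt0.
have /andP[h1 h2] := hu n.
have un : 0 < u n by apply: lt_le_trans h1; rewrite mulr_gt0.
have k1 : ln a + ln r *+ n <= ln (u n).
  by rewrite -lnXn// -lnM ?posrE// ler_ln ?posrE// mulr_gt0.
have k2 : ln (u n) <= ln b + ln r *+ n.
  by rewrite -lnXn// -lnM ?posrE// ler_ln ?posrE// mulr_gt0.
rewrite -[ln r *+ n]mulr_natl in k1 k2.
have -> : ln r - ln (u n) / n%:R = (n%:R * ln r - ln (u n)) / n%:R.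
  by rewrite mulrBl mulrAC mulfV ?mul1r// gt_eqF.
rewrite normrM normfV (gtr0_norm nR) ler_pdivrMr//.
apply: (@le_trans _ _ C); last by rewrite mulrC -ler_pdivrMr.
rewrite /C ler_norml; have := ler_norm (ln b); have := ler_norm (- ln a); rewrite normrN.
have := normr_ge0 (ln a); have := normr_ge0 (ln b).
by move=> h3 h4 h5 h6; apply/andP; split; lra.
Qed.

Lemma tangent_upper i y v : chart_box y -> `|chart_tangent i y v| <= 2 * `|v|.
Proof.
move=> [y0 y1]; have v0 := coord_le_norm v ord0; have v1 := coord_le_norm v ord_max.
apply: chart_norm; first by apply: le_trans v0 _; rewrite ler_peMl// ler1n.
apply: le_trans (ler_normD _ _) _; rewrite !normrM mulrDl mul1r.
apply: lerD.
  apply: le_trans v1; rewrite ler_piMl//; apply: le_trans y0 _.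
  by rewrite invf_le1// ler1n.
by apply: le_trans v0; rewrite ler_piMl.
Qed.

(** The chart degenerates on the fibre; its tangent map is bounded below by
    the height |y ord0 ord0|. *)
Lemma tangent_lower i y v (c : R) : chart_box y -> 0 < c -> c <= `|y ord0 ord0| ->
  c * `|v| <= 2 * `|chart_tangent i y v|.
Proof.
move=> [y0 y1] c0 cy; set t := chart_tangent i y v.
have [t0 t1] := chart_coord i (v ord0 ord0)
   (y ord0 ord0 * v ord0 ord_max + y ord0 ord_max * v ord0 ord0).
rewrite -/(chart_tangent i y v) -/t in t0 t1.
have h0 := coord_le_norm t i; have h1 := coord_le_norm t (other i).
rewrite t0 in h0; rewrite t1 in h1.
have hv0 : `|v ord0 ord0| <= 2 * `|t| / c.
  rewrite ler_pdivlMr//; apply: (@le_trans _ _ `|v ord0 ord0|).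
    rewrite ler_piMr//; apply: le_trans cy _; apply: le_trans y0 _.
    by rewrite invf_le1// ler1n.
  by apply: le_trans h0 _; rewrite ler_peMl// ler1n.
have hv1 : `|v ord0 ord_max| <= 2 * `|t| / c.
  rewrite ler_pdivlMr//; apply: (@le_trans _ _ `|y ord0 ord0 * v ord0 ord_max|).
    by rewrite normrM mulrC ler_wpM2r.
  have -> : y ord0 ord0 * v ord0 ord_max =
    (y ord0 ord0 * v ord0 ord_max + y ord0 ord_max * v ord0 ord0) -
     y ord0 ord_max * v ord0 ord0 by rewrite addrK.
  apply: le_trans (ler_normB _ _) _; rewrite mulrDl mul1r; apply: lerD => //.
  by rewrite normrM; apply: le_trans h0; rewrite ler_piMl.
have := row_norm_le hv0 hv1.
by rewrite ler_pdivlMr// mulrC.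
Qed.

Lemma chart_height i y : chart_box y -> ~ lattice (chart_plane i y) ->
  latdist (planar (surf_chart i y)) <= enorm_bound E * `|y ord0 ord0|.
Proof.
move=> [y0 y1] nl; rewrite surf_chart_plane// planar_surf_pt1//.
apply: le_trans (latdist_le_enorm _ _) _; apply: le_trans (enorm_le _ _) _.
rewrite ler_wpM2l ?(ltW (enorm_bound_gt0 E))//.
by apply: chart_norm => //; rewrite normrM ler_piMr.
Qed.

Lemma chart_cover w : ~ lattice w -> exists i y,
  [/\ chart_box y, y ord0 ord0 != 0 & surf_chart i y = surf_pt 1 w].
Proof.
move=> nlw; have [v [l hv]] : exists v, lattice (w - v) /\ `|v| <= 2^-1.
  have [m lm hm] := lattice_round w; exists (w - m); split => //.
  by rewrite opprB addrC subrK.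
have nlv : ~ lattice v by move=> h; apply: nlw; have := latticeD l h; rewrite subrK.
rewrite (surf_pt1_eq nlw l).
have [i hi] : exists i : 'I_2, `|v ord0 (other i)| <= `|v ord0 i|.
  have [h|h] := leP `|v ord0 ord_max| `|v ord0 ord0|; first by exists ord0.
  by exists ord_max; rewrite /other /= ltW.
have vi : v ord0 i != 0.
  apply/eqP => e; apply: nlv; rewrite (_ : v = 0); first exact: lattice0.
  move: hi; rewrite e normr0 normr_le0 => /eqP e'.
  by apply: row2P; rewrite mxE; move: e e'; rewrite /other; case: (ord2P i) => -> /=.
exists i, (chart_coords i v); split.
- split; rewrite !mxE /=.
    by apply: le_trans (coord_le_norm _ _) hv.
  by rewrite normrM normfV ler_pdivrMr ?normr_gt0// mul1r.
- by rewrite mxE.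
by rewrite surf_chart_plane ?chart_coordsK.
Qed.

Lemma periodic_min (g : nat -> R) P : (0 < P)%N -> (forall n, 0 < g n) ->
  (forall n, g (n + P)%N = g n) -> exists2 c, 0 < c & forall n, c <= g n.
Proof.
move=> P0 g0 gP.
have [c c0 hc] : exists2 c, 0 < c & forall n, (n < P)%N -> c <= g n.
  elim: P {P0 gP} => [|P [c c0 hc]]; first by exists 1.
  exists (Num.min c (g P)); first by rewrite lt_min c0 g0.
  move=> n; rewrite ltnS leq_eqVlt => /orP[/eqP ->|nP].
    by rewrite ge_min lexx orbT.
  by rewrite ge_min hc.
exists c => // n; rewrite (divn_eq n P) addnC.
elim: (n %/ P)%N => [|q ih]; first by rewrite mul0n addn0 hc// ltn_pmod.
by rewrite mulSn [(P + _)%N]addnC addnA gP.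
Qed.

Lemma cu_iter n w : cu E (iter n (mxact A) w) = lam ^+ n * cu E w.
Proof. by elim: n => [|n ih] /=; rewrite ?expr0 ?mul1r// cu_act ih exprS mulrA. Qed.

Lemma cs_iter n w : cs E (iter n (mxact A) w) = lam^-1 ^+ n * cs E w.
Proof. by elim: n => [|n ih] /=; rewrite ?expr0 ?mul1r// cs_act ih exprS mulrA. Qed.

Section Orbit.
Variables (w : 'rV[R]_2) (P : nat).
Hypotheses (nlw : ~ lattice w) (P0 : (0 < P)%N)
  (wP : lattice (iter P (mxact A) w - w)).

(** A periodic orbit is finite and avoids the fibre. *)
Lemma orbit_height : exists2 c, 0 < c & forall n i y, chart_box y ->
  surf_chart i y = surf_pt 1 (iter n (mxact A) w) ->
  y ord0 ord0 != 0 -> c <= `|y ord0 ord0|.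
Proof.
have [c c0 hc] : exists2 c, 0 < c & forall n, c <= latdist (iter n (mxact A) w).
  apply: (periodic_min P0) => n.
    by apply: latdist_gt0; exact: nonlattice_iter.
  apply: latdist_per; rewrite iterD -iter_mxactB; exact: iter_mxact_lattice.
have b0 := enorm_bound_gt0 E.
exists (c / enorm_bound E); first by rewrite divr_gt0.
move=> n i y hy e y0; rewrite ler_pdivrMr// mulrC; apply: le_trans (hc n) _.
have nl : ~ lattice (chart_plane i y).
  apply: chart_plane_nonlattice => //; case: hy => h _.
  by apply: le_lt_trans h _; rewrite invf_lt1// ltr1n.
rewrite -(planar_surf_pt1 E (nonlattice_iter dA (n := n) nlw)) -e.
exact: chart_height.
Qed.

Lemma box_lt1 y : chart_box y -> `|y ord0 ord0| < 1.
Proof. by case=> h _; apply: le_lt_trans h _; rewrite invf_lt1// ltr1n. Qed.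

Lemma chart_nonzero i y : surf_chart i y = surf_pt 1 w -> y ord0 ord0 != 0.
Proof.
move=> e; apply/eqP => y0; have := e; rewrite /surf_chart y0.
set r := \row_j _; have r0 : r != 0.
  apply/eqP => /rowP/(_ i); rewrite !mxE eqxx => /eqP; by rewrite oner_eq0.
move/(surf_ptP (blow_dom0 r0) (blow_dom1 nlw)) => [[/eqP//]|[_ /eqP]].
by rewrite oner_eq0.
Qed.

End Orbit.

Section Exponent.
Variables (w : 'rV[R]_2) (P : nat).
Hypotheses (nlw : ~ lattice w) (P0 : (0 < P)%N)
  (wP : lattice (iter P (mxact A) w - w)).
Variables (i : nat -> 'I_2) (y : nat -> 'rV[R]_2) (J : nat -> 'M[R]_2) (v : 'rV[R]_2).
Hypotheses (v0 : v != 0) (y_start : surf_chart (i 0%N) (y 0%N) = surf_pt 1 w)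
  (y_box : forall n, chart_box (y n))
  (y_diff : forall n, chart_differential (iter n f) (i 0%N) (y 0%N) (i n) (y n) (J n)).

Let w0 := chart_tangent (i 0%N) (y 0%N) v.

Let y_pt n : surf_chart (i n) (y n) = surf_pt 1 (iter n (mxact A) w).
Proof.
have [G [Gy _ hG _]] := y_diff n.
by have := nbhs_singleton hG; rewrite Gy y_start surf_pt1_iter.
Qed.

Let y_nz n : y n ord0 ord0 != 0.
Proof. by apply: chart_nonzero (y_pt n); exact: nonlattice_iter. Qed.

Let tangent_iter n : chart_tangent (i n) (y n) (v *m J n) = iter n (mxact A) w0.
Proof.
apply: (chart_differential_tangent dA) (y_diff n) v => //; exact: box_lt1.
Qed.

Lemma tangent_neq0 : w0 != 0.
Proof.
have [c c0 hc] := orbit_height nlw P0 wP.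
have := tangent_lower (i 0%N) v (y_box 0) c0 (hc _ _ _ (y_box 0) (y_pt 0) (y_nz 0)).
rewrite -/w0 => h; apply: contra_neq v0 => e; apply/eqP; rewrite -normr_le0.
move: h; rewrite e normr0 mulr0 => h.
by rewrite -(pmulr_rle0 _ c0).
Qed.

(** Read in the plane, the n-th tangent vector is A^n w0, and chart norms are
    comparable with the planar norm at heights bounded below. *)
Lemma tangent_bounds : exists a b, [/\ 0 < a, 0 < b & forall n,
  a * enorm (iter n (mxact A) w0) <= `|v *m J n| <= b * enorm (iter n (mxact A) w0)].
Proof.
have [c c0 hc] := orbit_height nlw P0 wP.
have b0 := enorm_bound_gt0 E.
exists (2 * enorm_bound E)^-1, (2 / c); split; [by rewrite invr_gt0 mulr_gt0|by rewrite divr_gt0|].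
move=> n; apply/andP; split.
  rewrite ler_pdivrMl ?mulr_gt0//.
  apply: le_trans (enorm_le _ _) _; rewrite mulrAC mulrC ler_wpM2r ?(ltW b0)//.
  by rewrite -tangent_iter; exact: tangent_upper.
rewrite mulrAC ler_pdivlMr// mulrC.
apply: le_trans (tangent_lower (i n) _ (y_box n) c0 (hc _ _ _ (y_box n) (y_pt n) (y_nz n))) _.
by rewrite tangent_iter ler_wpM2l// norm_le_enorm.
Qed.

Lemma exponent_unst : cu E w0 != 0 -> ln `|v *m J n| / n%:R @[n --> \oo] --> ln lam.
Proof.
move=> x0; have [a [b [a0 b0 hab]]] := tangent_bounds.
have l0 := lam_gt0 lam1; have X0 : 0 < `|cu E w0| by rewrite normr_gt0.
have eW : 0 < enorm w0 by rewrite enorm_gt0; exact: tangent_neq0.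
apply: (@growth_rate _ (a * `|cu E w0|) (b * enorm w0)) => [|||n]; rewrite ?mulr_gt0//.
have /andP[h1 h2] := hab n; have ln0 : 0 < lam ^+ n by rewrite exprn_gt0.
have lv0 := lamV_gt0 lam1.
apply/andP; split.
  apply: le_trans h1; rewrite -mulrA ler_wpM2l ?(ltW a0)// enormE cu_iter normrM.
  by rewrite (gtr0_norm ln0) mulrC lerDl.
apply: le_trans h2 _; rewrite -mulrA ler_wpM2l ?(ltW b0)//.
rewrite [enorm (iter _ _ _)]enormE cu_iter cs_iter !normrM (gtr0_norm ln0) [enorm w0]enormE.
rewrite mulrDl mulrC lerD// mulrC ler_wpM2l//.
rewrite normrX (gtr0_norm lv0); apply: (@le_trans _ _ 1).
  by rewrite exprn_ile1 ?(ltW lv0)// ltW// lamV_lt1.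
by rewrite exprn_ege1// ltW.
Qed.

Lemma exponent_stab : cu E w0 = 0 -> ln `|v *m J n| / n%:R @[n --> \oo] --> - ln lam.
Proof.
move=> x0; have [a [b [a0 b0 hab]]] := tangent_bounds.
have lv0 := lamV_gt0 lam1; have l0 := lam_gt0 lam1.
have eW : 0 < enorm w0 by rewrite enorm_gt0; exact: tangent_neq0.
rewrite -lnV ?posrE//.
have hE n : enorm (iter n (mxact A) w0) = enorm w0 * lam^-1 ^+ n.
  rewrite !enormE cu_iter cs_iter x0 mulr0 normr0 !add0r normrM mulrC normrX.
  by rewrite (gtr0_norm lv0).
apply: (@growth_rate _ (a * enorm w0) (b * enorm w0)) => [|||n]; rewrite ?mulr_gt0//.
by have := hab n; rewrite hE !mulrA.
Qed.

End Exponent.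

(** The tangent dynamics is that of A: a vector with a nonzero unstable
    coordinate grows like lam^n, any other one decays like lam^-n. *)
Theorem periodic_exponents (w : 'rV[R]_2) (P : nat) (chi : R) :
  ~ lattice w -> (0 < P)%N -> lattice (iter P (mxact A) w - w) ->
  lyapunov_exponent f (surf_pt 1 w) chi <-> chi = ln lam \/ chi = - ln lam.
Proof.
move=> nlw P0 wP; split.
  move=> [i [y [J [v [v0 ys yb yd yc]]]]].
  have [x0|x0] := eqVneq (cu E (chart_tangent (i 0%N) (y 0%N) v)) 0.
    right; have h := exponent_stab nlw P0 wP v0 ys yb yd x0.
    exact: (cvg_unique (@norm_hausdorff _ R) yc h).
  left; have h := exponent_unst nlw P0 wP v0 ys yb yd x0.
  exact: (cvg_unique (@norm_hausdorff _ R) yc h).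
have cover n : exists q : 'I_2 * 'rV[R]_2, [/\ chart_box q.2, q.2 ord0 ord0 != 0 &
    surf_chart q.1 q.2 = surf_pt 1 (iter n (mxact A) w)].
  have [i [y hy]] := chart_cover (nonlattice_iter dA (n := n) nlw).
  by exists (i, y).
have [iy hiy] := choice cover.
pose i n := (iy n).1; pose y n := (iy n).2.
have yb n : chart_box (y n) by case: (hiy n).
have y0 n : y n ord0 ord0 != 0 by case: (hiy n).
have ye n : surf_chart (i n) (y n) = surf_pt 1 (iter n (mxact A) w) by case: (hiy n).
have diff n : exists J, chart_differential (iter n f) (i 0%N) (y 0%N) (i n) (y n) J.
  apply: chart_differential_exists => //; try exact: box_lt1.
  by rewrite !ye surf_pt1_iter.
have [J yd] := choice diff.
have ys : surf_chart (i 0%N) (y 0%N) = surf_pt 1 w by exact: ye.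
have solve t : t != 0 -> exists2 v, v != 0 & chart_tangent (i 0%N) (y 0%N) v = t.
  move=> t0; pose v : 'rV[R]_2 := \row_k (if k == ord0 then t ord0 (i 0%N) else
    (t ord0 (other (i 0%N)) - y 0%N ord0 ord_max * t ord0 (i 0%N)) / y 0%N ord0 ord0).
  have e : chart_tangent (i 0%N) (y 0%N) v = t.
    have yn := y0 0%N; rewrite /chart_tangent !mxE /=.
    apply: row2P; rewrite !mxE /other; case: (ord2P (i 0%N)) => -> /=; field; exact: yn.
  exists v => //; apply: contra_neq t0 => v0; rewrite -e v0 /chart_tangent !mxE.
  by rewrite !mulr0 addr0 !scale0r addr0.
move=> hchi.
have [t [t0 ht]] : exists t, t != 0 /\
   forall v, v != 0 -> chart_tangent (i 0%N) (y 0%N) v = t ->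
     ln `|v *m J n| / n%:R @[n --> \oo] --> chi.
  case: hchi => ->.
    exists (bu E); split; first exact: bu_neq0.
    move=> v v0 e; apply: (exponent_unst nlw P0 wP v0 ys yb yd).
    by rewrite e cu_bu oner_eq0.
  exists (bs E); split; first exact: bs_neq0.
  move=> v v0 e; apply: (exponent_stab nlw P0 wP v0 ys yb yd).
  by rewrite e cu_bs.
have [v v0 e] := solve t t0.
by exists i, y, J, v; split => //; exact: ht.
Qed.

End Lyapunov.

(** * The limits of ergodic measures *)

Section Atoms.
Context {R : realType} {T : ptopologicalType}.

Lemma same_dirac_atom (mu : probability (borel T) R) (p : T) :
  measurable ([set p] : set (borel T)) ->
  same_measure mu (\d_(p : borel T)) -> mu [set p] = 1%E.
Proof. by move=> mp /(_ _ mp) ->; rewrite diracE mem_set. Qed.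

(** A measure that agrees with a Dirac mass takes only the values 0 and 1. *)
Lemma same_dirac_ergodic (f : T -> T) (mu : probability (borel T) R) (p : T) :
  invariant_measure f mu -> same_measure mu (\d_(p : borel T)) ->
  ergodic_measure f mu.
Proof.
move=> mu_inv h; split => // B mB _; rewrite h// diracE.
by case: (p \in B); [right|left].
Qed.

End Atoms.

Section Exponents.
Context (R : realType) (A : 'M[int]_2) (lam : R) (E : eigenframe A lam).
Hypotheses (dA : \det A = 1) (lam1 : 1 < lam).
Local Notation f := (blowup_map A : surface R -> surface R).

Lemma periodic_orbit_exponents (v : 'rV[R]_2) p (z : surface R) (chi : R) :
  ~ lattice v -> iter p.+1 f (surf_pt 1 v) = surf_pt 1 v ->
  full_orbit f (surf_pt 1 v) z ->
  lyapunov_exponent f z chi <-> chi = ln lam \/ chi = - ln lam.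
Proof.
move=> nlv vp [k _ <-]; rewrite surf_pt1_iter//.
apply: (periodic_exponents E dA lam1 (P := p.+1)) => //; first exact: nonlattice_iter.
move: vp; rewrite surf_pt1_iter// => /surf_pt1_inj l.
rewrite -iterD addnC iterD -iter_mxactB; apply: iter_mxact_lattice.
by apply: l => //; exact: nonlattice_iter.
Qed.

End Exponents.

Unset Implicit Arguments.
Set Strict Implicit.
Set Printing Implicit Defensive.

Theorem theorem3 (R : realType) (A : 'M[int]_2) (lam : R)
    (detA : \det A = 1)
    (lam_gt1 : 1 < lam)
    (eig_lam : eigenvalue (map_mx intr A) lam)
    (eig_lamV : eigenvalue (map_mx intr A) lam^-1)
    (p1 p2 : surface R)
    (p1_exc : exceptional R p1) (p1_fix : blowup_map A p1 = p1)
    (p2_exc : exceptional R p2) (p2_fix : blowup_map A p2 = p2)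
    (p12 : p1 <> p2)
    (mu : probability (borel (surface R)) R)
    (mu_inv : invariant_measure (blowup_map A) mu) :
  [/\ (exists nu : nat -> probability (borel (surface R)) R,
         (forall n, ergodic_measure (blowup_map A) (nu n)) /\
         weak_star_cvg nu mu)
      <->
      ((same_measure mu (\d_(p1 : borel (surface R))) \/ same_measure mu (\d_(p2 : borel (surface R)))) \/
       mu [set p1] = mu [set p2]),
      (same_measure mu (\d_(p1 : borel (surface R))) \/ same_measure mu (\d_(p2 : borel (surface R)))) ->
      forall nu : nat -> probability (borel (surface R)) R,
        (forall n, ergodic_measure (blowup_map A) (nu n)) ->
        weak_star_cvg nu mu ->
        \forall n \near \oo, same_measure (nu n) mu
    & mu [set p1] = mu [set p2] ->
      exists nu : nat -> probability (borel (surface R)) R,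
        (forall n,
           invariant_measure (blowup_map A) (nu n) /\
           exists x : surface R,
             [/\ periodic_point (blowup_map A) x,
                 nu n (full_orbit (blowup_map A) x) = 1%E &
                 forall (z : surface R) (chi : R),
                   full_orbit (blowup_map A) x z ->
                   lyapunov_exponent (blowup_map A) z chi <->
                   chi = ln lam \/ chi = - ln lam]) /\
        weak_star_cvg nu mu].
Proof.
have [E] := eigenframe_exists lam_gt1 eig_lam eig_lamV.
have pp : (p1 = p_unst E /\ p2 = p_stab E) \/ (p1 = p_stab E /\ p2 = p_unst E).
  have [e1|e1] := exc_fix E detA lam_gt1 p1_exc p1_fix;
    have [e2|e2] := exc_fix E detA lam_gt1 p2_exc p2_fix;
    by [case: p12; rewrite e1 e2|left|right].
have m1 : measurable ([set p1] : set (borel (surface R))).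
  by case: pp => -[-> _]; [exact: measurable_unst|exact: measurable_stab].
have m2 : measurable ([set p2] : set (borel (surface R))).
  by case: pp => -[_ ->]; [exact: measurable_stab|exact: measurable_unst].
have gapE : mu [set p1] = mu [set p2] <-> mu [set p_unst E] = mu [set p_stab E].
  by case: pp => -[-> ->]; split => ->.
have approx : mu [set p1] = mu [set p2] -> exists (z : nat -> 'rV[R]_2) (p : nat -> nat),
    (forall n, ~ lattice (z n) /\
       iter (p n).+1 (blowup_map A) (surf_pt 1 (z n)) = surf_pt 1 (z n)) /\
    weak_star_cvg (fun n => orbit_prob (R := R) (blowup_map A) (surf_pt 1 (z n)) (p n)) mu.
  by move/gapE => gap; exact: (periodic_approximation (E := E) detA lam_gt1 mu_inv gap).
split.
- split=> [[nu [nu_erg nu_mu]]|[dirac|/approx[z [p [hz hmu]]]]].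
  + have [gap|h] := limit_gap E detA lam_gt1 mu_inv nu_erg nu_mu.
      by right; apply/gapE.
    left; have [h1|h2] : mu [set p1] = 1%E \/ mu [set p2] = 1%E.
      by case: pp => -[-> ->]; case: h => h; [left|right|right|left].
    * by left; exact: atom_same_measure.
    * by right; exact: atom_same_measure.
  + exists (fun=> mu); split=> [n|g cg]; last exact: cvg_cst.
    by case: dirac; exact: same_dirac_ergodic.
  + exists (fun n => orbit_prob (R := R) (blowup_map A) (surf_pt 1 (z n)) (p n)); split => // n.
    by apply: (orbit_ergodic (ltn0Sn (p n)) (hz n).2) => B; exact: orbit_measureE.
- move=> dirac nu nu_erg nu_mu.
  have lim p : p = p1 \/ p = p2 -> mu [set p] = 1%E ->
      \forall n \near \oo, nu n [set p] = 1%E.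
    have : (p = p1 \/ p = p2) -> p = p_unst E \/ p = p_stab E.
      by case: pp => -[-> ->] [->|->]; [left|right|right|left].
    move=> h /h[->|->].
      exact: (limit_unst detA lam_gt1 mu_inv nu_erg nu_mu).
    exact: (limit_stab detA lam_gt1 mu_inv nu_erg nu_mu).
  have fin p : p = p1 \/ p = p2 -> measurable ([set p] : set (borel (surface R))) ->
      same_measure mu (\d_(p : borel (surface R))) ->
      \forall n \near \oo, same_measure (nu n) mu.
    move=> hp mp h; have := lim p hp (same_dirac_atom mp h).
    apply: filterS => n /(atom_same_measure mp) hn B mB.
    by rewrite hn// h.
  by case: dirac; apply: fin => //; [left|right].
- move=> /approx[z [p [hz hmu]]].
  exists (fun n => orbit_prob (R := R) (blowup_map A) (surf_pt 1 (z n)) (p n)); split => // n.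
  have [nlz zp] := hz n.
  have nuE (B : set (surface R)) :
      orbit_prob (blowup_map A) (surf_pt 1 (z n)) (p n) B =
      (orbit_count (blowup_map A) (surf_pt 1 (z n)) (p n).+1 B)%:E :> \bar R.
    exact: orbit_measureE.
  split; first exact: (orbit_invariant (ltn0Sn (p n)) zp nuE).
  exists (surf_pt 1 (z n)); split.
  + by exists (p n).+1.
  + exact: (orbit_full (ltn0Sn (p n)) nuE).
  + by move=> y chi hy; apply: (periodic_orbit_exponents E detA lam_gt1 _ nlz zp hy).
Qed.
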